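(* Let $\alpha>0$ and $(x,y)\in D_+$. Then $$\theta_{(1/2,\sqrt3/2)}(b;\alpha)\ge\theta_{(x,y)}(b;\alpha)\quad\text{and}\quad \widehat\theta_{(1/2,\sqrt3/2)}(b;\alpha)\ge\widehat\theta_{(x,y)}(b;\alpha),$$ where on each side $b=b(x,y)$ is evaluated at the respective parameters, and equality holds in either inequality if and only if $(x,y)=(1/2,\sqrt3/2)$.
   Context: $D_+=\{(x,y)\in\mathbb{R}^2: 0\le x\le\tfrac12,\ y>0,\ x^2+y^2\ge1\}$. For $(x,y)$ with $y>0$ and $c=(c_1,c_2)\in\mathbb{R}^2$, $\alpha>0$, define $$\theta_{(x,y)}(c;\alpha)=\sum_{k,l\in\mathbb{Z}}\exp\!\Big(-\tfrac{\pi\alpha}{y}\big((k+c_1)^2+2x(k+c_1)(l+c_2)+(x^2+y^2)(l+c_2)^2\big)\Big),$$ $$\widehat\theta_{(x,y)}(c;\alpha)=\sum_{k,l\in\mathbb{Z}}\exp\!\Big(-\tfrac{\pi\alpha}{y}\big(k^2+2xkl+(x^2+y^2)l^2\big)\Big)e^{2\pi i(kc_2-lc_1)}.$$ (These are the Gaussian sums over the covolume-one lattice with basis $y^{-1/2}(1,0),y^{-1/2}(x,y)$; the parameter $(1/2,\sqrt3/2)$ gives the hexagonal lattice.) The point $b=b(x,y)=(b_1,b_2)$ is $$b_1=\frac{x+(1-x)4y^2}{8y^2},\qquad b_2=\frac{4y^2-1}{8y^2}.$$ *)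

(* Defs.v *)
From Stdlib Require Import Reals ZArith.
From Coquelicot Require Import Coquelicot.
Open Scope R_scope.

Definition inDplus (x y : R) : Prop :=
  0 <= x <= 1/2 /\ 0 < y /\ x ^ 2 + y ^ 2 >= 1.

(* Sum over Z, split into the nonnegative and the negative indices.
   Used only on absolutely summable families. *)
Definition zsum (f : Z -> R) : R :=
  Series (fun n : nat => f (Z.of_nat n)) +
  Series (fun n : nat => f (- Z.of_nat (S n))%Z).

(* Sum over Z^2 (iterated; equals the double sum for absolutely summable families). *)
Definition zsum2 (f : Z -> Z -> R) : R :=
  zsum (fun k => zsum (fun l => f k l)).

Definition qform (x y u v : R) : R :=
  (u ^ 2 + 2 * x * u * v + (x ^ 2 + y ^ 2) * v ^ 2) / y.

Definition theta (x y c1 c2 alpha : R) : R :=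
  zsum2 (fun k l =>
    exp (- PI * alpha * qform x y (IZR k + c1) (IZR l + c2))).

(* hat-theta_{(x,y)}(c; alpha).  The complex sum
     sum exp(-pi alpha Q(k,l)) e^{2 pi i (k c2 - l c1)}
   is real (the terms at (k,l) and (-k,-l) are complex conjugate), and equals
   the sum with e^{...} replaced by its real part cos(...). *)
Definition thetahat (x y c1 c2 alpha : R) : R :=
  zsum2 (fun k l =>
    exp (- PI * alpha * qform x y (IZR k) (IZR l)) *
    cos (2 * PI * (IZR k * c2 - IZR l * c1))).

Definition b1 (x y : R) : R := (x + (1 - x) * 4 * y ^ 2) / (8 * y ^ 2).
Definition b2 (x y : R) : R := (4 * y ^ 2 - 1) / (8 * y ^ 2).

Definition hx : R := 1/2.
Definition hy : R := sqrt 3 / 2.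

(* Main.v *)
(* Write v = 1/y. By Poisson summation (obtained as the limit of the finite Fourier identity for
   random walks on a cycle, after Polya) thetahat at alpha is theta at 1/alpha divided by alpha, so
   both inequalities are needed only for alpha >= 1.

   For fixed y the value x = 1/2 is optimal. If alpha y >= 1/2, rows of the translated lattice are
   compared: odd rows gain, even rows lose at most l^2 times as much because 1 - cos (l t) <=
   l^2 (1 - cos t), and their Gaussian weights are much smaller. Otherwise one uses the twisted sum,
   where it suffices that a twisted one-dimensional Gaussian sum is minimal at 1/2; this is read off
   by pairing the terms k and -1-k.

   On the line x = 1/2 the point b is the circumcenter of an isosceles triangle. At the hexagonal
   lattice the first variation vanishes by symmetry. Near it, the quadratic increase of the
   circumradius (for theta), respectively the second variation of the first dual shell (for
   thetahat), beats the second-order remainder of all other shells; away from it crude bounds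
   suffice. *)

Require Import Defs.
From Stdlib Require Import Bool Reals ZArith List Lra Lia Psatz.
From Coquelicot Require Import Coquelicot.
Open Scope R_scope.

(** * Sums over Z and Z^2 *)

(** The same point b serves both sums for a structural reason: it is equidistant from the ends of
    the horizontal edge, so every row of [theta] is offset by 1/2, while every row of [thetahat]
    carries the sign (-1)^l. Offset 1/2 and alternating sign are Fourier duals, and this is what
    makes the family closed under Poisson summation.

    For the horizontal step two methods have to cover all parameters of [thetahat]. Comparing rows
    of [theta] works as soon as [alpha * y >= 1/2], which is more than [alpha >= 1] requires;
    dualized, it settles [thetahat] for [alpha / y <= 2]. The pairing argument starts exactly there,
    where [PI * alpha / y > 6] makes all pairs after the first negligible.

    For the vertical step [alpha >= 1] gives [a = PI * alpha >= 3.14]. The factor [a] or [a ^ 2]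
    produced by second-order terms is always absorbed by exponentials such as [a * exp (- (c * a))],
    which decrease from there on, so the numerical checks can be made at [a = 3.14]. The margins
    near the hexagonal lattice are thin, which fixes the cut points 0.9 and 1.05 for [v]. *)

Definition decay (e : R) (k : Z) : R := exp (- e * Rabs (IZR k)).

(* [gb1], [gb2]: exponential decay, the class of families in which sums over Z and Z^2
   are linear, reindexable and interchangeable. *)
Definition gb1 (f : Z -> R) : Prop :=
  exists C e, 0 < e /\ forall k, Rabs (f k) <= C * decay e k.

Definition gb2 (f : Z -> Z -> R) : Prop :=
  exists C e, 0 < e /\ forall k l, Rabs (f k l) <= C * (decay e k * decay e l).

(** The pairing of [n] with [- n - 1] merges the two series of [zsum] into one. It is symmetric
    about -1/2, which later suits a Gaussian centred at a half-integer. *)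
Definition fold_pair (f : Z -> R) (n : nat) : R :=
  f (Z.of_nat n) + f (- Z.of_nat (S n))%Z.

Lemma exp_le x y : x <= y -> exp x <= exp y.
Proof. intros [H | ->]; [left; now apply exp_increasing | lra]. Qed.

Lemma exp_mult_nat x n : exp x ^ n = exp (INR n * x).
Proof.
  induction n as [|n IH].
  - simpl. now rewrite Rmult_0_l, exp_0.
  - rewrite <- tech_pow_Rmult, IH, <- exp_plus, S_INR. f_equal. ring.
Qed.

Lemma Series_nonneg (a : nat -> R) : ex_series a -> (forall n, 0 <= a n) -> 0 <= Series a.
Proof.
  intros Ha H. replace 0 with (Series (fun n : nat => 0 * 0)).
  - apply Series_le; [|assumption]. intros n. rewrite Rmult_0_l. split; [lra | apply H].
  - rewrite (Series_scal_l 0 (fun _ => 0)); ring.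
Qed.

Lemma decay_pos e k : 0 < decay e k.
Proof. apply exp_pos. Qed.

Lemma decay_mono e e' k : e <= e' -> decay e' k <= decay e k.
Proof.
  intros He. unfold decay. apply exp_le.
  generalize (Rabs_pos (IZR k)); nra.
Qed.

Lemma decay_neg e k : decay e (- k) = decay e k.
Proof. unfold decay. rewrite opp_IZR, Rabs_Ropp. reflexivity. Qed.

Lemma decay_nat e n : decay e (Z.of_nat n) = exp (- e) ^ n.
Proof.
  unfold decay. rewrite <- INR_IZR_INZ, Rabs_pos_eq by apply pos_INR.
  rewrite exp_mult_nat. f_equal. ring.
Qed.

Lemma decay_add e k l : 0 <= e -> decay e k <= exp (e * Rabs (IZR l)) * decay e (k + l).
Proof.
  intros He. unfold decay. rewrite <- exp_plus. apply exp_le. rewrite plus_IZR.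
  assert (Rabs (IZR k + IZR l) <= Rabs (IZR k) + Rabs (IZR l)) by apply Rabs_triang.
  nra.
Qed.

Lemma gb_const_nonneg C (f : R) d : Rabs f <= C * d -> 0 < d -> 0 <= C.
Proof.
  intros H Hd. generalize (Rabs_pos f); intros. 
  destruct (Rle_lt_dec 0 C); [assumption | nra].
Qed.

Lemma exp_neg_lt1 e : 0 < e -> 0 < exp (- e) < 1.
Proof.
  intros. split; [apply exp_pos|]. rewrite <- exp_0. apply exp_increasing. lra.
Qed.

Lemma ex_series_decay C e : 0 < e -> ex_series (fun n => C * exp (- e) ^ n).
Proof.
  intros He. apply (ex_series_scal C (fun n => exp (- e) ^ n)).
  apply ex_series_geom. rewrite Rabs_pos_eq; apply exp_neg_lt1 in He; lra.
Qed.

Lemma gb1_ex_pos f : gb1 f -> ex_series (fun n : nat => f (Z.of_nat n)).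
Proof.
  intros (C & e & He & H).
  apply (@ex_series_le R_AbsRing R_CompleteNormedModule _ (fun n => C * exp (- e) ^ n)).
  - intros n. change (norm ?x) with (Rabs x). rewrite <- decay_nat. apply H.
  - apply ex_series_decay, He.
Qed.

Lemma gb1_ex_neg f : gb1 f -> ex_series (fun n : nat => f (- Z.of_nat (S n))%Z).
Proof.
  intros (C & e & He & H).
  apply (@ex_series_le R_AbsRing R_CompleteNormedModule _ (fun n => C * exp (- e) ^ n)).
  - intros n. change (norm ?x) with (Rabs x). rewrite <- decay_nat.
    eapply Rle_trans; [apply H|]. rewrite decay_neg.
    apply Rmult_le_compat_l.
    + eapply gb_const_nonneg; [apply (H 0%Z) | apply decay_pos].
    + rewrite !decay_nat. simpl.
      assert (B := exp_neg_lt1 e He). 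
      assert (0 < exp (-e) ^ n) by (apply pow_lt; lra). nra.
  - apply ex_series_decay, He.
Qed.

Lemma zsum_fold f : gb1 f -> zsum f = Series (fold_pair f).
Proof.
  intros H. unfold zsum, fold_pair. symmetry. apply Series_plus.
  - apply gb1_ex_pos, H.
  - apply gb1_ex_neg, H.
Qed.

Lemma gb1_ex_fold f : gb1 f -> ex_series (fold_pair f).
Proof.
  intros H. apply (ex_series_plus (fun n => f (Z.of_nat n)) (fun n => f (- Z.of_nat (S n))%Z)).
  - apply gb1_ex_pos, H.
  - apply gb1_ex_neg, H.
Qed.

Lemma zsum_ext f g : (forall k, f k = g k) -> zsum f = zsum g.
Proof. intros H. unfold zsum. f_equal; apply Series_ext; intros; apply H. Qed.

Lemma zsum2_ext f g : (forall k l, f k l = g k l) -> zsum2 f = zsum2 g.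
Proof. intros H. apply zsum_ext. intros k. apply zsum_ext, H. Qed.

Lemma zsum_scal c f : zsum (fun k => c * f k) = c * zsum f.
Proof. unfold zsum. rewrite !Series_scal_l. ring. Qed.

Lemma zsum_plus f g : gb1 f -> gb1 g -> zsum (fun k => f k + g k) = zsum f + zsum g.
Proof.
  intros Hf Hg. unfold zsum.
  rewrite (Series_plus (fun n => f (Z.of_nat n)) (fun n => g (Z.of_nat n))).
  rewrite (Series_plus (fun n => f (- Z.of_nat (S n))%Z) (fun n => g (- Z.of_nat (S n))%Z)).
  ring.
  all: auto using gb1_ex_pos, gb1_ex_neg.
Qed.

Lemma gb1_scal c f : gb1 f -> gb1 (fun k => c * f k).
Proof.
  intros (C & e & He & H). exists (Rabs c * C), e. split; [assumption|]. intros k.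
  rewrite Rabs_mult, Rmult_assoc. apply Rmult_le_compat_l; [apply Rabs_pos | apply H].
Qed.

Lemma gb1_plus f g : gb1 f -> gb1 g -> gb1 (fun k => f k + g k).
Proof.
  intros (C & e & He & H) (C' & e' & He' & H'). exists (C + C'), (Rmin e e').
  split; [now apply Rmin_glb_lt|]. intros k.
  eapply Rle_trans; [apply Rabs_triang|].
  assert (D1 := decay_mono _ _ k (Rmin_l e e')).
  assert (D2 := decay_mono _ _ k (Rmin_r e e')).
  assert (0 <= C) by (eapply gb_const_nonneg; [apply (H 0%Z) | apply decay_pos]).
  assert (0 <= C') by (eapply gb_const_nonneg; [apply (H' 0%Z) | apply decay_pos]).
  specialize (H k); specialize (H' k). nra.
Qed.

Lemma zsum_nonneg f : gb1 f -> (forall k, 0 <= f k) -> 0 <= zsum f.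
Proof.
  intros Hf H. unfold zsum. apply Rplus_le_le_0_compat; apply Series_nonneg.
  - apply gb1_ex_pos, Hf.
  - intros; apply H.
  - apply gb1_ex_neg, Hf.
  - intros; apply H.
Qed.

Lemma zsum_le f g : gb1 f -> gb1 g -> (forall k, f k <= g k) -> zsum f <= zsum g.
Proof.
  intros Hf Hg H.
  assert (0 <= zsum (fun k => g k + - 1 * f k)).
  { apply zsum_nonneg; [now apply gb1_plus; [|apply gb1_scal] |].
    intros k. generalize (H k); lra. }
  rewrite (zsum_plus g (fun k => -1 * f k)), zsum_scal in H0;
    [lra | assumption | now apply gb1_scal].
Qed.

Lemma zsum_abs_le f g : gb1 f -> gb1 g -> (forall k, Rabs (f k) <= g k) -> Rabs (zsum f) <= zsum g.
Proof.
  intros Hf Hg H. apply Rabs_le. split.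
  - rewrite <- (Rmult_1_l (zsum g)), <- Ropp_mult_distr_l_reverse, <- zsum_scal.
    apply zsum_le; [now apply gb1_scal | assumption |].
    intros k. generalize (Rabs_maj2 (f k)) (H k); lra.
  - apply zsum_le; try assumption. intros k. generalize (Rle_abs (f k)) (H k); lra.
Qed.

Lemma gb1_decay e : 0 < e -> gb1 (decay e).
Proof.
  intros. exists 1, e. split; [assumption|]. intros.
  rewrite Rabs_pos_eq by (left; apply decay_pos). lra.
Qed.

Lemma zsum_decay e : 0 < e -> zsum (decay e) = (1 + exp (- e)) / (1 - exp (- e)).
Proof.
  intros He. assert (B := exp_neg_lt1 e He). unfold zsum.
  rewrite (Series_ext _ (fun n => exp (- e) ^ n)) by (intros; apply decay_nat).
  rewrite (Series_ext (fun n => decay e (- Z.of_nat (S n)))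
             (fun n => exp (- e) * exp (- e) ^ n))
    by (intros; rewrite decay_neg, decay_nat; reflexivity).
  rewrite Series_scal_l, !Series_geom by (rewrite Rabs_pos_eq; lra).
  field. lra.
Qed.

Lemma gb1_succ f : gb1 f -> gb1 (fun k => f (k + 1)%Z).
Proof.
  intros (C & e & He & H). exists (C * exp e), e. split; [assumption|]. intros k.
  eapply Rle_trans; [apply H|]. rewrite Rmult_assoc. apply Rmult_le_compat_l.
  - eapply gb_const_nonneg; [apply (H 0%Z) | apply decay_pos].
  - generalize (decay_add e (k + 1) (- 1) (Rlt_le _ _ He)).
    replace (k + 1 + -1)%Z with k by ring. rewrite Rabs_left by lra.
    now replace (e * - -1) with e by ring.
Qed.

Lemma gb1_neg f : gb1 f -> gb1 (fun k => f (- k)%Z).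
Proof.
  intros (C & e & He & H). exists C, e. split; [assumption|]. intros k.
  rewrite <- decay_neg. apply H.
Qed.

Lemma gb1_shift_nat f n : gb1 f -> gb1 (fun k => f (k + Z.of_nat n)%Z).
Proof.
  intros Hf. induction n.
  - destruct Hf as (C & e & He & H). exists C, e. split; [assumption|]. intros k.
    rewrite Z.add_0_r. apply H.
  - apply gb1_succ in IHn. destruct IHn as (C & e & He & H). exists C, e.
    split; [assumption|]. intros k.
    replace (k + Z.of_nat (S n))%Z with (k + 1 + Z.of_nat n)%Z by lia. apply H.
Qed.

Lemma gb1_ext f g : (forall k, f k = g k) -> gb1 f -> gb1 g.
Proof.
  intros E (C & e & He & H). exists C, e. split; [assumption|]. intros k.
  rewrite <- E. apply H.
Qed.

Lemma gb1_shift f j : gb1 f -> gb1 (fun k => f (k + j)%Z).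
Proof.
  intros Hf. destruct (Z_le_gt_dec 0 j).
  - rewrite <- (Z2Nat.id j) by assumption. now apply gb1_shift_nat.
  - apply (gb1_ext (fun k => (fun k' => f (- k'))%Z (- k + Z.of_nat (Z.to_nat (- j)))%Z)).
    + intros k. f_equal. rewrite Z2Nat.id by lia. ring.
    + apply (gb1_neg (fun k => f (- (k + Z.of_nat (Z.to_nat (- j))))%Z)).
      apply (gb1_shift_nat (fun k => f (- k)%Z)). now apply gb1_neg.
Qed.

Lemma zsum_succ f : gb1 f -> zsum (fun k => f (k + 1)%Z) = zsum f.
Proof.
  intros Hf. unfold zsum.
  rewrite (Series_incr_1 (fun n => f (Z.of_nat n))) by now apply gb1_ex_pos.
  rewrite (Series_ext (fun n => f (Z.of_nat n + 1)%Z) (fun n => f (Z.of_nat (S n))))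
    by (intros; f_equal; lia).
  rewrite (Series_incr_1 (fun n => f (- Z.of_nat (S n) + 1)%Z)).
  - rewrite (Series_ext (fun n => f (- Z.of_nat (S (S n)) + 1)%Z) (fun n => f (- Z.of_nat (S n))%Z))
      by (intros; f_equal; lia).
    replace (- Z.of_nat 1 + 1)%Z with (Z.of_nat 0) by reflexivity. ring.
  - apply (gb1_ex_neg (fun k => f (k + 1)%Z)). now apply gb1_succ.
Qed.

Lemma zsum_neg f : gb1 f -> zsum (fun k => f (- k)%Z) = zsum f.
Proof.
  intros Hf. unfold zsum.
  rewrite (Series_incr_1 (fun n => f (Z.of_nat n))) by now apply gb1_ex_pos.
  rewrite (Series_incr_1 (fun n => f (- Z.of_nat n)%Z)).
  - rewrite (Series_ext (fun n => f (- - Z.of_nat (S n))%Z) (fun n => f (Z.of_nat (S n))))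
      by (intros; f_equal; lia).
    replace (- Z.of_nat 0)%Z with (Z.of_nat 0) by reflexivity. ring.
  - apply (gb1_ex_pos (fun k => f (- k)%Z)). now apply gb1_neg.
Qed.

Lemma zsum_shift_nat f n : gb1 f -> zsum (fun k => f (k + Z.of_nat n)%Z) = zsum f.
Proof.
  intros Hf. induction n.
  - apply zsum_ext. intros. f_equal. lia.
  - rewrite <- IHn, <- (zsum_succ (fun k => f (k + Z.of_nat n)%Z)) by now apply gb1_shift_nat.
    apply zsum_ext. intros. f_equal. lia.
Qed.

Lemma zsum_shift f j : gb1 f -> zsum (fun k => f (k + j)%Z) = zsum f.
Proof.
  intros Hf. destruct (Z_le_gt_dec 0 j).
  - rewrite <- (Z2Nat.id j) by assumption. now apply zsum_shift_nat.
  - rewrite <- (zsum_shift_nat (fun k => f (k + j)%Z) (Z.to_nat (- j))) by now apply gb1_shift.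
    apply zsum_ext. intros. f_equal. lia.
Qed.

(** Tannery's theorem. All tails are dominated by the tail of [b], which is below eps/3 from some
    index on; the remaining head is a finite sum and converges term by term. *)
Lemma Series_dominated (a : nat -> nat -> R) (b l : nat -> R) :
  ex_series b -> (forall N n, Rabs (a N n) <= b n) ->
  (forall n, is_lim_seq (fun N => a N n) (l n)) ->
  is_lim_seq (fun N => Series (a N)) (Series l).
Proof.
  intros Hb Hab Hl.
  assert (Hlb : forall n, Rabs (l n) <= b n).
  { intros n. apply (is_lim_seq_le (fun N => Rabs (a N n)) (fun _ => b n) (Rabs (l n)) (b n)).
    - intros N. apply Hab.
    - apply (is_lim_seq_abs _ (l n)), Hl.
    - apply is_lim_seq_const. }
  assert (Exa : forall N, ex_series (a N)).
  { intros N. apply (@ex_series_le R_AbsRing R_CompleteNormedModule _ b); [apply Hab | assumption]. }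
  assert (Exl : ex_series l).
  { apply (@ex_series_le R_AbsRing R_CompleteNormedModule _ b); [apply Hlb | assumption]. }
  assert (Tail : forall (c : nat -> R) K, (forall n, Rabs (c n) <= b n) ->
     Rabs (Series (fun n => c (S K + n)%nat)) <= Series (fun n => b (S K + n)%nat)).
  { intros c K Hc.
    assert (ex_series (fun n => b (S K + n)%nat)) by now apply (ex_series_incr_n b).
    eapply Rle_trans; [apply Series_Rabs|].
    - apply (@ex_series_le R_AbsRing R_CompleteNormedModule _ (fun n => b (S K + n)%nat)); [|assumption].
      intros n. change (norm ?x) with (Rabs x). rewrite Rabs_Rabsolu. apply Hc.
    - apply Series_le; [|assumption]. intros n; split; [apply Rabs_pos | apply Hc]. }
  assert (TailLim : is_lim_seq (fun K => Series (fun n => b (S K + n)%nat)) 0).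
  { apply (is_lim_seq_ext (fun K => Series b - sum_n b K)).
    - intros K. rewrite sum_n_Reals. rewrite (Series_incr_n b (S K)); [|lia|exact Hb]. simpl pred. lra.
    - replace (Finite 0) with (Rbar_minus (Series b) (Series b)).
      + apply is_lim_seq_minus'; [apply is_lim_seq_const | apply Series_correct, Hb].
      + simpl. f_equal. ring. }
  apply is_lim_seq_spec. intros eps.
  apply is_lim_seq_spec in TailLim.
  destruct (TailLim (mkposreal (eps / 3) ltac:(generalize (cond_pos eps); lra))) as [K HK].
  specialize (HK K (le_n K)). cbn [pos] in HK. rewrite Rminus_0_r in HK.
  assert (Fin : is_lim_seq (fun N => sum_f_R0 (a N) K) (sum_f_R0 l K)).
  { clear HK. induction K; simpl.
    - apply Hl.
    - apply is_lim_seq_plus'; [apply IHK | apply Hl]. }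
  apply is_lim_seq_spec in Fin.
  destruct (Fin (mkposreal (eps / 3) ltac:(generalize (cond_pos eps); lra))) as [N0 HN0].
  exists N0. intros N HN. specialize (HN0 N HN). cbn [pos] in HN0.
  rewrite (Series_incr_n (a N) (S K)), (Series_incr_n l (S K)) by (lia || apply Exa || apply Exl).
  simpl pred.
  assert (T1 := Tail (a N) K (Hab N)). assert (T2 := Tail l K Hlb).
  assert (H3 := Rle_abs (Series (fun n : nat => b (S K + n)%nat))).
  revert HN0 T1 T2 H3 HK. 
  generalize (Series (fun n => a N (S K + n)%nat)) (Series (fun n => l (S K + n)%nat))
    (Series (fun n : nat => b (S K + n)%nat)) (sum_f_R0 (a N) K) (sum_f_R0 l K).
  intros. destruct eps as [eps Heps]; cbn [pos] in *.
  revert HN0 T1 T2 H3 HK. clear. intros HN0 T1 T2 H3 HK.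
  apply Rabs_def2 in HN0. apply Rabs_le_between in T1, T2. apply Rabs_def1; lra.
Qed.

Lemma zsum_dominated (F : nat -> Z -> R) (f : Z -> R) (C e : R) :
  0 < e -> (forall N k, Rabs (F N k) <= C * decay e k) ->
  (forall k, is_lim_seq (fun N => F N k) (f k)) ->
  is_lim_seq (fun N => zsum (F N)) (zsum f).
Proof.
  intros He HF Hl.
  assert (HC : 0 <= C) by (eapply gb_const_nonneg; [apply (HF 0%nat 0%Z) | apply decay_pos]).
  assert (B := exp_neg_lt1 e He).
  apply is_lim_seq_plus'.
  - apply (Series_dominated (fun N n => F N (Z.of_nat n)) (fun n => C * exp (- e) ^ n)).
    + now apply ex_series_decay.
    + intros. rewrite <- decay_nat. apply HF.
    + intros. apply Hl.
  - apply (Series_dominated (fun N n => F N (- Z.of_nat (S n))%Z) (fun n => C * exp (- e) ^ n)).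
    + now apply ex_series_decay.
    + intros. rewrite <- decay_nat. eapply Rle_trans; [apply HF|].
      apply Rmult_le_compat_l; [assumption|]. rewrite decay_neg, !decay_nat. simpl.
      assert (0 < exp (-e) ^ n) by (apply pow_lt; lra). nra.
    + intros. apply Hl.
Qed.

Definition psum (f : Z -> R) (N : nat) : R := sum_n (fold_pair f) N.

Lemma psum_lim f : gb1 f -> is_lim_seq (psum f) (zsum f).
Proof. intros H. rewrite zsum_fold by assumption. now apply Series_correct, gb1_ex_fold. Qed.

Lemma zsum_psum (f : Z -> Z -> R) N : (forall l, gb1 (fun k => f k l)) ->
  gb1 (fun k => psum (f k) N) /\ psum (fun l => zsum (fun k => f k l)) N = zsum (fun k => psum (f k) N).
Proof.
  intros H. unfold psum. induction N as [|N [IH1 IH2]].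
  - split.
    + apply (gb1_ext (fun k => f k 0%Z + f k (-1)%Z)).
      * intros. rewrite sum_O. reflexivity.
      * apply gb1_plus; apply H.
    + rewrite sum_O. unfold fold_pair at 1. rewrite <- zsum_plus by apply H.
      apply zsum_ext. intros k. rewrite sum_O. reflexivity.
  - assert (G : gb1 (fun k => fold_pair (f k) (S N))).
    { apply (gb1_plus (fun k => f k (Z.of_nat (S N))) (fun k => f k (- Z.of_nat (S (S N)))%Z)); apply H. }
    split.
    + apply (gb1_ext (fun k => sum_n (fold_pair (f k)) N + fold_pair (f k) (S N))).
      * intros. now rewrite sum_Sn.
      * now apply gb1_plus.
    + rewrite sum_Sn, IH2.
      transitivity (zsum (fun k => sum_n (fold_pair (f k)) N) + zsum (fun k => fold_pair (f k) (S N))).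
      * change (@plus R_AbelianMonoid) with Rplus. f_equal. unfold fold_pair.
        symmetry. apply (zsum_plus (fun k => f k (Z.of_nat (S N))) (fun k => f k (- Z.of_nat (S (S N)))%Z)); apply H.
      * rewrite <- zsum_plus by assumption.
        apply zsum_ext. intros k. now rewrite sum_Sn.
Qed.

Lemma psum_bound f C e N : 0 < e -> (forall k, Rabs (f k) <= C * decay e k) ->
  Rabs (psum f N) <= C * zsum (decay e).
Proof.
  intros He H.
  assert (HC : 0 <= C) by (eapply gb_const_nonneg; [apply (H 0%Z) | apply decay_pos]).
  assert (G : gb1 (fun k => C * decay e k)) by apply gb1_scal, gb1_decay, He.
  rewrite <- zsum_scal, zsum_fold by assumption.
  apply Rle_trans with (sum_n (fold_pair (fun k => C * decay e k)) N).
  - unfold psum. eapply Rle_trans; [apply (norm_sum_n_m (fold_pair f) 0 N)|].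
    apply sum_n_m_le. intros n. change (norm ?x) with (Rabs x). unfold fold_pair.
    eapply Rle_trans; [apply Rabs_triang|]. apply Rplus_le_compat; apply H.
  - assert (Pos : forall n, 0 <= fold_pair (fun k => C * decay e k) n).
    { intros n. apply Rplus_le_le_0_compat; apply Rmult_le_pos; auto; left; apply decay_pos. }
    apply (is_lim_seq_le_loc (fun _ => sum_n (fold_pair (fun k => C * decay e k)) N)
       (sum_n (fold_pair (fun k => C * decay e k)))
       (sum_n (fold_pair (fun k => C * decay e k)) N) (Series (fold_pair (fun k => C * decay e k)))).
    + exists N. intros n Hn. induction Hn; [lra|]. rewrite sum_Sn. unfold plus; simpl.
      generalize (Pos (S m)); lra.
    + apply is_lim_seq_const.
    + now apply Series_correct, gb1_ex_fold.
Qed.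

Lemma gb2_row f k : gb2 f -> gb1 (f k).
Proof.
  intros (C & e & He & H). exists (C * decay e k), e. split; [assumption|]. intros l.
  rewrite Rmult_assoc. apply H.
Qed.

Lemma gb2_swap f : gb2 f -> gb2 (fun l k => f k l).
Proof.
  intros (C & e & He & H). exists C, e. split; [assumption|]. intros l k.
  rewrite (Rmult_comm (decay e l)). apply H.
Qed.

Lemma gb2_zsum f : gb2 f -> gb1 (fun k => zsum (f k)).
Proof.
  intros Hf. destruct (Hf) as (C & e & He & H). exists (C * zsum (decay e)), e.
  split; [assumption|]. intros k.
  replace (C * zsum (decay e) * decay e k) with (zsum (fun l => C * decay e k * decay e l)).
  - apply zsum_abs_le.
    + now apply gb2_row.
    + now apply gb1_scal, gb1_decay.
    + intros l. rewrite Rmult_assoc. apply H.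
  - rewrite zsum_scal. ring.
Qed.

(** Fubini. A partial sum in [l] commutes with the sum over [k] by finite additivity ([zsum_psum]);
    the partial sums are bounded by [C * zsum (decay e) * decay e k], so dominated convergence lets
    their length tend to infinity. *)
Lemma zsum2_swap f : gb2 f -> zsum2 f = zsum2 (fun l k => f k l).
Proof.
  intros Hf. unfold zsum2.
  assert (L1 := psum_lim _ (gb2_zsum _ (gb2_swap _ Hf))).
  assert (L2 : is_lim_seq (fun N => zsum (fun k => psum (f k) N)) (zsum (fun k => zsum (f k)))).
  { destruct (Hf) as (C & e & He & H).
    apply (zsum_dominated (fun N k => psum (f k) N) _ (C * zsum (decay e)) e He).
    - intros N k. replace (C * zsum (decay e) * decay e k) with (C * decay e k * zsum (decay e)) by ring.
      apply psum_bound; [assumption|]. intros l. rewrite Rmult_assoc. apply H.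
    - intros k. apply psum_lim. now apply gb2_row. }
  apply (is_lim_seq_ext _ (psum (fun l => zsum (fun k => f k l)))) in L2.
  - apply is_lim_seq_unique in L1, L2. rewrite L1 in L2. now injection L2.
  - intros N. symmetry. apply zsum_psum. intros l. now apply (gb2_row (fun l k => f k l)), gb2_swap.
Qed.

Lemma gb1_le f g : gb1 g -> (forall k, Rabs (f k) <= g k) -> gb1 f.
Proof.
  intros (C & e & He & H) Hfg. exists C, e. split; [assumption|]. intros k.
  generalize (Hfg k) (Rle_abs (g k)) (H k). lra.
Qed.

Lemma gb2_le f g : gb2 g -> (forall k l, Rabs (f k l) <= g k l) -> gb2 f.
Proof.
  intros (C & e & He & H) Hfg. exists C, e. split; [assumption|]. intros k l.
  generalize (Hfg k l) (Rle_abs (g k l)) (H k l). lra.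
Qed.

Lemma gb2_ext f g : (forall k l, f k l = g k l) -> gb2 f -> gb2 g.
Proof.
  intros E (C & e & He & H). exists C, e. split; [assumption|]. intros k l.
  rewrite <- E. apply H.
Qed.

Lemma gb2_scal c f : gb2 f -> gb2 (fun k l => c * f k l).
Proof.
  intros (C & e & He & H). exists (Rabs c * C), e. split; [assumption|]. intros k l.
  rewrite Rabs_mult, Rmult_assoc. apply Rmult_le_compat_l; [apply Rabs_pos | apply H].
Qed.

Lemma gb2_plus f g : gb2 f -> gb2 g -> gb2 (fun k l => f k l + g k l).
Proof.
  intros (C & e & He & H) (C' & e' & He' & H'). exists (C + C'), (Rmin e e').
  split; [now apply Rmin_glb_lt|]. intros k l.
  eapply Rle_trans; [apply Rabs_triang|].
  assert (0 <= C).
  { eapply gb_const_nonneg; [apply (H 0%Z 0%Z) | apply Rmult_lt_0_compat; apply decay_pos]. }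
  assert (0 <= C').
  { eapply gb_const_nonneg; [apply (H' 0%Z 0%Z) | apply Rmult_lt_0_compat; apply decay_pos]. }
  rewrite Rmult_plus_distr_r. apply Rplus_le_compat.
  - eapply Rle_trans; [apply H|]. apply Rmult_le_compat_l; [assumption|].
    apply Rmult_le_compat; try (left; apply decay_pos); apply decay_mono, Rmin_l.
  - eapply Rle_trans; [apply H'|]. apply Rmult_le_compat_l; [assumption|].
    apply Rmult_le_compat; try (left; apply decay_pos); apply decay_mono, Rmin_r.
Qed.

(** Half of the decay rate is spent on the linear factor, through [1 + u <= exp u]. This makes
    moments of Gaussian families summable, as the first variations require. *)
Lemma lin_decay e k : 0 < e -> Rabs (IZR k) * decay e k <= 2 / e * decay (e / 2) k.
Proof.
  intros He. unfold decay.
  replace (- e * Rabs (IZR k)) with (- (e / 2) * Rabs (IZR k) + - (e / 2) * Rabs (IZR k)) by field.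
  rewrite exp_plus, <- Rmult_assoc. apply Rmult_le_compat_r; [left; apply exp_pos|].
  set (t := Rabs (IZR k)).
  replace t with (2 / e * (e / 2 * t)) at 1 by (field; lra).
  rewrite Rmult_assoc. rewrite <- (Rmult_1_r (2 / e)) at 2.
  apply Rmult_le_compat_l; [apply Rlt_le, Rdiv_lt_0_compat; lra|].
  replace (- (e / 2) * t) with (- (e / 2 * t)) by ring.
  rewrite exp_Ropp. apply Rmult_le_reg_r with (exp (e / 2 * t)); [apply exp_pos|].
  rewrite Rmult_assoc, Rinv_l, Rmult_1_r, Rmult_1_l by (generalize (exp_pos (e / 2 * t)); lra).
  generalize (exp_ineq1_le (e / 2 * t)); lra.
Qed.

Lemma gb2_mul_l f : gb2 f -> gb2 (fun k l => IZR k * f k l).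
Proof.
  intros (C & e & He & H). exists (C * (2 / e)), (e / 2). split; [lra|]. intros k l.
  assert (HC : 0 <= C).
  { eapply gb_const_nonneg; [apply (H 0%Z 0%Z) | apply Rmult_lt_0_compat; apply decay_pos]. }
  rewrite Rabs_mult.
  apply Rle_trans with (Rabs (IZR k) * (C * (decay e k * decay e l))).
  { apply Rmult_le_compat_l; [apply Rabs_pos | apply H]. }
  replace (Rabs (IZR k) * (C * (decay e k * decay e l)))
    with (C * ((Rabs (IZR k) * decay e k) * decay e l)) by ring.
  replace (C * (2 / e) * (decay (e / 2) k * decay (e / 2) l))
    with (C * ((2 / e * decay (e / 2) k) * decay (e / 2) l)) by ring.
  apply Rmult_le_compat_l; [assumption|]. apply Rmult_le_compat.
  - apply Rmult_le_pos; [apply Rabs_pos | left; apply decay_pos].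
  - left; apply decay_pos.
  - now apply lin_decay.
  - apply decay_mono. lra.
Qed.

Lemma gb2_mul_r f : gb2 f -> gb2 (fun k l => IZR l * f k l).
Proof.
  intros H. apply (gb2_swap (fun l k => IZR l * f k l)).
  apply (gb2_mul_l (fun l k => f k l)). now apply gb2_swap.
Qed.

Lemma gb2_exp (Q : Z -> Z -> R) c d : 0 < c ->
  (forall k l, c * (Rabs (IZR k) + Rabs (IZR l)) - d <= Q k l) ->
  gb2 (fun k l => exp (- Q k l)).
Proof.
  intros Hc H. exists (exp d), c. split; [assumption|]. intros k l.
  rewrite Rabs_pos_eq by (left; apply exp_pos). unfold decay.
  rewrite <- !exp_plus. apply exp_le. generalize (H k l). lra.
Qed.

Lemma gb2_decay e : 0 < e -> gb2 (fun k l => decay e k * decay e l).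
Proof.
  intros He. exists 1, e. split; [assumption|]. intros k l.
  rewrite Rabs_pos_eq; [lra|]. apply Rmult_le_pos; left; apply decay_pos.
Qed.

Lemma zsum2_plus f g : gb2 f -> gb2 g -> zsum2 (fun k l => f k l + g k l) = zsum2 f + zsum2 g.
Proof.
  intros Hf Hg. unfold zsum2. rewrite <- zsum_plus by now apply gb2_zsum.
  apply zsum_ext. intros k. apply (zsum_plus (f k) (g k)); now apply gb2_row.
Qed.

Lemma zsum2_scal c f : zsum2 (fun k l => c * f k l) = c * zsum2 f.
Proof.
  unfold zsum2. rewrite <- zsum_scal. apply zsum_ext. intros k. apply zsum_scal.
Qed.

Lemma zsum2_le f g : gb2 f -> gb2 g -> (forall k l, f k l <= g k l) -> zsum2 f <= zsum2 g.
Proof.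
  intros Hf Hg H. apply zsum_le; try now apply gb2_zsum.
  intros k. apply zsum_le; try now apply gb2_row. intros; apply H.
Qed.

Lemma zsum2_decay e : 0 < e ->
  zsum2 (fun k l => decay e k * decay e l) = ((1 + exp (- e)) / (1 - exp (- e))) ^ 2.
Proof.
  intros He. unfold zsum2.
  rewrite (zsum_ext _ (fun k => zsum (decay e) * decay e k)).
  - rewrite zsum_scal, zsum_decay by assumption. ring.
  - intros k. rewrite zsum_scal. ring.
Qed.

(** The row map may depend on [k]. Together with [zsum2_swap] this gives the reflections
    [l -> j - k - l] that generate the hexagonal symmetries. *)
Lemma zsum2_inner (s : Z -> Z -> Z) f :
  (forall k g, gb1 g -> zsum (fun l => g (s k l)) = zsum g) ->
  gb2 f -> zsum2 (fun k l => f k (s k l)) = zsum2 f.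
Proof.
  intros Hs Hf. apply zsum_ext. intros k. apply (Hs k (f k)). now apply gb2_row.
Qed.

Lemma zsum_reflect f j : gb1 f -> zsum (fun k => f (j - k)%Z) = zsum f.
Proof.
  intros Hf. rewrite <- (zsum_shift f j) by assumption.
  rewrite <- (zsum_neg (fun k => f (k + j)%Z)) by now apply gb1_shift.
  apply zsum_ext. intros k. f_equal. ring.
Qed.

Definition single (k0 : Z) (c : R) (k : Z) : R := if Z.eqb k k0 then c else 0.

Lemma gb1_single k0 c : gb1 (single k0 c).
Proof.
  exists (Rabs c * exp (Rabs (IZR k0))), 1. split; [lra|]. intros k. unfold single, decay.
  destruct (Z.eqb_spec k k0) as [->|_].
  - rewrite Rmult_assoc, <- exp_plus.
    replace (Rabs (IZR k0) + Ropp 1 * Rabs (IZR k0)) with 0 by ring. rewrite exp_0. lra.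
  - rewrite Rabs_R0. repeat apply Rmult_le_pos; try (left; apply exp_pos); apply Rabs_pos.
Qed.

Lemma Series_0 (a : nat -> R) : (forall n, a n = 0) -> Series a = 0.
Proof.
  intros H. rewrite (Series_ext a (fun n => 0 * a n)) by (intros; rewrite H; ring).
  rewrite Series_scal_l. ring.
Qed.

Lemma zsum_single k0 c : zsum (single k0 c) = c.
Proof.
  rewrite <- (zsum_shift _ k0) by apply gb1_single. unfold zsum.
  rewrite Series_incr_1.
  - rewrite !Series_0.
    + unfold single. rewrite Z.add_0_l, Z.eqb_refl. ring.
    + intros n. unfold single. destruct (Z.eqb_spec (- Z.of_nat (S n) + k0) k0); [lia|reflexivity].
    + intros n. unfold single. destruct (Z.eqb_spec (Z.of_nat (S n) + k0) k0); [lia|reflexivity].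
  - apply (gb1_ex_pos (fun k => single k0 c (k + k0)%Z)), gb1_shift, gb1_single.
Qed.

(* [spikes S f] is [f] restricted to the finite set [S]; it isolates the leading shells
   of a lattice sum from the tail. *)
Definition lsum (S : list (Z * Z)) (f : Z -> Z -> R) : R :=
  fold_right (fun p acc => f (fst p) (snd p) + acc) 0 S.

Definition spikes (S : list (Z * Z)) (f : Z -> Z -> R) (k l : Z) : R :=
  fold_right (fun p acc => single (fst p) 1 k * single (snd p) (f (fst p) (snd p)) l + acc) 0 S.

Lemma spikes_sum S f : gb2 (spikes S f) /\ zsum2 (spikes S f) = lsum S f.
Proof.
  induction S as [|p S [IH1 IH2]].
  - split.
    + exists 0, 1. split; [lra|]. intros. unfold spikes; simpl. rewrite Rabs_R0. lra.
    + unfold spikes; simpl. rewrite (zsum2_ext _ (fun _ _ => 0 * 0)) by (intros; ring).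
      rewrite (zsum2_scal 0 (fun _ _ => 0)). ring.
  - assert (G : gb2 (fun k l => single (fst p) 1 k * single (snd p) (f (fst p) (snd p)) l)).
    { destruct (gb1_single (fst p) 1) as (C & e & He & H).
      destruct (gb1_single (snd p) (f (fst p) (snd p))) as (C' & e' & He' & H').
      assert (0 <= C) by (eapply gb_const_nonneg; [apply (H 0%Z) | apply decay_pos]).
      assert (0 <= C') by (eapply gb_const_nonneg; [apply (H' 0%Z) | apply decay_pos]).
      exists (C * C'), (Rmin e e'). split; [now apply Rmin_glb_lt|]. intros k l.
      rewrite Rabs_mult.
      replace (C * C' * (decay (Rmin e e') k * decay (Rmin e e') l)) with
        ((C * decay (Rmin e e') k) * (C' * decay (Rmin e e') l)) by ring.
      apply Rmult_le_compat; try apply Rabs_pos.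
      - eapply Rle_trans; [apply H|]. apply Rmult_le_compat_l; [assumption|apply decay_mono, Rmin_l].
      - eapply Rle_trans; [apply H'|]. apply Rmult_le_compat_l; [assumption|apply decay_mono, Rmin_r]. }
    split.
    + apply (gb2_plus _ _ G IH1).
    + change (spikes (p :: S) f) with (fun k l => single (fst p) 1 k * single (snd p) (f (fst p) (snd p)) l + spikes S f k l).
      rewrite zsum2_plus by assumption. simpl. rewrite IH2. f_equal.
      unfold zsum2. rewrite (zsum_ext _ (fun k => f (fst p) (snd p) * single (fst p) 1 k)).
      * rewrite zsum_scal, zsum_single. ring.
      * intros k. rewrite zsum_scal, zsum_single. ring.
Qed.

Lemma spikes_out S f k l : ~ In (k, l) S -> spikes S f k l = 0.
Proof.
  induction S as [|[k0 l0] S IH]; intros H; [reflexivity|]. unfold spikes; simpl.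
  fold (spikes S f k l). rewrite IH by (intros ?; apply H; now right).
  unfold single. destruct (Z.eqb_spec k k0); [|ring]. destruct (Z.eqb_spec l l0); [|ring].
  exfalso. apply H. left. congruence.
Qed.

Lemma spikes_in S f k l : NoDup S -> In (k, l) S -> spikes S f k l = f k l.
Proof.
  induction 1 as [|[k0 l0] S H0 _ IH]; intros H; [contradiction|].
  unfold spikes; simpl. fold (spikes S f k l).
  destruct H as [E|H].
  - injection E as -> ->. rewrite spikes_out by assumption.
    unfold single. rewrite !Z.eqb_refl. ring.
  - rewrite IH by assumption. unfold single.
    destruct (Z.eqb_spec k k0); [|ring]. destruct (Z.eqb_spec l l0); [|ring].
    exfalso. apply H0. congruence.
Qed.

Lemma zsum2_finite_part S f g : NoDup S -> gb2 f -> gb2 g ->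
  (forall k l, 0 <= g k l) -> (forall k l, ~ In (k, l) S -> f k l <= g k l) ->
  zsum2 f <= lsum S f + zsum2 g.
Proof.
  intros HS Hf Hg Hpos Hout. destruct (spikes_sum S f) as [G E].
  rewrite <- E, <- zsum2_plus by assumption.
  apply zsum2_le; [assumption | now apply gb2_plus |]. intros k l.
  assert (D : forall p q : Z * Z, {p = q} + {p <> q}) by (decide equality; apply Z.eq_dec).
  destruct (in_dec D (k, l) S) as [H|H].
  - rewrite spikes_in by assumption. generalize (Hpos k l). lra.
  - rewrite spikes_out by assumption. generalize (Hout k l H). lra.
Qed.

(** * Poisson summation for Gaussians *)

(* [walk M n] is [C(2M, M + n) / 4 ^ M], the law of a lazy simple random walk. *)
Fixpoint walk (M : nat) (n : Z) : R :=
  match M with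
  | O => if Z.eqb n 0 then 1 else 0
  | S M => walk M (n - 1) / 4 + walk M n / 2 + walk M (n + 1) / 4
  end.

Lemma walk_range M n : 0 <= walk M n <= 1.
Proof.
  revert n; induction M as [|M IH]; intros n; simpl.
  - destruct (Z.eqb n 0); lra.
  - generalize (IH (n - 1)%Z) (IH n) (IH (n + 1)%Z). lra.
Qed.

Lemma walk_out M n : (Z.of_nat M < Z.abs n)%Z -> walk M n = 0.
Proof.
  revert n; induction M as [|M IH]; intros n H; simpl.
  - destruct (Z.eqb_spec n 0); [subst; simpl in H; lia | reflexivity].
  - rewrite !IH by lia. lra.
Qed.

Lemma walk_opp M n : walk M (- n) = walk M n.
Proof.
  revert n; induction M as [|M IH]; intros n; simpl.
  - now destruct n.
  - replace (- n - 1)%Z with (- (n + 1))%Z by ring.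
    replace (- n + 1)%Z with (- (n - 1))%Z by ring. rewrite !IH. lra.
Qed.

(** The quotient of neighbouring binomial coefficients, multiplied out so that it holds for every
    integer [n], also outside the support; the induction needs it at [n - 1], [n] and [n + 1]. *)
Lemma walk_ratio M n : (INR M + IZR n + 1) * walk M (n + 1) = (INR M - IZR n) * walk M n.
Proof.
  revert n; induction M as [|M IH]; intros n.
  - simpl. destruct (Z.eqb_spec n 0) as [->|H]; [simpl; lra|].
    destruct (Z.eqb_spec (n + 1) 0); [|lra].
    replace n with (-1)%Z by lia. lra.
  - rewrite S_INR. cbn [walk].
    assert (H0 := IH n). assert (H1 := IH (n + 1)%Z). assert (H2 := IH (n - 1)%Z).
    replace (n - 1 + 1)%Z with n in H2 by ring.
    replace (n + 1 - 1)%Z with n by ring.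
    rewrite plus_IZR in H1. rewrite minus_IZR in H2. lra.
Qed.

Lemma walk_step M n : (n < M)%nat ->
  walk M (Z.of_nat (S n)) = walk M (Z.of_nat n) * (1 - (2 * INR n + 1) / (INR M + INR n + 1)).
Proof.
  intros H. assert (E := walk_ratio M (Z.of_nat n)). rewrite <- INR_IZR_INZ in E.
  rewrite Nat2Z.inj_succ. unfold Z.succ.
  assert (0 <= INR M) by apply pos_INR. assert (0 <= INR n) by apply pos_INR.
  apply Rmult_eq_reg_l with (INR M + INR n + 1); [|lra].
  rewrite E. field. lra.
Qed.

(** A product of factors [1 - (2 j + 1) / (M + j + 1)], each at most [exp (- (2 j + 1) / (M + m))];
    the odd numbers add up to [n ^ 2]. The choice [m = M] yields a majorant uniform in [n], the
    choice [m = n] the sharp asymptotics. *)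
Lemma walk_le_gen M n m : (n <= m)%nat -> (m <= M)%nat ->
  walk M (Z.of_nat n) <= walk M 0 * exp (- (INR n ^ 2 / (INR M + INR m))).
Proof.
  intros Hn Hm.
  destruct (Nat.eq_dec M 0) as [->|HM].
  { replace n with 0%nat by lia. simpl.
    replace (- (0 * (0 * 1) / (0 + INR m))) with 0 by (unfold Rdiv; ring). rewrite exp_0. lra. }
  assert (HM' : 1 <= INR M) by (apply (le_INR 1); lia).
  assert (Hm' : 0 <= INR m) by apply pos_INR.
  induction n as [|n IH].
  - replace (- (INR 0 ^ 2 / (INR M + INR m))) with 0 by (simpl; unfold Rdiv; ring).
    rewrite exp_0. simpl. lra.
  - rewrite walk_step by lia. rewrite S_INR.
    replace (- ((INR n + 1) ^ 2 / (INR M + INR m)))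
      with (- (INR n ^ 2 / (INR M + INR m)) + - ((2 * INR n + 1) / (INR M + INR m)))
      by (field; lra).
    rewrite exp_plus, <- Rmult_assoc.
    assert (0 <= INR n) by apply pos_INR.
    assert (INR n + 1 <= INR m) by (rewrite <- S_INR; apply le_INR; lia).
    assert (INR n + 1 <= INR M) by (rewrite <- S_INR; apply le_INR; lia).
    apply Rmult_le_compat; [apply walk_range | | apply IH; lia |].
    + assert ((2 * INR n + 1) / (INR M + INR n + 1) <= 1); [|lra].
      apply Rle_div_l; lra.
    + eapply Rle_trans; [|apply exp_ineq1_le].
      assert ((2 * INR n + 1) / (INR M + INR m) <= (2 * INR n + 1) / (INR M + INR n + 1)); [|lra].
      apply Rmult_le_compat_l; [lra|]. apply Rinv_le_contravar; lra.
Qed.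

Lemma exp_lower_one_minus t : 0 <= t < 1 -> exp (- (t / (1 - t))) <= 1 - t.
Proof.
  intros H. rewrite exp_Ropp. apply Rle_trans with (/ / (1 - t)); [|rewrite Rinv_inv; lra].
  apply Rinv_le_contravar; [apply Rinv_0_lt_compat; lra|].
  replace (/ (1 - t)) with (1 + t / (1 - t)) by (field; lra). apply exp_ineq1_le.
Qed.

(** Counterpart of [walk_le_gen] with [1 - t >= exp (- t / (1 - t))]: for
    [t = (2 j + 1) / (M + j + 1)] the quotient [t / (1 - t)] is [(2 j + 1) / (M - j)]. *)
Lemma walk_ge M m n : (n <= m)%nat -> (m < M)%nat ->
  walk M 0 * exp (- (INR n ^ 2 / (INR M - INR m))) <= walk M (Z.of_nat n).
Proof.
  intros Hn Hm.
  assert (Hm' : INR m + 1 <= INR M) by (rewrite <- S_INR; apply le_INR; lia).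
  induction n as [|n IH].
  - replace (- (INR 0 ^ 2 / (INR M - INR m))) with 0 by (simpl; unfold Rdiv; ring).
    rewrite exp_0. simpl. lra.
  - rewrite walk_step by lia. rewrite S_INR.
    replace (- ((INR n + 1) ^ 2 / (INR M - INR m)))
      with (- (INR n ^ 2 / (INR M - INR m)) + - ((2 * INR n + 1) / (INR M - INR m)))
      by (field; lra).
    rewrite exp_plus, <- Rmult_assoc.
    assert (0 <= INR n) by apply pos_INR.
    assert (INR n + 1 <= INR m) by (rewrite <- S_INR; apply le_INR; lia).
    apply Rmult_le_compat; [ | left; apply exp_pos | apply IH; lia |].
    + apply Rmult_le_pos; [apply walk_range | left; apply exp_pos].
    + eapply Rle_trans; [|apply exp_lower_one_minus].
      * apply exp_le, Ropp_le_contravar.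
        replace ((2 * INR n + 1) / (INR M + INR n + 1) / (1 - (2 * INR n + 1) / (INR M + INR n + 1)))
          with ((2 * INR n + 1) / (INR M - INR n)) by (field; lra).
        apply Rmult_le_compat_l; [lra|]. apply Rinv_le_contravar; lra.
      * split; [apply Rdiv_le_0_compat; lra | apply Rlt_div_l; lra].
Qed.

Lemma walk_abs M n : walk M n = walk M (Z.of_nat (Z.abs_nat n)).
Proof.
  rewrite Nat2Z.inj_abs_nat. destruct (Zabs_dec n) as [E|E]; rewrite E at 1; [reflexivity|apply walk_opp].
Qed.

Lemma INR_abs_nat n : INR (Z.abs_nat n) = Rabs (IZR n).
Proof. rewrite INR_IZR_INZ, Nat2Z.inj_abs_nat, abs_IZR. reflexivity. Qed.

Lemma walk_gauss M n : (0 < M)%nat -> walk M n <= walk M 0 * exp (- (IZR n ^ 2 / (2 * INR M))).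
Proof.
  intros HM. destruct (Z_le_gt_dec (Z.abs n) (Z.of_nat M)) as [H|H].
  - rewrite walk_abs. eapply Rle_trans; [apply (walk_le_gen M _ M); lia|].
    right. rewrite INR_abs_nat. do 3 f_equal. rewrite <- Rsqr_pow2, <- Rsqr_abs, Rsqr_pow2. f_equal. ring.
  - rewrite walk_out by lia. apply Rmult_le_pos; [apply walk_range | left; apply exp_pos].
Qed.

Lemma walk_0_pos M : 0 < walk M 0.
Proof.
  induction M as [|M IH]; simpl; [lra|].
  generalize (walk_range M (-1)) (walk_range M 1). lra.
Qed.

Lemma walk_0_S M : walk (S M) 0 = walk M 0 * ((2 * INR M + 1) / (2 * INR M + 2)).
Proof.
  assert (E := walk_ratio M 0). simpl in E.
  assert (0 <= INR M) by apply pos_INR.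
  cbn [walk]. change (0 - 1)%Z with (Z.opp 1). rewrite (walk_opp M 1). simpl Z.add.
  assert (walk M 1 = INR M * walk M 0 / (INR M + 1)).
  { apply Rmult_eq_reg_l with (INR M + 1); [|lra]. field_simplify; lra. }
  rewrite H0. field. lra.
Qed.

(** By [walk_0_S], [sqrt M * walk M 0] increases while [(M + 1/2) * walk M 0 ^ 2] decreases, so the
    former has a limit. The limit is positive because the term [M = 1] already equals 1/2; its value
    is left open. *)
Lemma walk_0_lim : exists K, 0 < K /\ is_lim_seq (fun M => sqrt (INR M) * walk M 0) K.
Proof.
  assert (Up : forall M, (INR M + 1 / 2) * walk M 0 ^ 2 <= 1 / 2).
  { induction M as [|M IH]; [simpl; lra|]. eapply Rle_trans; [|apply IH].
    rewrite walk_0_S, S_INR. assert (0 <= INR M) by apply pos_INR.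
    set (w := walk M 0) in *. clearbody w.
    replace ((INR M + 1 + 1 / 2) * (w * ((2 * INR M + 1) / (2 * INR M + 2))) ^ 2)
      with ((w ^ 2 * (INR M + 1 / 2)) * ((2 * INR M + 3) * (2 * INR M + 1) / (2 * INR M + 2) ^ 2))
      by (field; lra).
    rewrite (Rmult_comm (INR M + 1 / 2)). rewrite <- (Rmult_1_r (w ^ 2 * (INR M + 1 / 2))) at 2.
    apply Rmult_le_compat_l; [apply Rmult_le_pos; [apply pow2_ge_0 | lra]|].
    apply Rle_div_l; nra. }
  assert (Inc : forall M, sqrt (INR M) * walk M 0 <= sqrt (INR (S M)) * walk (S M) 0).
  { intros M. rewrite walk_0_S, S_INR. assert (0 <= INR M) by apply pos_INR.
    assert (P := walk_0_pos M). set (w := walk M 0) in *. clearbody w.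
    apply Rsqr_incr_0; try (repeat apply Rmult_le_pos; try apply sqrt_pos; try lra).
    - rewrite !Rsqr_mult, !Rsqr_sqrt by lra. unfold Rsqr.
      replace ((INR M + 1) * (w * w * ((2 * INR M + 1) / (2 * INR M + 2) * ((2 * INR M + 1) / (2 * INR M + 2)))))
        with ((w * w) * ((2 * INR M + 1) ^ 2 / (4 * (INR M + 1)))) by (field; lra).
      rewrite (Rmult_comm (INR M)). apply Rmult_le_compat_l; [nra|].
      apply Rle_div_r; nra.
    - left. apply Rinv_0_lt_compat. lra. }
  assert (Bd : forall M, sqrt (INR M) * walk M 0 <= 1).
  { intros M. assert (0 <= INR M) by apply pos_INR. apply Rsqr_incr_0; [|
      apply Rmult_le_pos; [apply sqrt_pos | left; apply walk_0_pos] | lra].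
    rewrite Rsqr_mult, Rsqr_sqrt, Rsqr_1 by lra. generalize (Up M) (pow2_ge_0 (walk M 0)).
    unfold Rsqr. nra. }
  destruct (ex_finite_lim_seq_incr _ 1 Inc Bd) as [K HK]. exists K. split; [|exact HK].
  assert (C := is_lim_seq_incr_compare _ K HK Inc 1%nat). simpl in C.
  rewrite sqrt_1 in C. lra.
Qed.

(** * Finite Fourier analysis on a cycle of odd length *)

Lemma gb1_finite_support f K B : (forall k, Rabs (f k) <= B) ->
  (forall k, (K < Z.abs k)%Z -> f k = 0) -> gb1 f.
Proof.
  intros HB H0. exists (B * exp (IZR K)), 1. split; [lra|]. intros k. unfold decay.
  assert (0 <= B) by (eapply Rle_trans; [apply Rabs_pos | apply (HB 0%Z)]).
  destruct (Z_le_gt_dec (Z.abs k) K).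
  - eapply Rle_trans; [apply HB|]. rewrite Rmult_assoc, <- exp_plus, <- abs_IZR.
    rewrite <- (Rmult_1_r B) at 1. apply Rmult_le_compat_l; [assumption|].
    apply Rle_trans with (exp 0); [rewrite exp_0; lra|]. apply exp_le. apply IZR_le in l. lra.
  - rewrite H0 by lia. rewrite Rabs_R0.
    repeat apply Rmult_le_pos; try (left; apply exp_pos); assumption.
Qed.

(** The indices [|k| <= J] form a complete residue system modulo [2 * J + 1], centred so that it
    exhausts Z as [J] grows. *)
Definition window (J : nat) (f : Z -> R) (k : Z) : R :=
  if Z.leb (Z.abs k) (Z.of_nat J) then f k else 0.

Lemma gb1_window J f B : (forall k, Rabs (f k) <= B) -> gb1 (window J f).
Proof.
  intros HB. apply (gb1_finite_support _ (Z.of_nat J) B).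
  - intros k. unfold window. destruct (Z.leb _ _); [apply HB|].
    rewrite Rabs_R0. eapply Rle_trans; [apply Rabs_pos | apply (HB 0%Z)].
  - intros k Hk. unfold window. destruct (Z.leb_spec (Z.abs k) (Z.of_nat J)); [lia|reflexivity].
Qed.

Lemma zsum_window_S J f B : (forall k, Rabs (f k) <= B) ->
  zsum (window (S J) f) = zsum (window J f) + f (Z.of_nat (S J)) + f (- Z.of_nat (S J))%Z.
Proof.
  intros HB.
  rewrite (zsum_ext _ (fun k => (window J f k + single (Z.of_nat (S J)) (f (Z.of_nat (S J))) k)
      + single (- Z.of_nat (S J)) (f (- Z.of_nat (S J))%Z) k)).
  - rewrite zsum_plus, zsum_plus, !zsum_single; try apply gb1_single;
      try (now apply gb1_window with B); [reflexivity|].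
    apply gb1_plus; [now apply gb1_window with B | apply gb1_single].
  - intros k. unfold window, single.
    destruct (Z.leb_spec (Z.abs k) (Z.of_nat (S J))), (Z.leb_spec (Z.abs k) (Z.of_nat J)),
      (Z.eqb_spec k (Z.of_nat (S J))), (Z.eqb_spec k (- Z.of_nat (S J)));
      try lia; subst; ring.
Qed.

Lemma zsum_window_0 f : zsum (window 0 f) = f 0%Z.
Proof.
  rewrite (zsum_ext _ (single 0 (f 0%Z))); [apply zsum_single|].
  intros k. unfold window, single.
  destruct (Z.leb_spec (Z.abs k) (Z.of_nat 0)), (Z.eqb_spec k 0); try lia; subst; reflexivity.
Qed.

Lemma Rabs_cos_le1 x : Rabs (cos x) <= 1.
Proof. apply Rabs_le. generalize (COS_bound x); lra. Qed.

(** The Dirichlet kernel with a phase; the factor [2 * sin (t / 2)] makes the sum telescope. *)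
Lemma window_cos_mul (J : nat) t phi :
  2 * sin (t / 2) * zsum (window J (fun k => cos (IZR k * t - phi)))
  = sin ((INR J + / 2) * t - phi) + sin ((INR J + / 2) * t + phi).
Proof.
  assert (HB : forall k, Rabs (cos (IZR k * t - phi)) <= 1) by (intros; apply Rabs_cos_le1).
  induction J as [|J IH].
  - rewrite zsum_window_0. simpl INR.
    replace ((0 + / 2) * t - phi) with (t / 2 - phi) by field.
    replace ((0 + / 2) * t + phi) with (t / 2 + phi) by field.
    rewrite sin_minus, sin_plus. replace (0 * t - phi) with (- phi) by ring.
    rewrite cos_neg. ring.
  - rewrite (zsum_window_S J _ 1 HB), !Rmult_plus_distr_l, IH.
    rewrite opp_IZR, <- INR_IZR_INZ, S_INR.
    set (u := (INR J + 1) * t).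
    replace (- (INR J + 1) * t - phi) with (- (u + phi)) by (unfold u; ring).
    replace ((INR J + / 2) * t - phi) with ((u - phi) - t / 2) by (unfold u; field).
    replace ((INR J + / 2) * t + phi) with ((u + phi) - t / 2) by (unfold u; field).
    replace ((INR J + 1 + / 2) * t - phi) with ((u - phi) + t / 2) by (unfold u; field).
    replace ((INR J + 1 + / 2) * t + phi) with ((u + phi) + t / 2) by (unfold u; field).
    rewrite cos_neg, !(sin_plus _ (t / 2)), !(sin_minus _ (t / 2)). ring.
Qed.

Lemma zsum_window_const J c : zsum (window J (fun _ => c)) = (2 * INR J + 1) * c.
Proof.
  induction J as [|J IH].
  - rewrite zsum_window_0. simpl; ring.
  - rewrite (zsum_window_S J (fun _ => c) (Rabs c)) by (intros; lra). rewrite IH, S_INR. ring.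
Qed.

Lemma cos_2PI_Z x n : cos (x + 2 * PI * IZR n) = cos x.
Proof.
  destruct (Z_le_gt_dec 0 n) as [H|H].
  - rewrite <- (Z2Nat.id n) by assumption. rewrite <- INR_IZR_INZ.
    replace (2 * PI * INR (Z.to_nat n)) with (2 * INR (Z.to_nat n) * PI) by ring. apply cos_period.
  - rewrite <- (cos_period _ (Z.to_nat (- n))). f_equal.
    rewrite INR_IZR_INZ, Z2Nat.id, opp_IZR by lia. ring.
Qed.

Lemma sin_2PI_Z x n : sin (x + 2 * PI * IZR n) = sin x.
Proof.
  replace (x + 2 * PI * IZR n) with (PI / 2 - (PI / 2 - x + 2 * PI * IZR (- n))).
  - rewrite sin_shift, cos_2PI_Z, cos_shift. reflexivity.
  - rewrite opp_IZR. ring.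
Qed.

Lemma zsum_window_orthogonality (J : nat) (r : Z) phi :
  let L := (2 * Z.of_nat J + 1)%Z in
  zsum (window J (fun k => cos (IZR k * (2 * PI * IZR r / IZR L) - phi)))
  = if Z.eqb (r mod L) 0 then IZR L * cos phi else 0.
Proof.
  intros L.
  assert (HL : IZR L = 2 * INR J + 1) by (unfold L; rewrite plus_IZR, mult_IZR, <- INR_IZR_INZ; ring).
  assert (PL : 0 < IZR L) by (apply IZR_lt; lia).
  destruct (Z.eqb_spec (r mod L) 0) as [H|H].
  - apply Z.mod_divide in H; [|lia]. destruct H as [j ->].
    rewrite HL, <- zsum_window_const. apply zsum_ext. intros k. unfold window.
    destruct (Z.leb _ _); [|reflexivity].
    rewrite <- (cos_neg phi), <- (cos_2PI_Z (- phi) (k * j)). f_equal.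
    rewrite !mult_IZR, HL. field. lra.
  - assert (E := window_cos_mul J (2 * PI * IZR r / IZR L) phi).
    replace ((INR J + / 2) * (2 * PI * IZR r / IZR L) - phi) with (PI * IZR r - phi) in E
      by (rewrite HL; field; lra).
    (* Modulo [2 * PI] the two arguments are opposite, so the sines cancel; the factor [sin (t / 2)]
       vanishes only if [L] divides [r]. *)
    replace ((INR J + / 2) * (2 * PI * IZR r / IZR L) + phi)
      with (- ((PI * IZR r - phi) + 2 * PI * IZR (- r))) in E
      by (rewrite HL, opp_IZR; field; lra).
    rewrite sin_neg, sin_2PI_Z, Rplus_opp_r in E.
    apply Rmult_integral in E. destruct E as [E|E]; [|exact E]. exfalso.
    replace (2 * PI * IZR r / IZR L / 2) with (PI * (IZR r / IZR L)) in E by (field; lra).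
    assert (E' : sin (PI * (IZR r / IZR L)) = 0) by lra.
    apply sin_eq_0_0 in E'. destruct E' as [j E'].
    apply H. apply Z.mod_divide; [lia|]. exists j.
    apply eq_IZR. rewrite mult_IZR.
    assert (IZR r / IZR L = IZR j).
    { apply Rmult_eq_reg_l with PI; [lra | generalize PI_RGT_0; lra]. }
    rewrite <- H0. field. lra.
Qed.

(* Both sides satisfy the same recurrence in [M]: one step of the walk on the left is
   multiplication by cos^2 on the Fourier side. *)
Lemma walk_finite_poisson (J M : nat) (r : Z) b phi :
  let L := (2 * Z.of_nat J + 1)%Z in
  let d := 2 * PI * b / IZR L in
  IZR L * zsum (fun nu => walk M (r + nu * L) * cos (d * IZR (r + nu * L) + phi))
  = zsum (window J (fun k => cos (PI * (IZR k + b) / IZR L) ^ (2 * M)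
                      * cos (IZR k * (2 * PI * IZR r / IZR L) - phi))).
Proof.
  intros L d.
  assert (PL : 0 < IZR L) by (apply IZR_lt; lia).
  assert (GW : forall M r phi, gb1 (fun nu => walk M (r + nu * L) * cos (d * IZR (r + nu * L) + phi))).
  { intros M' r' phi'. apply (gb1_finite_support _ (Z.of_nat M' + Z.abs r') 1).
    - intros k. rewrite Rabs_mult, (Rabs_pos_eq (walk _ _)) by apply walk_range.
      generalize (walk_range M' (r' + k * L)) (Rabs_cos_le1 (d * IZR (r' + k * L) + phi')).
      generalize (Rabs_pos (cos (d * IZR (r' + k * L) + phi'))). nra.
    - intros k Hk. rewrite walk_out; [ring|].
      lia. }
  assert (CB : forall M k r phi, Rabs (cos (PI * (IZR k + b) / IZR L) ^ (2 * M)
                      * cos (IZR k * (2 * PI * IZR r / IZR L) - phi)) <= 1).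
  { intros M' k r' phi'. rewrite Rabs_mult, <- RPow_abs.
    assert (A := Rabs_cos_le1 (IZR k * (2 * PI * IZR r' / IZR L) - phi')).
    assert (B := Rabs_cos_le1 (PI * (IZR k + b) / IZR L)).
    assert (Rabs (cos (PI * (IZR k + b) / IZR L)) ^ (2 * M') <= 1).
    { rewrite <- (pow1 (2 * M')). apply pow_incr. split; [apply Rabs_pos | assumption]. }
    generalize (Rabs_pos (cos (IZR k * (2 * PI * IZR r' / IZR L) - phi'))). nra. }
  revert r phi. induction M as [|M IH]; intros r phi.
  - rewrite (zsum_ext (window J _) (window J (fun k => cos (IZR k * (2 * PI * IZR r / IZR L) - phi)))).
    2:{ intros k. unfold window. destruct (Z.leb _ _); [|reflexivity]. simpl. ring. }
    assert (O := zsum_window_orthogonality J r phi). cbv zeta in O. fold L in O. rewrite O.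
    destruct (Z.eqb_spec (r mod L) 0) as [H|H].
    + apply Z.mod_divide in H; [|lia]. destruct H as [j ->]. f_equal.
      rewrite <- (zsum_single (- j) (cos phi)). apply zsum_ext. intros nu.
      unfold single. cbn [walk].
      destruct (Z.eqb_spec nu (- j)) as [->|Hn].
      * replace (j * L + - j * L)%Z with 0%Z by ring. simpl.
        rewrite Rmult_0_r, Rplus_0_l. ring.
      * destruct (Z.eqb_spec (j * L + nu * L) 0); [nia | ring].
    + rewrite (zsum_ext _ (fun nu => 0 * 0)); [rewrite (zsum_scal 0 (fun _ => 0)); ring|].
      intros nu. cbn [walk]. destruct (Z.eqb_spec (r + nu * L) 0) as [E|]; [|ring].
      exfalso. apply H. apply Z.mod_divide; [lia|]. exists (- nu)%Z. lia.
  (* The phases [phi + d], [phi], [phi - d] compensate the shifts of [r], so the three left-hand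
     sides carry the same cosine and recombine into one step of the walk. *)
  - assert (I1 := IH (r - 1)%Z (phi + d)). assert (I2 := IH r phi). assert (I3 := IH (r + 1)%Z (phi - d)).
    set (A := fun r' phi' nu => walk M (r' + nu * L) * cos (d * IZR (r' + nu * L) + phi')).
    change (fun nu => walk M (r - 1 + nu * L) * cos (d * IZR (r - 1 + nu * L) + (phi + d))) with (A (r - 1)%Z (phi + d)) in I1.
    change (fun nu => walk M (r + nu * L) * cos (d * IZR (r + nu * L) + phi)) with (A r phi) in I2.
    change (fun nu => walk M (r + 1 + nu * L) * cos (d * IZR (r + 1 + nu * L) + (phi - d))) with (A (r + 1)%Z (phi - d)) in I3.
    rewrite (zsum_ext _ (fun nu => (/ 4 * A (r - 1)%Z (phi + d) nu + / 2 * A r phi nu) + / 4 * A (r + 1)%Z (phi - d) nu)).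
    2:{ intros nu. unfold A. cbn [walk].
        replace (r - 1 + nu * L)%Z with (r + nu * L - 1)%Z by ring.
        replace (r + 1 + nu * L)%Z with (r + nu * L + 1)%Z by ring.
        rewrite (minus_IZR _ 1), (plus_IZR (r + nu * L) 1).
        replace (d * (IZR (r + nu * L) - 1) + (phi + d)) with (d * IZR (r + nu * L) + phi) by ring.
        replace (d * (IZR (r + nu * L) + 1) + (phi - d)) with (d * IZR (r + nu * L) + phi) by ring.
        field. }
    assert (GA : forall r phi, gb1 (A r phi)) by (intros; apply GW).
    rewrite zsum_plus, zsum_plus, !zsum_scal;
      [ | apply gb1_scal, GA | apply gb1_scal, GA
        | apply gb1_plus; apply gb1_scal, GA | apply gb1_scal, GA].
    rewrite !Rmult_plus_distr_l.
    replace (IZR L * (/ 4 * zsum (A (r - 1)%Z (phi + d)))) with (/ 4 * (IZR L * zsum (A (r - 1)%Z (phi + d)))) by ring.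
    replace (IZR L * (/ 2 * zsum (A r phi))) with (/ 2 * (IZR L * zsum (A r phi))) by ring.
    replace (IZR L * (/ 4 * zsum (A (r + 1)%Z (phi - d)))) with (/ 4 * (IZR L * zsum (A (r + 1)%Z (phi - d)))) by ring.
    rewrite I1, I2, I3.
    rewrite <- !zsum_scal, <- zsum_plus, <- zsum_plus;
      try apply gb1_plus; try (apply gb1_scal; apply gb1_window with 1; intros; apply CB).
    apply zsum_ext. intros k. unfold window. destruct (Z.leb _ _); [|ring].
    replace (2 * S M)%nat with (2 + 2 * M)%nat by lia. rewrite pow_add.
    set (C := cos (PI * (IZR k + b) / IZR L) ^ (2 * M)).
    set (th := PI * (IZR k + b) / IZR L).
    set (u := IZR k * (2 * PI * IZR r / IZR L) - phi).
    replace (IZR k * (2 * PI * IZR (r - 1) / IZR L) - (phi + d)) with (u - 2 * th)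
      by (unfold u, th, d; rewrite minus_IZR; field; lra).
    replace (IZR k * (2 * PI * IZR (r + 1) / IZR L) - (phi - d)) with (u + 2 * th)
      by (unfold u, th, d; rewrite plus_IZR; field; lra).
    rewrite cos_plus, cos_minus, cos_2a_cos. field.
Qed.

(** * Passage to the limit in the finite identity *)

Lemma sin_taylor3_le x : 0 <= x <= 4 -> x - x ^ 3 / 6 <= sin x.
Proof.
  intros H. destruct (pre_sin_bound x 0) as [B _]; try lra.
  unfold sin_approx, sin_term in B. simpl in B. lra.
Qed.

Lemma sin_sqr_ge x : Rabs x <= PI / 2 -> x ^ 2 / 9 <= sin x ^ 2.
Proof.
  intros H. assert (P4 := PI_4).
  assert (E : forall y, 0 <= y <= 2 -> y ^ 2 / 9 <= sin y ^ 2).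
  { intros y Hy. assert (B := sin_taylor3_le y ltac:(lra)).
    assert (y ^ 2 <= 4) by nra. assert (y / 3 <= sin y).
    { eapply Rle_trans; [|apply B]. generalize (Rmult_le_pos y (4 - y ^ 2)). simpl. lra. }
    replace (y ^ 2 / 9) with ((y / 3) ^ 2) by field. apply pow_incr. lra. }
  destruct (Rle_lt_dec 0 x).
  - rewrite Rabs_pos_eq in H by assumption. apply E. lra.
  - rewrite Rabs_left in H by assumption. replace (x ^ 2) with ((- x) ^ 2) by ring.
    replace (sin x) with (- sin (- x)) by (rewrite sin_neg; ring).
    replace ((- sin (- x)) ^ 2) with (sin (- x) ^ 2) by ring. apply E. lra.
Qed.

Lemma exp_sqr_decay kappa u k C0 : 0 < kappa -> Rabs (IZR k) - C0 <= Rabs u ->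
  exp (- (kappa * u ^ 2)) <= exp (kappa * (2 * C0 + 1)) * decay (2 * kappa) k.
Proof.
  intros Hk H. unfold decay. rewrite <- exp_plus. apply exp_le.
  assert (2 * Rabs u - 1 <= u ^ 2).
  { rewrite <- (pow2_abs u). generalize (pow2_ge_0 (Rabs u - 1)). lra. }
  nra.
Qed.

Lemma squeeze_inv_L (u : nat -> R) (l : R) :
  (forall N, Rabs (u N - l) <= / (2 * INR N + 1)) -> is_lim_seq u l.
Proof.
  intros H. apply is_lim_seq_spec. intros eps.
  destruct (archimed_cor1 eps (cond_pos eps)) as [N0 [H0 P0]].
  exists N0. intros n Hn. eapply Rle_lt_trans; [apply H|]. eapply Rle_lt_trans; [|apply H0].
  apply le_INR in Hn. apply lt_INR in P0. simpl in P0. apply Rinv_le_contravar; lra.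
Qed.

Lemma lim_inv_L : is_lim_seq (fun N => / (2 * INR N + 1)) 0.
Proof.
  apply squeeze_inv_L. intros N. rewrite Rminus_0_r.
  assert (0 < / (2 * INR N + 1)) by (apply Rinv_0_lt_compat; generalize (pos_INR N); lra).
  rewrite Rabs_pos_eq; lra.
Qed.

Lemma is_lim_seq_exp (u : nat -> R) (l : R) : is_lim_seq u l -> is_lim_seq (fun n => exp (u n)) (exp l).
Proof.
  intros H. apply (is_lim_seq_continuous exp u l); [|assumption].
  apply derivable_continuous_pt, derivable_pt_exp.
Qed.

Lemma is_lim_seq_opp' (u : nat -> R) (l : R) : is_lim_seq u l -> is_lim_seq (fun n => - u n) (- l).
Proof. intros H. now apply (is_lim_seq_opp u l) in H. Qed.

(** A local limit theorem: [walk_ge] and [walk_le_gen] with [m = |n|] have the denominators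
    [M - |n|] and [M + |n|], and [|n| / L ^ 2] tends to 0 for [L = 2 N + 1], so both exponents have
    the same limit. *)
Lemma walk_lim (M : nat -> nat) (n : nat -> Z) (c x : R) :
  0 < c -> (forall N, (0 < M N)%nat) ->
  is_lim_seq (fun N => INR (M N) / (2 * INR N + 1) ^ 2) c ->
  is_lim_seq (fun N => IZR (n N) / (2 * INR N + 1)) x ->
  is_lim_seq (fun N => walk (M N) (n N) / walk (M N) 0) (exp (- (x ^ 2 / c))).
Proof.
  intros Hc HM LM Ln.
  assert (PL : forall N, 0 < 2 * INR N + 1) by (intros N; generalize (pos_INR N); lra).
  assert (La := is_lim_seq_abs _ _ Ln). cbn [Rbar_abs] in La.
  assert (Lz : is_lim_seq (fun N => Rabs (IZR (n N) / (2 * INR N + 1)) * / (2 * INR N + 1)) 0).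
  { replace (Finite 0) with (Finite (Rabs x * 0)) by (f_equal; ring).
    apply is_lim_seq_mult'; [exact La | exact lim_inv_L]. }
  assert (Ev : eventually (fun N => (Z.abs_nat (n N) < M N)%nat)).
  { assert (D : is_lim_seq (fun N => INR (M N) / (2 * INR N + 1) ^ 2
       - Rabs (IZR (n N) / (2 * INR N + 1)) * / (2 * INR N + 1)) (c - 0)) by now apply is_lim_seq_minus'.
    apply is_lim_seq_spec in D. destruct (D (mkposreal c Hc)) as [N0 H0].
    exists N0. intros N HN. specialize (H0 N HN). cbn [pos] in H0. apply Rabs_def2 in H0.
    apply INR_lt. rewrite INR_abs_nat. specialize (PL N).
    rewrite Rabs_div, (Rabs_pos_eq (2 * INR N + 1)) in H0 by lra.
    assert (0 < (INR (M N) - Rabs (IZR (n N))) / (2 * INR N + 1) ^ 2).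
    { replace ((INR (M N) - Rabs (IZR (n N))) / (2 * INR N + 1) ^ 2) with
       (INR (M N) / (2 * INR N + 1) ^ 2 - Rabs (IZR (n N)) / (2 * INR N + 1) * / (2 * INR N + 1))
       by (field; lra). lra. }
    apply Rmult_lt_compat_r with (r := (2 * INR N + 1) ^ 2) in H; [|apply pow_lt; lra].
    rewrite Rmult_0_l in H. unfold Rdiv in H. rewrite Rmult_assoc, Rinv_l in H; [lra | apply pow_nonzero; lra]. }
  assert (Lsq : is_lim_seq (fun N => (IZR (n N) / (2 * INR N + 1)) ^ 2) (x ^ 2)).
  { simpl. apply is_lim_seq_mult'; [assumption|]. apply is_lim_seq_mult'; [assumption|apply is_lim_seq_const]. }
  assert (Bnd : forall s : R, Rabs s = 1 ->
    is_lim_seq (fun N => exp (- ((IZR (n N) / (2 * INR N + 1)) ^ 2 /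
      (INR (M N) / (2 * INR N + 1) ^ 2 + s * (Rabs (IZR (n N) / (2 * INR N + 1)) * / (2 * INR N + 1))))))
     (exp (- (x ^ 2 / c)))).
  { intros s _. apply is_lim_seq_exp. apply is_lim_seq_opp'. apply is_lim_seq_div'; [assumption| |lra].
    replace c with (c + s * 0) by ring.
    apply is_lim_seq_plus'; [assumption|]. apply is_lim_seq_mult'; [apply is_lim_seq_const|assumption]. }
  apply (is_lim_seq_le_le_loc
     (fun N => exp (- ((IZR (n N) / (2 * INR N + 1)) ^ 2 /
      (INR (M N) / (2 * INR N + 1) ^ 2 + Ropp 1 * (Rabs (IZR (n N) / (2 * INR N + 1)) * / (2 * INR N + 1))))))
     _ (fun N => exp (- ((IZR (n N) / (2 * INR N + 1)) ^ 2 /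
      (INR (M N) / (2 * INR N + 1) ^ 2 + 1 * (Rabs (IZR (n N) / (2 * INR N + 1)) * / (2 * INR N + 1))))))).
  2: apply (Bnd (Ropp 1)); rewrite Rabs_Ropp; apply Rabs_R1.
  2: apply (Bnd 1), Rabs_R1.
  destruct Ev as [N0 H0]. exists N0. intros N HN. specialize (H0 N HN). specialize (PL N).
  assert (W0 := walk_0_pos (M N)).
  assert (Hlt : Rabs (IZR (n N)) < INR (M N)) by (rewrite <- INR_abs_nat; now apply lt_INR).
  assert (Hge := Rabs_pos (IZR (n N))).
  rewrite Rabs_div, (Rabs_pos_eq (2 * INR N + 1)) by lra.
  replace ((IZR (n N) / (2 * INR N + 1)) ^ 2) with ((Rabs (IZR (n N)) / (2 * INR N + 1)) ^ 2).
  2:{ unfold Rdiv. rewrite !Rpow_mult_distr, pow2_abs. reflexivity. }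
  rewrite (walk_abs (M N) (n N)). split.
  - apply Rle_div_r; [assumption|].
    eapply Rle_trans; [|apply (walk_ge (M N) (Z.abs_nat (n N)) (Z.abs_nat (n N))); lia].
    rewrite Rmult_comm, INR_abs_nat. apply Rmult_le_compat_l; [lra|]. right. do 2 f_equal.
    field. split; lra.
  - apply Rle_div_l; [assumption|].
    eapply Rle_trans; [apply (walk_le_gen (M N) (Z.abs_nat (n N)) (Z.abs_nat (n N))); lia|].
    rewrite Rmult_comm, INR_abs_nat. apply Rmult_le_compat_r; [lra|]. right. do 2 f_equal.
    field. split; lra.
Qed.

Lemma cos_even_pow t M : cos t ^ (2 * M) = (1 - sin t ^ 2) ^ M.
Proof.
  rewrite pow_mult. f_equal. generalize (sin2_cos2 t). unfold Rsqr. intros; simpl. lra.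
Qed.

Lemma cos_pow_le t M : cos t ^ (2 * M) <= exp (- (INR M * sin t ^ 2)).
Proof.
  rewrite cos_even_pow. replace (- (INR M * sin t ^ 2)) with (INR M * - sin t ^ 2) by ring.
  rewrite <- exp_mult_nat. apply pow_incr. split.
  - generalize (sin2_cos2 t) (Rle_0_sqr (cos t)). unfold Rsqr. intros; simpl; lra.
  - generalize (exp_ineq1_le (- sin t ^ 2)). lra.
Qed.

Lemma cos_pow_ge t M : sin t ^ 2 < 1 ->
  exp (- (INR M * sin t ^ 2 / (1 - sin t ^ 2))) <= cos t ^ (2 * M).
Proof.
  intros H. rewrite cos_even_pow.
  replace (- (INR M * sin t ^ 2 / (1 - sin t ^ 2))) with (INR M * - (sin t ^ 2 / (1 - sin t ^ 2))) by (field; lra).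
  rewrite <- exp_mult_nat. apply pow_incr. split; [left; apply exp_pos|].
  apply exp_lower_one_minus. split; [apply pow2_ge_0 | assumption].
Qed.

Lemma sin_L_lim t : is_lim_seq (fun N => sin (t / (2 * INR N + 1)) * (2 * INR N + 1)) t.
Proof.
  assert (PL : forall N, 0 < 2 * INR N + 1) by (intros N; generalize (pos_INR N); lra).
  destruct (Req_dec t 0) as [->|Ht].
  - apply (is_lim_seq_ext (fun _ => 0)); [|apply is_lim_seq_const].
    intros N. unfold Rdiv. rewrite Rmult_0_l, sin_0. ring.
  - apply (is_lim_seq_ext (fun N => t * (sin (t * / (2 * INR N + 1)) / (t * / (2 * INR N + 1))))).
    { intros N. unfold Rdiv. field. split; [|assumption]. generalize (PL N); lra. }
    replace (Finite t) with (Finite (t * 1)) by (f_equal; ring).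
    apply is_lim_seq_mult'; [apply is_lim_seq_const|].
    apply (is_lim_comp_seq (fun x => sin x / x) (fun N => t * / (2 * INR N + 1)) 0 1).
    + apply is_lim_sinc_0.
    + exists 0%nat. intros N _ E. injection E as E. apply Rmult_integral in E. destruct E as [E|E]; [tauto|].
      generalize (Rinv_0_lt_compat _ (PL N)). lra.
    + replace (Finite 0) with (Finite (t * 0)) by (f_equal; ring).
      apply is_lim_seq_mult'; [apply is_lim_seq_const | apply lim_inv_L].
Qed.

Lemma cos_pow_lim (M : nat -> nat) (c t : R) :
  is_lim_seq (fun N => INR (M N) / (2 * INR N + 1) ^ 2) c ->
  is_lim_seq (fun N => cos (t / (2 * INR N + 1)) ^ (2 * M N)) (exp (- (c * t ^ 2))).
Proof.
  intros LM.
  assert (PL : forall N, 0 < 2 * INR N + 1) by (intros N; generalize (pos_INR N); lra).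
  set (s := fun N => sin (t / (2 * INR N + 1))).
  assert (Ls : is_lim_seq s 0).
  { apply (is_lim_seq_ext (fun N => (sin (t / (2 * INR N + 1)) * (2 * INR N + 1)) * / (2 * INR N + 1))).
    - intros N. unfold s. field. generalize (PL N); lra.
    - replace (Finite 0) with (Finite (t * 0)) by (f_equal; ring).
      apply is_lim_seq_mult'; [apply sin_L_lim | apply lim_inv_L]. }
  assert (Ls2 : is_lim_seq (fun N => s N ^ 2) 0).
  { replace (Finite 0) with (Finite (0 * (0 * 1))) by (f_equal; ring).
    simpl. apply is_lim_seq_mult'; [assumption|]. apply is_lim_seq_mult'; [assumption|apply is_lim_seq_const]. }
  assert (LMs : is_lim_seq (fun N => INR (M N) * s N ^ 2) (c * t ^ 2)).
  { apply (is_lim_seq_ext (fun N => INR (M N) / (2 * INR N + 1) ^ 2 * (s N * (2 * INR N + 1)) ^ 2)).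
    - intros N. field. generalize (PL N); lra.
    - apply is_lim_seq_mult'; [assumption|]. simpl.
      apply is_lim_seq_mult'; [apply sin_L_lim|]. apply is_lim_seq_mult'; [apply sin_L_lim|apply is_lim_seq_const]. }
  apply (is_lim_seq_le_le_loc (fun N => exp (- (INR (M N) * s N ^ 2 / (1 - s N ^ 2))))
     _ (fun N => exp (- (INR (M N) * s N ^ 2)))).
  - apply is_lim_seq_spec in Ls2. destruct (Ls2 (mkposreal 1 Rlt_0_1)) as [N0 H0].
    exists N0. intros N HN. specialize (H0 N HN). cbn [pos] in H0.
    rewrite Rminus_0_r in H0. apply Rabs_def2 in H0. split.
    + apply cos_pow_ge. apply H0.
    + apply cos_pow_le.
  - apply is_lim_seq_exp, is_lim_seq_opp'. replace (c * t ^ 2) with (c * t ^ 2 / (1 - 0)) by field.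
    apply is_lim_seq_div'; [assumption| |lra]. apply is_lim_seq_minus'; [apply is_lim_seq_const|assumption].
  - now apply is_lim_seq_exp, is_lim_seq_opp'.
Qed.

Lemma IZR_odd N : IZR (2 * Z.of_nat N + 1) = 2 * INR N + 1.
Proof. rewrite plus_IZR, mult_IZR, <- INR_IZR_INZ. reflexivity. Qed.

(** The limit of [walk_finite_poisson] on a cycle of length [L = 2 N + 1], with about [c * L ^ 2]
    steps and residue about [rho * L]. Dividing the left-hand side by [walk M 0] leaves the factor
    [L * walk M 0], which tends to [K / sqrt c]. *)
Lemma poisson_upto_constant (K c rho b : R) :
  is_lim_seq (fun M => sqrt (INR M) * walk M 0) K -> 0 < c -> 0 <= b <= 1 / 2 ->
  K / sqrt c * zsum (fun n => exp (- ((rho + IZR n) ^ 2 / c)) * cos (2 * PI * b * (rho + IZR n)))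
  = zsum (fun k => exp (- (c * (PI * (IZR k + b)) ^ 2)) * cos (IZR k * (2 * PI * rho))).
Proof.
  intros HK Hc Hb.
  assert (PL : forall N, 1 <= 2 * INR N + 1) by (intros N; generalize (pos_INR N); lra).
  set (L := fun N => 2 * INR N + 1).
  set (M := fun N => Z.to_nat (up (c * L N ^ 2))).
  set (r := fun N => up (rho * L N)).
  assert (PL2 : forall N, 1 <= L N ^ 2) by (intros N; generalize (PL N); unfold L; nra).
  assert (HM : forall N, c * L N ^ 2 < INR (M N) <= c * L N ^ 2 + 1).
  { intros N. unfold M. rewrite INR_IZR_INZ. destruct (archimed (c * L N ^ 2)) as [U1 U2].
    rewrite Z2Nat.id; [lra|]. apply le_IZR. generalize (PL2 N). nra. }
  assert (HMpos : forall N, (0 < M N)%nat).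
  { intros N. apply INR_lt. simpl. generalize (HM N) (PL2 N). nra. }
  assert (Hr : forall N, rho * L N < IZR (r N) <= rho * L N + 1).
  { intros N. unfold r. generalize (archimed (rho * L N)). lra. }
  assert (LM : is_lim_seq (fun N => INR (M N) / L N ^ 2) c).
  { apply squeeze_inv_L. intros N. fold (L N). specialize (HM N). specialize (PL2 N). specialize (PL N). fold (L N) in PL.
    replace (INR (M N) / L N ^ 2 - c) with ((INR (M N) - c * L N ^ 2) / L N ^ 2) by (field; lra).
    rewrite Rabs_pos_eq by (apply Rdiv_le_0_compat; lra).
    apply Rle_trans with (1 / L N ^ 2).
    - apply Rmult_le_compat_r; [left; apply Rinv_0_lt_compat|]; lra.
    - unfold Rdiv. rewrite Rmult_1_l. apply Rinv_le_contravar; nra. }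
  assert (Lr : is_lim_seq (fun N => IZR (r N) / L N) rho).
  { apply squeeze_inv_L. intros N. fold (L N). specialize (Hr N). specialize (PL N). fold (L N) in PL.
    replace (IZR (r N) / L N - rho) with ((IZR (r N) - rho * L N) / L N) by (field; lra).
    rewrite Rabs_pos_eq by (apply Rdiv_le_0_compat; lra).
    rewrite <- (Rmult_1_l (/ L N)).
    apply Rmult_le_compat_r; [left; apply Rinv_0_lt_compat|]; lra. }
  assert (Lcoef : is_lim_seq (fun N => L N * walk (M N) 0) (K / sqrt c)).
  { apply (is_lim_seq_ext (fun N => (sqrt (INR (M N)) * walk (M N) 0) / sqrt (INR (M N) / L N ^ 2))).
    - intros N. specialize (HM N). specialize (PL2 N). specialize (PL N). fold (L N) in PL.
      assert (0 < INR (M N)) by nra.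
      rewrite sqrt_div by lra. rewrite sqrt_pow2 by lra. field.
      split; [lra | apply Rgt_not_eq, sqrt_lt_R0; lra].
    - apply is_lim_seq_div'.
      + apply (is_lim_seq_subseq (fun m => sqrt (INR m) * walk m 0) K M); [|exact HK].
        intros P [n0 Hn0]. destruct (nfloor_ex (INR n0 / c)) as [n1 Hn1].
        { apply Rdiv_le_0_compat; [apply pos_INR | assumption]. }
        exists (S n1). intros N HN. apply Hn0. apply INR_le. left.
        eapply Rle_lt_trans; [|apply HM]. apply le_INR in HN. rewrite S_INR in HN.
        destruct Hn1 as [_ Hn1]. rewrite Rmult_comm. apply Rle_div_l; [assumption|].
        unfold L. generalize (pos_INR N). nra.
      + apply (is_lim_seq_continuous sqrt); [|assumption]. apply continuity_pt_sqrt. lra.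
      + apply Rgt_not_eq, sqrt_lt_R0. assumption. }
  assert (LHS : is_lim_seq (fun N => zsum (fun nu =>
       walk (M N) (r N + nu * (2 * Z.of_nat N + 1)) / walk (M N) 0
       * cos (2 * PI * b / L N * IZR (r N + nu * (2 * Z.of_nat N + 1)))))
     (zsum (fun n => exp (- ((rho + IZR n) ^ 2 / c)) * cos (2 * PI * b * (rho + IZR n))))).
  { set (kap := / (2 * (c + 1))).
    assert (Hkap : 0 < kap) by (apply Rinv_0_lt_compat; lra).
    assert (Hfrac : forall N nu, IZR (r N + nu * (2 * Z.of_nat N + 1)) / L N = IZR (r N) / L N + IZR nu).
    { intros N nu. rewrite plus_IZR, mult_IZR, IZR_odd. fold (L N). field.
      generalize (PL N). fold (L N). lra. }
    apply (zsum_dominated _ _ (exp (kap * (2 * (Rabs rho + 1) + 1))) (2 * kap)); [lra | |].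
    - intros N nu. rewrite Rabs_mult.
      assert (W0 := walk_0_pos (M N)).
      set (n := (r N + nu * (2 * Z.of_nat N + 1))%Z).
      rewrite Rabs_pos_eq by (apply Rdiv_le_0_compat; [apply walk_range | assumption]).
      apply Rle_trans with (exp (- (IZR n ^ 2 / (2 * INR (M N)))) * 1).
      { apply Rmult_le_compat; [apply Rdiv_le_0_compat; [apply walk_range | assumption] | apply Rabs_pos | | apply Rabs_cos_le1].
        apply Rle_div_l; [assumption|]. rewrite Rmult_comm. apply walk_gauss, HMpos. }
      rewrite Rmult_1_r.
      apply Rle_trans with (exp (- (kap * (IZR n / L N) ^ 2))).
      { apply exp_le, Ropp_le_contravar. unfold kap.
        specialize (HM N). specialize (PL2 N). specialize (PL N). fold (L N) in PL.
        replace (/ (2 * (c + 1)) * (IZR n / L N) ^ 2) with (IZR n ^ 2 * / (2 * ((c + 1) * L N ^ 2))) by (field; lra).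
        apply Rmult_le_compat_l; [apply pow2_ge_0|]. apply Rinv_le_contravar; nra. }
      apply exp_sqr_decay; [assumption|]. unfold n. rewrite Hfrac.
      assert (Rabs (IZR (r N) / L N) <= Rabs rho + 1).
      { replace (IZR (r N) / L N) with (rho + (IZR (r N) / L N - rho)) by ring.
        eapply Rle_trans; [apply Rabs_triang|]. apply Rplus_le_compat_l.
        specialize (Hr N). specialize (PL N). fold (L N) in PL.
        replace (IZR (r N) / L N - rho) with ((IZR (r N) - rho * L N) / L N) by (field; lra).
        rewrite Rabs_pos_eq by (apply Rdiv_le_0_compat; lra). apply Rle_div_l; lra. }
      generalize (Rabs_triang_inv (IZR nu) (- (IZR (r N) / L N))).
      rewrite Rabs_Ropp. replace (IZR nu - - (IZR (r N) / L N)) with (IZR (r N) / L N + IZR nu) by ring. lra.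
    - intros nu.
      assert (Lx : is_lim_seq (fun N => IZR (r N + nu * (2 * Z.of_nat N + 1)) / L N) (rho + IZR nu)).
      { apply (is_lim_seq_ext (fun N => IZR (r N) / L N + IZR nu)); [intros; now rewrite Hfrac|].
        apply is_lim_seq_plus'; [assumption | apply is_lim_seq_const]. }
      apply is_lim_seq_mult'.
      + apply (walk_lim M (fun N => (r N + nu * (2 * Z.of_nat N + 1))%Z)); assumption.
      + apply (is_lim_seq_continuous cos); [apply continuity_cos|].
        apply (is_lim_seq_ext (fun N => 2 * PI * b * (IZR (r N + nu * (2 * Z.of_nat N + 1)) / L N))).
        * intros N. field. generalize (PL N). fold (L N). lra.
        * apply is_lim_seq_mult'; [apply is_lim_seq_const | assumption]. }
  assert (RHS : is_lim_seq (fun N => zsum (window N (fun k => cos (PI * (IZR k + b) / L N) ^ (2 * M N)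
                      * cos (IZR k * (2 * PI * IZR (r N) / L N) - 0))))
     (zsum (fun k => exp (- (c * (PI * (IZR k + b)) ^ 2)) * cos (IZR k * (2 * PI * rho))))).
  { set (kap := c * PI ^ 2 / 9). assert (Ppi := PI_RGT_0).
    assert (Hkap : 0 < kap) by (unfold kap; apply Rdiv_lt_0_compat; [apply Rmult_lt_0_compat; [|apply pow_lt]|]; lra).
    apply (zsum_dominated _ _ (exp (kap * (2 * (1 / 2) + 1))) (2 * kap)); [lra | |].
    - intros N k. unfold window. destruct (Z.leb_spec (Z.abs k) (Z.of_nat N)) as [Hk|Hk].
      2:{ rewrite Rabs_R0. apply Rmult_le_pos; left; apply exp_pos. }
      rewrite Rabs_mult, cos_even_pow.
      set (x := PI * (IZR k + b) / L N). specialize (PL N). specialize (PL2 N). specialize (HM N). fold (L N) in PL.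
      (* Here [0 <= b <= 1/2] matters: together with [|k| <= N] it keeps [x] within
         [[- PI / 2, PI / 2]], where [sin] has no second zero. *)
      assert (Hkb : Rabs (IZR k + b) <= L N / 2).
      { apply IZR_le in Hk. rewrite abs_IZR, <- INR_IZR_INZ in Hk.
        apply Rabs_le_between in Hk. apply Rabs_le. unfold L. lra. }
      assert (Hx : Rabs x <= PI / 2).
      { unfold x. rewrite Rabs_div, Rabs_mult, (Rabs_pos_eq PI), (Rabs_pos_eq (L N)) by lra.
        apply Rle_div_l; nra. }
      assert (S2 := sin_sqr_ge x Hx).
      assert (Nn : 0 <= 1 - sin x ^ 2).
      { generalize (sin2_cos2 x) (Rle_0_sqr (cos x)). unfold Rsqr. simpl. lra. }
      rewrite Rabs_pos_eq by (apply pow_le; assumption).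
      apply Rle_trans with (exp (- (kap * (IZR k + b) ^ 2)) * 1).
      { apply Rmult_le_compat; [apply pow_le; assumption | apply Rabs_pos | | apply Rabs_cos_le1].
        rewrite <- cos_even_pow. eapply Rle_trans; [apply cos_pow_le|].
        apply exp_le, Ropp_le_contravar. apply Rle_trans with (c * L N ^ 2 * (x ^ 2 / 9)).
        - right. unfold kap, x. field. lra.
        - apply Rmult_le_compat; nra. }
      rewrite Rmult_1_r. apply exp_sqr_decay; [assumption|].
      generalize (Rabs_triang_inv (IZR k) (- b)).
      rewrite Rabs_Ropp, (Rabs_pos_eq b) by lra. replace (IZR k - - b) with (IZR k + b) by ring. lra.
    - intros k.
      apply (is_lim_seq_ext_loc (fun N => cos (PI * (IZR k + b) / L N) ^ (2 * M N)
                      * cos (IZR k * (2 * PI * (IZR (r N) / L N))))).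
      + exists (Z.abs_nat k). intros N HN. unfold window.
        destruct (Z.leb_spec (Z.abs k) (Z.of_nat N)); [|lia].
        rewrite Rminus_0_r. do 3 f_equal. unfold Rdiv. ring.
      + apply is_lim_seq_mult'.
        * now apply (cos_pow_lim M).
        * apply (is_lim_seq_continuous cos); [apply continuity_cos|].
          apply is_lim_seq_mult'; [apply is_lim_seq_const|].
          apply is_lim_seq_mult'; [apply is_lim_seq_const|assumption]. }
  apply (is_lim_seq_mult' _ _ _ _ Lcoef) in LHS.
  apply (is_lim_seq_ext _ (fun N => zsum (window N (fun k => cos (PI * (IZR k + b) / L N) ^ (2 * M N)
                      * cos (IZR k * (2 * PI * IZR (r N) / L N) - 0))))) in LHS.
  - apply is_lim_seq_unique in LHS, RHS. rewrite LHS in RHS. now injection RHS.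
  - intros N. assert (E := walk_finite_poisson N (M N) (r N) b 0). cbv zeta in E.
    rewrite IZR_odd in E. fold (L N) in E. rewrite <- E, Rmult_assoc. f_equal.
    rewrite <- zsum_scal. apply zsum_ext. intros nu. rewrite Rplus_0_r. field.
    generalize (PL N) (walk_0_pos (M N)). fold (L N). lra.
Qed.

(* The constant is forced by self-duality at [s = 1], so neither Stirling's formula nor
   the Gaussian integral is needed. *)
Theorem poisson s rho b : 0 < s -> 0 <= b <= 1 / 2 ->
  sqrt s * zsum (fun n => exp (- PI * s * (rho + IZR n) ^ 2) * cos (2 * PI * b * (rho + IZR n)))
  = zsum (fun k => exp (- PI / s * (IZR k + b) ^ 2) * cos (2 * PI * IZR k * rho)).
Proof.
  intros Hs Hb. assert (Ppi := PI_RGT_0).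
  destruct walk_0_lim as [K [PK HK]].
  assert (Kpi : K * sqrt PI = 1).
  { assert (E := poisson_upto_constant K (/ PI) 0 0 HK (Rinv_0_lt_compat _ Ppi)).
    rewrite sqrt_inv in E.
    rewrite (zsum_ext _ (fun n => exp (- PI * IZR n ^ 2))) in E.
    2:{ intros n. replace (2 * PI * 0 * (0 + IZR n)) with 0 by ring. rewrite cos_0, Rmult_1_r.
        f_equal. field. lra. }
    rewrite (zsum_ext (fun k => _ * cos (IZR k * (2 * PI * 0))) (fun n => exp (- PI * IZR n ^ 2))) in E.
    2:{ intros n. replace (IZR n * (2 * PI * 0)) with 0 by ring. rewrite cos_0, Rmult_1_r.
        f_equal. field. lra. }
    unfold Rdiv in E. rewrite Rinv_inv in E.
    assert (P : 0 < zsum (fun n => exp (- PI * IZR n ^ 2))).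
    { assert (G : gb1 (fun n => exp (- PI * IZR n ^ 2))).
      { exists (exp (PI * (2 * 0 + 1))), (2 * PI). split; [lra|]. intros k.
        rewrite Rabs_pos_eq by (left; apply exp_pos).
        replace (- PI * IZR k ^ 2) with (- (PI * IZR k ^ 2)) by ring.
        apply exp_sqr_decay; lra. }
      apply Rlt_le_trans with (zsum (single 0 1)); [rewrite zsum_single; lra|].
      apply zsum_le; [apply gb1_single | assumption |]. intros k. unfold single.
      destruct (Z.eqb_spec k 0) as [->|_]; [|left; apply exp_pos].
      replace (- PI * 0 ^ 2) with 0 by ring. rewrite exp_0. lra. }
    specialize (E ltac:(lra)). nra. }
  assert (E := poisson_upto_constant K (/ (PI * s)) rho b HK).
  assert (0 < PI * s) by nra.
  specialize (E (Rinv_0_lt_compat _ H) Hb).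
  rewrite sqrt_inv, sqrt_mult in E by lra. unfold Rdiv in E at 1. rewrite Rinv_inv in E.
  replace (K * (sqrt PI * sqrt s)) with (sqrt s) in E.
  2:{ rewrite <- Rmult_assoc, Kpi. ring. }
  rewrite (zsum_ext _ (fun n => exp (- PI * s * (rho + IZR n) ^ 2) * cos (2 * PI * b * (rho + IZR n)))) in E.
  2:{ intros n. do 2 f_equal. field. lra. }
  rewrite E. apply zsum_ext. intros k. f_equal; f_equal; field; lra.
Qed.

(** * Rows of the lattice and duality *)

Lemma qform_lower x y c1 c2 : 0 < y -> exists d, forall k l,
  / y * 2 * (Rabs (IZR k) + Rabs (IZR l)) - d <= qform x y (IZR k + c1) (IZR l + c2).
Proof.
  intros Hy. exists (/ y * (2 * Rabs c1 + 2 * Rabs c2 + 1 + ((Rabs x + 1) / y) ^ 2)). intros k l.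
  set (u := IZR k + c1). set (v := IZR l + c2). set (m := Rabs x + 1).
  assert (Hu : Rabs (IZR k) <= Rabs u + Rabs c1).
  { replace (IZR k) with (u + - c1) by (unfold u; ring).
    eapply Rle_trans; [apply Rabs_triang|]. rewrite Rabs_Ropp. lra. }
  assert (Hv : Rabs (IZR l) <= Rabs v + Rabs c2).
  { replace (IZR l) with (v + - c2) by (unfold v; ring).
    eapply Rle_trans; [apply Rabs_triang|]. rewrite Rabs_Ropp. lra. }
  assert (HU : Rabs u <= Rabs (u + x * v) + Rabs x * Rabs v).
  { rewrite <- Rabs_mult. replace u with ((u + x * v) + - (x * v)) at 1 by ring.
    eapply Rle_trans; [apply Rabs_triang|]. rewrite Rabs_Ropp. lra. }
  assert (Q1 : 2 * Rabs (u + x * v) - 1 <= (u + x * v) ^ 2).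
  { rewrite <- pow2_abs. generalize (pow2_ge_0 (Rabs (u + x * v) - 1)). lra. }
  assert (Q2 : 2 * m * Rabs v - (m / y) ^ 2 <= y ^ 2 * v ^ 2).
  { rewrite <- (pow2_abs v). generalize (pow2_ge_0 (y * Rabs v - m / y)).
    replace ((y * Rabs v - m / y) ^ 2) with (y ^ 2 * Rabs v ^ 2 - 2 * m * Rabs v + (m / y) ^ 2) by (field; lra).
    lra. }
  unfold qform. fold u v.
  replace ((u ^ 2 + 2 * x * u * v + (x ^ 2 + y ^ 2) * v ^ 2) / y)
    with (/ y * ((u + x * v) ^ 2 + y ^ 2 * v ^ 2)) by (field; lra).
  rewrite Rmult_assoc, <- Rmult_minus_distr_l. apply Rmult_le_compat_l; [left; now apply Rinv_0_lt_compat|].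
  fold m. unfold m in *. nra.
Qed.

Lemma gb2_qform x y c1 c2 a : 0 < y -> 0 < a ->
  gb2 (fun k l => exp (- PI * a * qform x y (IZR k + c1) (IZR l + c2))).
Proof.
  intros Hy Ha. destruct (qform_lower x y c1 c2 Hy) as [d Hd]. assert (Ppi := PI_RGT_0).
  apply (gb2_ext (fun k l => exp (- (PI * a * qform x y (IZR k + c1) (IZR l + c2))))).
  - intros. f_equal. ring.
  - assert (0 < PI * a) by now apply Rmult_lt_0_compat.
    apply (gb2_exp _ (PI * a * (/ y * 2)) (PI * a * d)).
    + apply Rmult_lt_0_compat; [assumption|]. generalize (Rinv_0_lt_compat y Hy). lra.
    + intros k l. rewrite Rmult_assoc, <- Rmult_minus_distr_l.
      apply Rmult_le_compat_l; [lra | apply Hd].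
Qed.

(** One row of the lattice, a Jacobi theta function: [s] is the inverse squared width, [u] the
    offset and [b] the twist. The rows of [theta] have twist 0, those of [thetahat] the twist
    [b2 x y]. *)
Definition chi (s b u : R) : R :=
  zsum (fun k => exp (- PI * s * (IZR k + u) ^ 2) * cos (2 * PI * b * (IZR k + u))).

(** (-1)^l, written as a cosine because this is how the addition formulas deliver it. *)
Definition sgn (l : Z) : R := cos (PI * IZR l).

Lemma gb1_gauss s u : 0 < s -> gb1 (fun k => exp (- PI * s * (IZR k + u) ^ 2)).
Proof.
  intros Hs. assert (Ppi := PI_RGT_0). assert (0 < PI * s) by now apply Rmult_lt_0_compat.
  exists (exp (PI * s * (2 * Rabs u + 1))), (2 * (PI * s)). split; [lra|]. intros k.
  rewrite Rabs_pos_eq by (left; apply exp_pos).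
  replace (- PI * s * (IZR k + u) ^ 2) with (- (PI * s * (IZR k + u) ^ 2)) by ring.
  apply exp_sqr_decay; [assumption|].
  generalize (Rabs_triang_inv (IZR k) (- u)). rewrite Rabs_Ropp.
  replace (IZR k - - u) with (IZR k + u) by ring. lra.
Qed.

Lemma Rabs_exp_cos t c : Rabs (exp t * cos c) <= exp t.
Proof.
  rewrite Rabs_mult, (Rabs_pos_eq (exp t)) by (left; apply exp_pos).
  rewrite <- (Rmult_1_r (exp t)) at 2. apply Rmult_le_compat_l; [left; apply exp_pos | apply Rabs_cos_le1].
Qed.

Lemma gb1_chi s b u : 0 < s ->
  gb1 (fun k => exp (- PI * s * (IZR k + u) ^ 2) * cos (2 * PI * b * (IZR k + u))).
Proof. intros Hs. eapply gb1_le; [apply (gb1_gauss s u Hs) | intros; apply Rabs_exp_cos]. Qed.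

Lemma sin_PI_Z l : sin (PI * IZR l) = 0.
Proof. rewrite Rmult_comm. apply sin_eq_0_1. now exists l. Qed.

Lemma Rabs_sgn l : Rabs (sgn l) <= 1.
Proof. apply Rabs_cos_le1. Qed.

Lemma sgn_even l j : l = (2 * j)%Z -> sgn l = 1.
Proof.
  intros ->. unfold sgn. rewrite mult_IZR, <- cos_0, <- (cos_2PI_Z 0 j). f_equal. ring.
Qed.

Lemma sgn_odd l j : l = (2 * j + 1)%Z -> sgn l = -1.
Proof.
  intros ->. unfold sgn. rewrite plus_IZR, mult_IZR, <- cos_PI, <- (cos_2PI_Z PI j). f_equal. ring.
Qed.

Lemma b1_b2 x y : 0 < y -> b1 x y + x * b2 x y = 1 / 2.
Proof. intros Hy. unfold b1, b2. field. lra. Qed.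

(* By [b1_b2] the translation has real abscissa 1/2 in every row. *)
Lemma theta_rows x y a : 0 < y -> 0 < a ->
  theta x y (b1 x y) (b2 x y) a
  = zsum (fun l => exp (- PI * (a * y) * (IZR l + b2 x y) ^ 2) * chi (a / y) 0 (1 / 2 + x * IZR l)).
Proof.
  intros Hy Ha. unfold theta. rewrite zsum2_swap by now apply gb2_qform.
  apply zsum_ext. intros l. unfold chi. rewrite <- zsum_scal. apply zsum_ext. intros k.
  replace (2 * PI * 0 * (IZR k + (1 / 2 + x * IZR l))) with 0 by ring. rewrite cos_0, Rmult_1_r, <- exp_plus.
  f_equal. rewrite <- (b1_b2 x y Hy). unfold qform. field. lra.
Qed.

(** The sign comes from [k b2 - l b1 = b2 (k + x l) - l / 2], which is [b1_b2] again. *)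
Lemma thetahat_rows x y a : 0 < y -> 0 < a ->
  thetahat x y (b1 x y) (b2 x y) a
  = zsum (fun l => sgn l * exp (- PI * (a * y) * IZR l ^ 2) * chi (a / y) (b2 x y) (x * IZR l)).
Proof.
  intros Hy Ha. unfold thetahat. rewrite zsum2_swap.
  2:{ eapply gb2_le; [apply (gb2_qform x y 0 0 a Hy Ha)|]. intros k l.
      cbv beta. rewrite !Rplus_0_r. apply Rabs_exp_cos. }
  apply zsum_ext. intros l. unfold chi. rewrite <- zsum_scal. apply zsum_ext. intros k.
  replace (2 * PI * (IZR k * b2 x y - IZR l * b1 x y))
    with (2 * PI * b2 x y * (IZR k + x * IZR l) - PI * IZR l).
  2:{ replace (b1 x y) with (1 / 2 - x * b2 x y) by (generalize (b1_b2 x y Hy); lra). field. }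
  rewrite cos_minus, sin_PI_Z. fold (sgn l).
  replace (- PI * a * qform x y (IZR k) (IZR l))
    with (- PI * (a * y) * IZR l ^ 2 + - PI * (a / y) * (IZR k + x * IZR l) ^ 2)
    by (unfold qform; field; lra).
  rewrite exp_plus. ring.
Qed.

Lemma chi_poisson s b u : 0 < s -> 0 <= b <= 1 / 2 ->
  sqrt s * chi s b u = zsum (fun k => exp (- PI / s * (IZR k + b) ^ 2) * cos (2 * PI * IZR k * u)).
Proof.
  intros Hs Hb. rewrite <- poisson by assumption. f_equal. apply zsum_ext. intros k.
  now rewrite (Rplus_comm u).
Qed.

Lemma gb1_dual s b u : 0 < s ->
  gb1 (fun k => exp (- PI / s * (IZR k + b) ^ 2) * cos (2 * PI * IZR k * u)).
Proof.
  intros Hs. eapply gb1_le; [apply (gb1_gauss (/ s) b); now apply Rinv_0_lt_compat|].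
  intros k. apply Rabs_exp_cos.
Qed.

(** [b2] equals [1/2 - 1 / (8 y ^ 2)], and its lower bound 1/3 is the value at the hexagonal
    lattice. The range lies inside the interval on which [poisson] is available. *)
Lemma b2_range x y : sqrt 3 / 2 <= y -> 1 / 3 <= b2 x y < 1 / 2.
Proof.
  intros Hy. assert (H3 : sqrt 3 * sqrt 3 = 3) by (apply sqrt_sqrt; lra).
  assert (0 < sqrt 3) by (apply sqrt_lt_R0; lra).
  assert (3 / 4 <= y ^ 2) by nra.
  unfold b2. split.
  - apply (Rle_div_r (1 / 3) (4 * y ^ 2 - 1) (8 * y ^ 2)); lra.
  - apply (Rlt_div_l (4 * y ^ 2 - 1) (1 / 2) (8 * y ^ 2)); lra.
Qed.

(** Poisson summation along the rows, applied to either side, leads to the same double series [X],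
    once summed over [l] first and once over [m] first. The sign of the rows on one side matches the
    offset 1/2 on the other. *)
Lemma thetahat_theta x y a : 0 < a -> sqrt 3 / 2 <= y ->
  thetahat x y (b1 x y) (b2 x y) a = theta x y (b1 x y) (b2 x y) (/ a) / a.
Proof.
  intros Ha Hy. assert (0 < sqrt 3) by (apply sqrt_lt_R0; lra). assert (Hy0 : 0 < y) by lra.
  assert (Hb := b2_range x y Hy). assert (Hia := Rinv_0_lt_compat a Ha).
  assert (Hs : 0 < a / y) by now apply Rdiv_lt_0_compat.
  assert (Hs' : 0 < / a / y) by now apply Rdiv_lt_0_compat.
  set (X := fun l m : Z => exp (- PI * (a * y) * IZR l ^ 2) * exp (- PI * (y / a) * (IZR m + b2 x y) ^ 2)
                * (sgn l * cos (2 * PI * IZR m * (x * IZR l)))).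
  assert (E1 : sqrt (a / y) * thetahat x y (b1 x y) (b2 x y) a = zsum2 X).
  { rewrite thetahat_rows by assumption. rewrite <- zsum_scal. apply zsum_ext. intros l.
    transitivity (sgn l * exp (- PI * (a * y) * IZR l ^ 2) * (sqrt (a / y) * chi (a / y) (b2 x y) (x * IZR l))); [ring|].
    rewrite chi_poisson by (assumption || lra). rewrite <- zsum_scal. apply zsum_ext. intros m.
    unfold X. replace (- PI / (a / y) * (IZR m + b2 x y) ^ 2) with (- PI * (y / a) * (IZR m + b2 x y) ^ 2) by (field; lra).
    ring. }
  assert (E2 : sqrt (/ a / y) * theta x y (b1 x y) (b2 x y) (/ a) = zsum2 (fun m l => X l m)).
  { rewrite theta_rows by assumption. rewrite <- zsum_scal. apply zsum_ext. intros m.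
    transitivity (exp (- PI * (/ a * y) * (IZR m + b2 x y) ^ 2) * (sqrt (/ a / y) * chi (/ a / y) 0 (1 / 2 + x * IZR m))); [ring|].
    rewrite chi_poisson by (assumption || lra). rewrite <- zsum_scal. apply zsum_ext. intros l.
    unfold X. rewrite Rplus_0_r.
    replace (- PI / (/ a / y) * IZR l ^ 2) with (- PI * (a * y) * IZR l ^ 2) by (field; lra).
    replace (- PI * (/ a * y) * (IZR m + b2 x y) ^ 2) with (- PI * (y / a) * (IZR m + b2 x y) ^ 2) by (field; lra).
    replace (2 * PI * IZR l * (1 / 2 + x * IZR m)) with (2 * PI * IZR m * (x * IZR l) + PI * IZR l) by field.
    rewrite cos_plus, sin_PI_Z. fold (sgn l). ring. }
  assert (G : gb2 X).
  { assert (P1 : 0 < a * y) by now apply Rmult_lt_0_compat. 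
    assert (P2 : 0 < y / a) by now apply Rdiv_lt_0_compat.
    destruct (gb1_gauss (a * y) 0 P1) as (C & e & He & B).
    destruct (gb1_gauss (y / a) (b2 x y) P2) as (C' & e' & He' & B').
    exists (C * C'), (Rmin e e'). split; [now apply Rmin_glb_lt|]. intros l m.
    assert (0 <= C) by (eapply gb_const_nonneg; [apply (B 0%Z) | apply decay_pos]).
    assert (0 <= C') by (eapply gb_const_nonneg; [apply (B' 0%Z) | apply decay_pos]).
    unfold X. rewrite Rabs_mult, Rabs_mult, <- (Rmult_1_r (C * C' * _)).
    apply Rmult_le_compat.
    - apply Rmult_le_pos; apply Rabs_pos.
    - apply Rabs_pos.
    - replace (C * C' * (decay (Rmin e e') l * decay (Rmin e e') m))
        with ((C * decay (Rmin e e') l) * (C' * decay (Rmin e e') m)) by ring.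
      apply Rmult_le_compat; try apply Rabs_pos.
      + specialize (B l). rewrite Rplus_0_r in B. eapply Rle_trans; [apply B|].
        apply Rmult_le_compat_l; [assumption|apply decay_mono, Rmin_l].
      + eapply Rle_trans; [apply B'|]. apply Rmult_le_compat_l; [assumption|apply decay_mono, Rmin_r].
    - rewrite Rabs_mult. generalize (Rabs_sgn l) (Rabs_cos_le1 (2 * PI * IZR m * (x * IZR l))).
      generalize (Rabs_pos (sgn l)) (Rabs_pos (cos (2 * PI * IZR m * (x * IZR l)))). nra. }
  rewrite <- (zsum2_swap X G), <- E1 in E2.
  replace (sqrt (a / y)) with (a * sqrt (/ a / y)) in E2.
  - apply Rmult_eq_reg_l with (a * sqrt (/ a / y)).
    + rewrite <- E2. field. lra.
    + apply Rgt_not_eq, Rmult_lt_0_compat; [assumption | now apply sqrt_lt_R0].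
  - rewrite <- (sqrt_pow2 a) at 1 by lra. rewrite <- sqrt_mult by (try apply pow2_ge_0; lra).
    f_equal. field. lra.
Qed.

Lemma chi_shift s b u n : 0 < s -> chi s b (u + IZR n) = chi s b u.
Proof.
  intros Hs. unfold chi. rewrite <- (zsum_shift (fun k => exp (- PI * s * (IZR k + u) ^ 2) * cos (2 * PI * b * (IZR k + u))) n)
    by now apply gb1_chi.
  apply zsum_ext. intros k. rewrite plus_IZR.
  now replace (IZR k + IZR n + u) with (IZR k + (u + IZR n)) by ring.
Qed.

Lemma chi_opp s b u : 0 < s -> chi s b (- u) = chi s b u.
Proof.
  intros Hs. unfold chi. rewrite <- (zsum_neg (fun k => exp (- PI * s * (IZR k + u) ^ 2) * cos (2 * PI * b * (IZR k + u))))
    by now apply gb1_chi.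
  apply zsum_ext. intros k. rewrite opp_IZR. f_equal.
  - f_equal. ring.
  - rewrite <- cos_neg. f_equal. ring.
Qed.

(** By Poisson summation the Fourier coefficients in [u] are positive, for every admissible
    twist. *)
Lemma chi_le_0 s b u : 0 < s -> 0 <= b <= 1 / 2 -> Rabs (chi s b u) <= chi s b 0.
Proof.
  intros Hs Hb. assert (0 < sqrt s) by now apply sqrt_lt_R0.
  apply Rmult_le_reg_l with (sqrt s); [assumption|].
  rewrite <- (Rabs_pos_eq (sqrt s)) at 1 by lra. rewrite <- Rabs_mult, !chi_poisson by assumption.
  apply zsum_abs_le; try now apply gb1_dual.
  intros k. rewrite Rmult_0_r, cos_0, Rmult_1_r. apply Rabs_exp_cos.
Qed.

(** * Horizontal deformation: [x = 1/2] is optimal *)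

Lemma Rabs_sin_mult n t : Rabs (sin (INR n * t)) <= INR n * Rabs (sin t).
Proof.
  induction n as [|n IH].
  - simpl. rewrite Rmult_0_l, sin_0, Rabs_R0. lra.
  - rewrite S_INR, Rmult_plus_distr_r, Rmult_1_l, sin_plus.
    eapply Rle_trans; [apply Rabs_triang|]. rewrite !Rabs_mult.
    generalize (Rabs_cos_le1 t) (Rabs_cos_le1 (INR n * t)) (Rabs_pos (sin t)) (Rabs_pos (sin (INR n * t))).
    nra.
Qed.

Lemma one_minus_cos_mult l t : 1 - cos (IZR l * t) <= IZR l ^ 2 * (1 - cos t).
Proof.
  assert (H : forall u, 1 - cos u = 2 * sin (u / 2) ^ 2).
  { intros u. replace u with (2 * (u / 2)) at 1 by field. rewrite cos_2a_sin. ring. }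
  rewrite !H. replace (IZR l * t / 2) with (IZR l * (t / 2)) by field.
  rewrite <- (pow2_abs (sin (IZR l * (t / 2)))), <- (pow2_abs (sin (t / 2))), <- (pow2_abs (IZR l)).
  rewrite <- INR_abs_nat.
  assert (E : Rabs (sin (IZR l * (t / 2))) = Rabs (sin (INR (Z.abs_nat l) * (t / 2)))).
  { rewrite INR_abs_nat. unfold Rabs at 3. destruct (Rcase_abs (IZR l)); [|reflexivity].
    rewrite Ropp_mult_distr_l_reverse, sin_neg, Rabs_Ropp. reflexivity. }
  rewrite E. generalize (Rabs_sin_mult (Z.abs_nat l) (t / 2)) (Rabs_pos (sin (INR (Z.abs_nat l) * (t / 2)))).
  intros. assert (Rabs (sin (INR (Z.abs_nat l) * (t / 2))) ^ 2 <= (INR (Z.abs_nat l) * Rabs (sin (t / 2))) ^ 2)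
    by (apply pow_incr; lra).
  rewrite Rpow_mult_distr in H2. lra.
Qed.

Lemma zsum_minus f g : gb1 f -> gb1 g -> zsum (fun k => f k - g k) = zsum f - zsum g.
Proof.
  intros Hf Hg. rewrite (zsum_ext _ (fun k => f k + -1 * g k)) by (intros; ring).
  rewrite zsum_plus, zsum_scal; [ring | assumption | now apply gb1_scal].
Qed.

Lemma gb1_minus f g : gb1 f -> gb1 g -> gb1 (fun k => f k - g k).
Proof.
  intros Hf Hg. apply (gb1_ext (fun k => f k + -1 * g k)); [intros; ring|].
  apply gb1_plus; [assumption | now apply gb1_scal].
Qed.

(* The Fourier coefficients of [chi s 0] are positive, so its oscillation at the
   minimum 1/2 is dominated by that at the maximum 0. *)
Lemma chi_half_diff s l u : 0 < s ->
  chi s 0 (1 / 2 - IZR l * u) - chi s 0 (1 / 2) <= IZR l ^ 2 * (chi s 0 0 - chi s 0 u).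
Proof.
  intros Hs. assert (Hq : 0 < sqrt s) by now apply sqrt_lt_R0.
  apply Rmult_le_reg_l with (sqrt s); [assumption|].
  replace (sqrt s * (IZR l ^ 2 * (chi s 0 0 - chi s 0 u)))
    with (IZR l ^ 2 * (sqrt s * chi s 0 0 - sqrt s * chi s 0 u)) by ring.
  rewrite Rmult_minus_distr_l, !chi_poisson by lra.
  rewrite <- !zsum_minus by now apply gb1_dual. rewrite <- zsum_scal.
  apply zsum_le.
  - apply gb1_minus; now apply gb1_dual.
  - apply gb1_scal, gb1_minus; now apply gb1_dual.
  - intros k. rewrite <- !Rmult_minus_distr_l.
    set (p := exp _). assert (Pp : 0 < p) by apply exp_pos.
    match goal with |- p * ?A <= IZR l ^ 2 * (p * ?B) =>
      replace (IZR l ^ 2 * (p * B)) with (p * (IZR l ^ 2 * B)) by ring end.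
    apply Rmult_le_compat_l; [lra|].
    replace (2 * PI * IZR k * (1 / 2 - IZR l * u)) with (PI * IZR k - IZR l * (2 * PI * IZR k * u)) by field.
    replace (2 * PI * IZR k * (1 / 2)) with (PI * IZR k) by field.
    rewrite cos_minus, sin_PI_Z, Rmult_0_r, cos_0. fold (sgn k).
    assert (C := one_minus_cos_mult l (2 * PI * IZR k * u)).
    assert (D := Rabs_sgn k). apply Rabs_le_between in D.
    assert (C1 := COS_bound (IZR l * (2 * PI * IZR k * u))). nra.
Qed.

(** The Fourier mode [k = 1] alone already gives strictness. *)
Lemma chi_lt_0 s u : 0 < s -> 0 < u <= 1 / 2 -> chi s 0 u < chi s 0 0.
Proof.
  intros Hs Hu. assert (Hq : 0 < sqrt s) by now apply sqrt_lt_R0. assert (Ppi := PI_RGT_0).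
  apply Rmult_lt_reg_l with (sqrt s); [assumption|].
  rewrite !chi_poisson by lra.
  assert (G : forall v, gb1 (fun k => exp (- PI / s * (IZR k + 0) ^ 2) * cos (2 * PI * IZR k * v)))
    by (intros; now apply gb1_dual).
  set (c := exp (- PI / s * (1 + 0) ^ 2) * (1 - cos (2 * PI * 1 * u))).
  assert (Pc : 0 < c).
  { apply Rmult_lt_0_compat; [apply exp_pos|].
    assert (cos (2 * PI * 1 * u) < cos 0); [|rewrite cos_0 in H; lra].
    apply cos_decreasing_1; nra. }
  apply Rlt_le_trans with (zsum (fun k => exp (- PI / s * (IZR k + 0) ^ 2) * cos (2 * PI * IZR k * u) + single 1 c k)).
  - rewrite zsum_plus, zsum_single by (apply G || apply gb1_single). lra.
  - apply zsum_le; [apply gb1_plus; [apply G | apply gb1_single] | apply G |].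
    intros k. unfold single. rewrite Rmult_0_r, cos_0.
    destruct (Z.eqb_spec k 1) as [->|_].
    + unfold c. lra.
    + generalize (exp_pos (- PI / s * (IZR k + 0) ^ 2)) (COS_bound (2 * PI * IZR k * u)). nra.
Qed.

(** Meant for [|l| = n + 2], where the exponent is [l ^ 2 - |l|]: the weight [l ^ 2] is swallowed
    and a geometric series with ratio 1/2 remains. *)
Lemma sqr_pow_bound E n : 0 < E <= / 4 ->
  (INR n + 2) ^ 2 * E ^ ((n + 2) * (n + 1)) <= 4 * E ^ 2 * (/ 2) ^ n.
Proof.
  intros HE. induction n as [|n IH].
  - simpl. lra.
  - rewrite S_INR.
    replace ((S n + 2) * (S n + 1))%nat with ((n + 2) * (n + 1) + 2 * (n + 2))%nat by ring.
    rewrite pow_add.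
    assert (N0 := pos_INR n).
    assert (HP : E ^ (2 * (n + 2)) <= / 16 * / 16).
    { replace (2 * (n + 2))%nat with (2 * n + 4)%nat by ring. rewrite pow_add.
      assert (E ^ (2 * n) <= 1) by (rewrite <- (pow1 (2 * n)); apply pow_incr; lra).
      assert (E ^ 4 <= / 16 * / 16).
      { replace (E ^ 4) with (E ^ 2 * E ^ 2) by ring. apply Rmult_le_compat; nra. }
      nra. }
    assert (HQ : 0 <= E ^ ((n + 2) * (n + 1))) by (apply pow_le; lra).
    set (Q := E ^ ((n + 2) * (n + 1))) in *. set (P := E ^ (2 * (n + 2))) in *.
    rewrite <- (tech_pow_Rmult (/ 2)). set (z := (/ 2) ^ n) in *. clearbody z.
    apply Rle_trans with ((INR n + 2) ^ 2 * Q * / 2); [|lra].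
    replace ((INR n + 1 + 2) ^ 2 * (Q * P)) with (Q * ((INR n + 1 + 2) ^ 2 * P)) by ring.
    rewrite (Rmult_comm _ Q), Rmult_assoc. apply Rmult_le_compat_l; [assumption|].
    apply Rle_trans with ((INR n + 1 + 2) ^ 2 * (/ 16 * / 16)); [|generalize (pow2_ge_0 (INR n)); lra].
    apply Rmult_le_compat_l; [apply pow2_ge_0 | assumption].
Qed.

Lemma decay_ln2 n : decay (ln 2) n = (/ 2) ^ Z.abs_nat n.
Proof.
  replace (/ 2) with (exp (- ln 2)) by (rewrite exp_Ropp, exp_ln; lra).
  rewrite exp_mult_nat, INR_abs_nat.
  unfold decay. f_equal. ring.
Qed.

Lemma PI_gt_3 : 3 < PI.
Proof. generalize PI2_3_2. lra. Qed.

Lemma weight_ratio t b l : 1 / 2 <= t -> 0 <= b <= 1 / 2 -> (2 <= Z.abs l)%Z ->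
  IZR l ^ 2 * exp (- PI * t * (IZR l + b) ^ 2)
  <= exp (- PI * t * (IZR (-1) + b) ^ 2) * (16 * exp (- PI * t) ^ 2 * decay (ln 2) l).
Proof.
  intros Ht Hb Hl. assert (P3 := PI_gt_3).
  set (E := exp (- PI * t)).
  assert (HE : 0 < E <= / 4).
  { split; [apply exp_pos|]. unfold E. replace (- PI * t) with (- (PI * t)) by ring.
    rewrite exp_Ropp. apply Rinv_le_contravar; [lra|].
    apply Rle_trans with (exp (3 / 2)); [|apply exp_le; nra].
    eapply Rle_trans; [|apply (exp_ge_taylor (3 / 2) 4); lra]. simpl. lra. }
  set (n := (Z.abs_nat l - 2)%nat).
  assert (Hn : Z.abs_nat l = (n + 2)%nat) by (unfold n; lia).
  assert (Hm : Rabs (IZR l) = INR n + 2) by (rewrite <- INR_abs_nat, Hn, plus_INR; reflexivity).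
  rewrite decay_ln2, Hn, pow_add.
  apply Rle_trans with (IZR l ^ 2 * (exp (- PI * t * (IZR (-1) + b) ^ 2) * E ^ ((n + 2) * (n + 1)))).
  - apply Rmult_le_compat_l; [apply pow2_ge_0|].
    unfold E. rewrite exp_mult_nat, <- exp_plus. apply exp_le.
    rewrite mult_INR, !plus_INR. simpl (INR 2). simpl (INR 1).
    assert (0 < PI * t) by nra.
    (* For negative [l] the difference is [(n + 1) * (n + 3 - 2 b)], and [b <= 1/2] gives the bound;
       positive [l] are farther away. *)
    assert ((INR n + 2) * (INR n + 1) <= (IZR l + b) ^ 2 - (IZR (-1) + b) ^ 2).
    { assert (N0 := pos_INR n). unfold Rabs in Hm. destruct (Rcase_abs (IZR l)).
      - replace (IZR l) with (- (INR n + 2)) by lra. nra.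
      - replace (IZR l) with (INR n + 2) by lra. nra. }
    replace (1 + 1) with 2 by ring. nra.
  - rewrite <- (pow2_abs (IZR l)), Hm.
    replace ((INR n + 2) ^ 2 * (exp (- PI * t * (IZR (-1) + b) ^ 2) * E ^ ((n + 2) * (n + 1))))
      with (exp (- PI * t * (IZR (-1) + b) ^ 2) * ((INR n + 2) ^ 2 * E ^ ((n + 2) * (n + 1)))) by ring.
    apply Rmult_le_compat_l; [left; apply exp_pos|].
    eapply Rle_trans; [now apply sqr_pow_bound|]. right. simpl. field.
Qed.

(** The bound 1/19 serves the margin [16 / 19 < 1] in [theta_step1]. *)
Lemma E_small t : 1 / 2 <= t -> exp (- PI * t) ^ 2 <= / 19.
Proof.
  intros Ht. rewrite exp_mult_nat. simpl (INR 2).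
  replace ((1 + 1) * (- PI * t)) with (- (2 * PI * t)) by ring.
  rewrite exp_Ropp. apply Rinv_le_contravar; [lra|].
  apply Rle_trans with (exp 3); [|apply exp_le; generalize PI_gt_3; nra].
  eapply Rle_trans; [|apply (exp_ge_taylor 3 7); lra]. simpl. lra.
Qed.

(** At [x = 1/2] odd rows sit at the maximum [chi s 0 0] and even rows at [chi s 0 (1/2)]. Gains and
    losses are measured in the unit [D * W (-1)], the gain of row -1 alone; the total loss is at
    most [C <= 16 / 19] units. *)
Lemma theta_step1 x y a : 0 < a -> 1 / 2 <= a * y -> sqrt 3 / 2 <= y -> 0 <= x < 1 / 2 ->
  theta x y (b1 x y) (b2 x y) a < theta (1 / 2) y (b1 (1 / 2) y) (b2 (1 / 2) y) a.
Proof.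
  intros Ha Ht Hy Hx. assert (0 < sqrt 3) by (apply sqrt_lt_R0; lra). assert (Hy0 : 0 < y) by lra.
  rewrite !theta_rows by assumption. change (b2 (1 / 2) y) with (b2 x y).
  assert (Hb := b2_range x y Hy). set (b := b2 x y) in *. clearbody b.
  set (s := a / y). assert (Hs : 0 < s) by now apply Rdiv_lt_0_compat.
  set (t := a * y) in *. assert (Ht0 : 0 < t) by lra. clearbody s t.
  set (W := fun l => exp (- PI * t * (IZR l + b) ^ 2)).
  assert (GW : gb1 W) by now apply gb1_gauss.
  assert (PW : forall l, 0 < W l) by (intros; apply exp_pos).
  assert (GC : forall v : Z -> R, gb1 (fun l => W l * chi s 0 (v l))).
  { intros v. apply (gb1_le _ (fun l => chi s 0 0 * W l)); [now apply gb1_scal|].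
    intros l. rewrite Rabs_mult, (Rabs_pos_eq (W l)) by (left; apply PW).
    rewrite (Rmult_comm (chi s 0 0)). apply Rmult_le_compat_l; [left; apply PW|].
    apply chi_le_0; lra. }
  set (u := 1 / 2 - x). assert (Hu : 0 < u <= 1 / 2) by (unfold u; lra).
  set (D := chi s 0 0 - chi s 0 u).
  assert (HD : 0 < D) by (unfold D; generalize (chi_lt_0 s u Hs Hu); lra).
  set (C := 16 * exp (- PI * t) ^ 2).
  assert (HC : 0 <= C) by (apply Rmult_le_pos; [lra | apply pow2_ge_0]).
  assert (HE := E_small t Ht).
  assert (Hln : 0 < ln 2) by (rewrite <- ln_1; apply ln_increasing; lra).
  (* Majorant, in units of [W (-1)], of the weight lost in the even rows. *)
  set (maj := fun l => C * decay (ln 2) l - single 0 C l - single 1 (C / 2) l - single (-1) (C / 2) l).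
  assert (Gmaj : gb1 maj).
  { repeat apply gb1_minus; try apply gb1_single. apply gb1_scal, gb1_decay, Hln. }
  assert (Smaj : zsum maj = C).
  (* The two-sided geometric series with ratio 1/2 has sum 3; the removed indices 0, 1, -1 account
     for 2. *)
  { unfold maj. rewrite !zsum_minus, !zsum_single, zsum_scal, zsum_decay; try apply gb1_single; try assumption;
      repeat apply gb1_minus; try apply gb1_single; try (apply gb1_scal, gb1_decay, Hln).
    rewrite exp_Ropp, exp_ln by lra. field. }
  assert (Pmaj : forall l, 0 <= maj l).
  { intros l. unfold maj, single.
    destruct (Z.eqb_spec l 0) as [->|H0]; [rewrite decay_ln2; simpl; lra|].
    destruct (Z.eqb_spec l 1) as [->|H1]; [rewrite decay_ln2; simpl; lra|].
    destruct (Z.eqb_spec l (-1)) as [->|H2]; [rewrite decay_ln2; simpl; lra|].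
    generalize (decay_pos (ln 2) l). nra. }
  set (f := fun l => W l * chi s 0 (1 / 2 + 1 / 2 * IZR l) - W l * chi s 0 (1 / 2 + x * IZR l)).
  (* Row -1 gains exactly one unit, the other odd rows lose nothing, row 0 does not change, and
     [chi_half_diff] with [weight_ratio] bounds the loss of the remaining even rows. *)
  assert (Row : forall l, D * W (-1)%Z * (single (-1) 1 l - maj l) <= f l).
  { intros l. unfold f. rewrite <- Rmult_minus_distr_l.
    assert (Pm := Pmaj l). assert (PWl := PW l). assert (PW1 := PW (-1)%Z).
    assert (PDW : 0 < D * W (-1)%Z) by now apply Rmult_lt_0_compat.
    destruct (Z.Even_or_Odd l) as [[j Hj]|[j Hj]].
    - replace (1 / 2 + 1 / 2 * IZR l) with (1 / 2 + IZR j) by (rewrite Hj, mult_IZR; field).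
      rewrite chi_shift by assumption.
      replace (1 / 2 + x * IZR l) with (1 / 2 - IZR l * u + IZR j) by (unfold u; rewrite Hj, mult_IZR; field).
      rewrite chi_shift by assumption.
      assert (E := chi_half_diff s l u Hs). fold D in E.
      replace (single (-1) 1 l) with 0.
      2:{ unfold single. destruct (Z.eqb_spec l (-1)); [lia|reflexivity]. }
      assert (WB : IZR l ^ 2 * W l <= W (-1)%Z * maj l).
      { destruct (Z.eq_dec l 0) as [->|Hl].
        - simpl. rewrite !Rmult_0_l. apply Rmult_le_pos; lra.
        - replace (maj l) with (C * decay (ln 2) l).
          + apply weight_ratio; lra || lia.
          + unfold maj, single.
            destruct (Z.eqb_spec l 0), (Z.eqb_spec l 1), (Z.eqb_spec l (-1)); try lia. ring. }
      assert (W l * (IZR l ^ 2 * D) <= D * (W (-1)%Z * maj l)).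
      { replace (W l * (IZR l ^ 2 * D)) with (D * (IZR l ^ 2 * W l)) by ring.
        apply Rmult_le_compat_l; lra. }
      assert (W l * (chi s 0 (1 / 2 - IZR l * u) - chi s 0 (1 / 2)) <= W l * (IZR l ^ 2 * D))
        by (apply Rmult_le_compat_l; lra).
      lra.
    - replace (1 / 2 + 1 / 2 * IZR l) with (0 + IZR (j + 1)) by (rewrite Hj, !plus_IZR, mult_IZR; field).
      rewrite chi_shift by assumption.
      assert (B := chi_le_0 s 0 (1 / 2 + x * IZR l) Hs ltac:(lra)). apply Rabs_le_between in B.
      destruct (Z.eq_dec l (-1)) as [->|Hl].
      + unfold single. rewrite Z.eqb_refl.
        replace (1 / 2 + x * IZR (-1)) with u by (unfold u; simpl; ring). fold D. nra.
      + unfold single. destruct (Z.eqb_spec l (-1)); [lia|].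
        nra. }
  apply zsum_le in Row.
  2:{ apply gb1_scal, gb1_minus; [apply gb1_single | assumption]. }
  2:{ apply gb1_minus; apply GC. }
  unfold f in Row. rewrite (zsum_minus (fun l => W l * _)) in Row by apply GC.
  rewrite zsum_scal, zsum_minus, zsum_single, Smaj in Row by (apply gb1_single || assumption).
  assert (0 < D * W (-1)%Z * (1 - C)).
  { apply Rmult_lt_0_compat; [apply Rmult_lt_0_compat; [assumption | apply PW]|]. unfold C. lra. }
  unfold W in *. lra.
Qed.

(** * Bounds for the pairs of the twisted one-dimensional sum *)

Lemma PI_bounds : 3.141 < PI < 3.142.
Proof.
  assert (H6 := sin_PI6). assert (P3 := PI_gt_3).
  split; apply Rnot_le_lt; intros H.
  - destruct (pre_sin_bound 0.5235 0) as [_ B]; try lra.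
    unfold sin_approx, sin_term in B. simpl in B.
    assert (sin (PI / 6) <= sin 0.5235); [|lra].
    apply sin_incr_1; lra.
  - destruct (pre_sin_bound (3.142 / 6) 1) as [B _]; try lra.
    unfold sin_approx, sin_term in B. simpl in B.
    assert (sin (3.142 / 6) <= sin (PI / 6)); [|lra].
    apply sin_incr_1; lra.
Qed.

Lemma exp_neg_le2 q : 0 <= q -> exp (- q) <= 1 - q + q ^ 2 / 2.
Proof.
  intros Hq.
  assert (E : 1 + q + q ^ 2 / 2 <= exp q).
  { eapply Rle_trans; [|apply (exp_ge_taylor q 2 Hq)]. simpl. lra. }
  assert (P : 0 < exp q) by apply exp_pos.
  rewrite exp_Ropp. apply (Rmult_le_reg_l (exp q)); [assumption|]. rewrite Rinv_r by lra.
  assert (0 < 1 - q + q ^ 2 / 2) by nra.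
  apply Rle_trans with ((1 + q + q ^ 2 / 2) * (1 - q + q ^ 2 / 2)); [|apply Rmult_le_compat_r; lra].
  replace ((1 + q + q ^ 2 / 2) * (1 - q + q ^ 2 / 2)) with (1 + (q ^ 2) ^ 2 / 4) by field.
  generalize (pow2_ge_0 (q ^ 2)). lra.
Qed.

Lemma sinh_ge q : 0 <= q -> q <= sinh q.
Proof.
  intros Hq. unfold sinh. assert (N := exp_neg_le2 q Hq).
  assert (E : 1 + q + q ^ 2 / 2 <= exp q).
  { eapply Rle_trans; [|apply (exp_ge_taylor q 2 Hq)]. simpl. lra. }
  lra.
Qed.

Lemma sinh_le_exp q : 0 <= q -> sinh q <= q * exp q.
Proof.
  intros Hq. unfold sinh.
  assert (exp q * (1 - 2 * q) <= exp (- q)); [|lra].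
  replace (- q) with (q + - (2 * q)) by ring. rewrite exp_plus.
  apply Rmult_le_compat_l; [left; apply exp_pos|]. generalize (exp_ineq1_le (- (2 * q))). lra.
Qed.

Lemma cosh_le_exp q : 0 <= q -> cosh q <= exp q.
Proof.
  intros Hq. unfold cosh. assert (exp (- q) <= exp q) by (apply exp_le; lra). lra.
Qed.

Lemma cosh_ge q : 0 <= q -> 1 + q ^ 2 / 2 <= cosh q.
Proof.
  intros Hq. assert (S := sinh_ge (q / 2) ltac:(lra)).
  replace (cosh q) with (1 + 2 * sinh (q / 2) ^ 2).
  - assert ((q / 2) ^ 2 <= sinh (q / 2) ^ 2) by (apply pow_incr; lra). lra.
  - unfold cosh, sinh.
    assert (E1 : exp q = exp (q / 2) * exp (q / 2)) by (rewrite <- exp_plus; f_equal; field).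
    assert (E2 : exp (- q) = exp (- (q / 2)) * exp (- (q / 2))) by (rewrite <- exp_plus; f_equal; field).
    assert (E3 : exp (q / 2) * exp (- (q / 2)) = 1) by (rewrite <- exp_plus, <- exp_0; f_equal; ring).
    rewrite E1, E2. nra.
Qed.

(** Induction on [sinh (A + 2 z) = sinh A + 2 cosh (A + z) sinh z]. With [z = t * w <= t / 2] the
    factor [exp (2 n z)] will be absorbed by the [exp (- t * n)] in the weight of the pair [n]. *)
Lemma sinh_odd_bound n z : 0 <= z ->
  sinh ((2 * INR n + 1) * z) <= (2 * INR n + 1) * sinh z * exp (2 * INR n * z).
Proof.
  intros Hz. assert (S0 := sinh_ge z Hz). induction n as [|n IH].
  - simpl INR. replace ((2 * 0 + 1) * z) with z by ring. replace (2 * 0 * z) with 0 by ring.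
    rewrite exp_0. lra.
  - rewrite S_INR. assert (N0 := pos_INR n).
    replace (sinh ((2 * (INR n + 1) + 1) * z))
      with (sinh ((2 * INR n + 1) * z) + 2 * cosh ((2 * INR n + 2) * z) * sinh z).
    2:{ unfold sinh, cosh.
        replace ((2 * (INR n + 1) + 1) * z) with ((2 * INR n + 2) * z + z) by ring.
        replace ((2 * INR n + 1) * z) with ((2 * INR n + 2) * z + - z) by ring.
        rewrite !Ropp_plus_distr, !exp_plus, Ropp_involutive. field. }
    assert (C := cosh_le_exp ((2 * INR n + 2) * z) ltac:(nra)).
    replace (2 * (INR n + 1) * z) with ((2 * INR n + 2) * z) by ring.
    assert (M : exp (2 * INR n * z) <= exp ((2 * INR n + 2) * z)) by (apply exp_le; nra).
    apply Rle_trans with ((2 * INR n + 1) * sinh z * exp ((2 * INR n + 2) * z) + 2 * exp ((2 * INR n + 2) * z) * sinh z); [|lra].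
    apply Rplus_le_compat; [|nra].
    eapply Rle_trans; [apply IH|]. apply Rmult_le_compat_l; [|assumption]. apply Rmult_le_pos; lra.
Qed.

Lemma cosh_odd_bound n z : 0 <= z ->
  0 <= cosh ((2 * INR n + 1) * z) - cosh z <= 2 * INR n * (INR n + 1) * z * exp (2 * INR n * z) * sinh z.
Proof.
  intros Hz. assert (S0 := sinh_ge z Hz). induction n as [|n IH].
  - simpl INR. replace ((2 * 0 + 1) * z) with z by ring. lra.
  - rewrite S_INR. assert (N0 := pos_INR n).
    replace (cosh ((2 * (INR n + 1) + 1) * z))
      with (cosh ((2 * INR n + 1) * z) + 2 * sinh ((2 * INR n + 2) * z) * sinh z).
    2:{ unfold sinh, cosh.
        replace ((2 * (INR n + 1) + 1) * z) with ((2 * INR n + 2) * z + z) by ring.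
        replace ((2 * INR n + 1) * z) with ((2 * INR n + 2) * z + - z) by ring.
        rewrite !Ropp_plus_distr, !exp_plus, Ropp_involutive. field. }
    assert (C := sinh_le_exp ((2 * INR n + 2) * z) ltac:(nra)).
    assert (C' := sinh_ge ((2 * INR n + 2) * z) ltac:(nra)).
    replace (2 * (INR n + 1) * z) with ((2 * INR n + 2) * z) by ring.
    assert (M : exp (2 * INR n * z) <= exp ((2 * INR n + 2) * z)) by (apply exp_le; nra).
    assert (0 <= (2 * INR n + 2) * z) by nra.
    set (q := (2 * INR n + 2) * z) in *. split.
    + assert (0 <= sinh q * sinh z) by (apply Rmult_le_pos; lra). lra.
    + replace (2 * (INR n + 1) * (INR n + 1 + 1) * z * exp q * sinh z)
        with (2 * INR n * (INR n + 1) * z * exp q * sinh z + 2 * (q * exp q) * sinh z) by (unfold q; ring).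
      assert (2 * INR n * (INR n + 1) * z * exp (2 * INR n * z) * sinh z <= 2 * INR n * (INR n + 1) * z * exp q * sinh z).
      { apply Rmult_le_compat_r; [lra|]. apply Rmult_le_compat_l; [|assumption].
        repeat apply Rmult_le_pos; lra. }
      assert (2 * sinh q * sinh z <= 2 * (q * exp q) * sinh z) by (apply Rmult_le_compat_r; lra).
      lra.
Qed.

(** The cosine of an odd multiple of [B] is divisible by [cos B]. A bound relative to [cos B] is
    needed, because [cos B] vanishes when the twist is 1/2. *)
Lemma Rabs_cos_odd n B : Rabs (cos ((2 * INR n + 1) * B)) <= (2 * INR n + 1) * Rabs (cos B).
Proof.
  induction n as [|n IH].
  - simpl INR. replace ((2 * 0 + 1) * B) with B by ring. lra.
  - rewrite S_INR. replace ((2 * (INR n + 1) + 1) * B) with ((2 * INR n + 1) * B + 2 * B) by ring.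
    rewrite cos_plus, sin_2a. unfold Rminus.
    eapply Rle_trans; [apply Rabs_triang|]. rewrite Rabs_Ropp, !Rabs_mult, (Rabs_pos_eq 2) by lra.
    assert (A1 := Rabs_cos_le1 (2 * B)).
    assert (A2 : forall x, Rabs (sin x) <= 1) by (intros; apply Rabs_le; generalize (SIN_bound x); lra).
    assert (A3 := A2 B). assert (A4 := A2 ((2 * INR n + 1) * B)).
    assert (Q1 := Rabs_pos (cos B)). assert (Q2 := Rabs_pos (sin B)).
    assert (Q3 := Rabs_pos (sin ((2 * INR n + 1) * B))).
    assert (Q4 := Rabs_pos (cos ((2 * INR n + 1) * B))).
    assert (Rabs (sin ((2 * INR n + 1) * B)) * (2 * Rabs (sin B) * Rabs (cos B)) <= 1 * (2 * 1 * Rabs (cos B))).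
    { apply Rmult_le_compat; try lra; repeat apply Rmult_le_pos; try lra.
      apply Rmult_le_compat_r; lra. }
    nra.
Qed.

Lemma Rabs_sin_odd n B : Rabs (sin ((2 * INR n + 1) * B)) <= (2 * INR n + 1) * Rabs (sin B).
Proof.
  assert (H := Rabs_sin_mult (2 * n + 1) B).
  rewrite plus_INR, mult_INR in H. simpl (INR 2) in H. simpl (INR 1) in H.
  replace (1 + 1) with 2 in H by ring. exact H.
Qed.

(** The left side bounds the pair [n] relative to the first one. For [n >= 1] the value [t = 6] is
    the worst; there the polynomial is at most [100 ^ n] and [exp (- 6) <= 1 / 400]. *)
Lemma gauss_tail_term t n : 6 <= t ->
  (2 * INR n + 1) * (2 * INR n * (INR n + 1) * t + (2 * INR n + 1)) * exp (- t * INR n ^ 2) <= (/ 4) ^ n.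
Proof.
  intros Ht. destruct n as [|n'].
  { simpl INR. replace (- t * 0 ^ 2) with 0 by ring. rewrite exp_0. simpl. lra. }
  set (n := S n'). assert (N1 : 1 <= INR n) by (apply (le_INR 1); unfold n; lia).
  assert (E6 : 400 <= exp 6).
  { replace 6 with (INR 12 * (1 / 2)) by (simpl; field). rewrite <- exp_mult_nat.
    apply Rle_trans with (1.648 ^ 12); [lra|]. apply pow_incr. split; [lra|].
    eapply Rle_trans; [|apply (exp_ge_taylor (1 / 2) 4); lra]. simpl. lra. }
  assert (T : t * exp (- t * INR n ^ 2) <= 6 * exp (- 6 * INR n ^ 2)).
  { replace (- t * INR n ^ 2) with (- 6 * INR n ^ 2 + - ((t - 6) * INR n ^ 2)) by ring.
    rewrite exp_plus, exp_Ropp. assert (P := exp_pos (- 6 * INR n ^ 2)).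
    assert (t / 6 <= exp ((t - 6) * INR n ^ 2)).
    { eapply Rle_trans; [|apply exp_ineq1_le]. assert (1 <= INR n ^ 2) by nra. nra. }
    replace (t * (exp (- 6 * INR n ^ 2) * / exp ((t - 6) * INR n ^ 2)))
      with (exp (- 6 * INR n ^ 2) * (t / exp ((t - 6) * INR n ^ 2))) by (field; lra).
    rewrite (Rmult_comm 6). apply Rmult_le_compat_l; [lra|].
    apply (Rle_div_l t 6 (exp ((t - 6) * INR n ^ 2))); lra. }
  assert (T1 : exp (- t * INR n ^ 2) <= exp (- 6 * INR n ^ 2)) by (apply exp_le; nra).
  apply Rle_trans with ((2 * INR n + 1) * (12 * INR n * (INR n + 1) + (2 * INR n + 1)) * exp (- 6 * INR n ^ 2)).
  { rewrite !Rmult_assoc. apply Rmult_le_compat_l; [lra|].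
    nra. }
  apply Rle_trans with (100 ^ n * (/ 400) ^ n).
  2:{ rewrite <- Rpow_mult_distr. right. f_equal. field. }
  apply Rmult_le_compat.
  - repeat apply Rmult_le_pos; nra.
  - left; apply exp_pos.
  - clear. induction n as [|n IH]; [simpl; lra|].
    rewrite <- tech_pow_Rmult, S_INR. assert (N0 := pos_INR n).
    nra.
  - apply Rle_trans with (exp (INR n * - 6)); [apply exp_le; nra|].
    rewrite <- exp_mult_nat. apply pow_incr. split; [left; apply exp_pos|].
    replace (exp (- 6)) with (/ exp 6) by (rewrite <- exp_Ropp; f_equal; ring).
    apply Rinv_le_contravar; lra.
Qed.

(** With [z = t * w] the exponent is [- z ^ 2 / t]. If [z ^ 2 <= t / 2], Taylor bounds for both
    factors suffice. Otherwise [z > 1.7], and [w <= 1/2] turns the exponent into at least [- z / 2],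
    so the product is at least [exp (z / 2) / 2]. *)
Lemma gauss_cosh_ge1 t w : 6 <= t -> 0 <= w <= 1 / 2 -> 1 <= exp (- t * w ^ 2) * cosh (t * w).
Proof.
  intros Ht Hw. set (z := t * w). assert (Hz : 0 <= z) by (unfold z; nra).
  replace (- t * w ^ 2) with (- (z ^ 2 / t)) by (unfold z; field; lra).
  destruct (Rle_lt_dec (z ^ 2) (t / 2)) as [H|H].
  - assert (C := cosh_ge z Hz). assert (E := exp_ineq1_le (- (z ^ 2 / t))).
    assert (Hq : z ^ 2 / t <= 1 / 2) by (apply Rle_div_l; lra).
    assert (Hq' : z ^ 2 / t <= z ^ 2 / 6) by (apply Rmult_le_compat_l; [apply pow2_ge_0 | apply Rinv_le_contravar; lra]).
    assert (Z2 := pow2_ge_0 z).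
    apply Rle_trans with ((1 - z ^ 2 / t) * (1 + z ^ 2 / 2)); [nra|].
    apply Rmult_le_compat; lra.
  - assert (Hz2 : 1.7 <= z).
    { apply Rnot_lt_le. intros Q. assert (z * z <= 1.7 * 1.7) by (apply Rmult_le_compat; lra). lra. }
    apply Rle_trans with (exp (- (z / 2)) * (exp z / 2)).
    + replace (exp (- (z / 2)) * (exp z / 2)) with (exp (- (z / 2)) * exp z / 2) by field.
      rewrite <- exp_plus. replace (- (z / 2) + z) with (z / 2) by field.
      assert (1 + 0.85 + 0.85 ^ 2 / 2 <= exp 0.85).
      { eapply Rle_trans; [|apply (exp_ge_taylor 0.85 2); lra]. simpl. lra. }
      assert (exp 0.85 <= exp (z / 2)) by (apply exp_le; lra). lra.
    + apply Rmult_le_compat; try (left; apply exp_pos).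
      * generalize (exp_pos z). lra.
      * apply exp_le, Ropp_le_contravar. apply (Rle_div_l (z ^ 2) (z / 2) t); [lra|].
        assert (0 <= (t * t) * (w * (1 / 2 - w))) by (repeat apply Rmult_le_pos; lra). unfold z. nra.
      * unfold cosh. generalize (exp_pos (- z)). lra.
Qed.

(** Since [w <= 1/2], the product is at least [exp (- z / 2) * sinh z >= sinh (z / 2) >= z / 2] with
    [z = t * w]. *)
Lemma gauss_sinh_ge t w : 6 <= t -> 0 <= w <= 1 / 2 -> t * w / 2 <= exp (- t * w ^ 2) * sinh (t * w).
Proof.
  intros Ht Hw. set (z := t * w). assert (Hz : 0 <= z) by (unfold z; nra).
  apply Rle_trans with (exp (- (z / 2)) * sinh z).
  - unfold sinh. replace (exp (- (z / 2)) * ((exp z - exp (- z)) / 2))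
      with ((exp (- (z / 2)) * exp z - exp (- (z / 2)) * exp (- z)) / 2) by field.
    rewrite <- !exp_plus. replace (- (z / 2) + z) with (z / 2) by field.
    assert (S := sinh_ge (z / 2) ltac:(lra)). unfold sinh in S.
    assert (exp (- (z / 2) + - z) <= exp (- (z / 2))) by (apply exp_le; lra). lra.
  - apply Rmult_le_compat_r; [generalize (sinh_ge z Hz); lra|].
    apply exp_le. assert (0 <= t * (w * (1 / 2 - w))) by (repeat apply Rmult_le_pos; lra). unfold z. nra.
Qed.

(* The terms [k = n] and [k = - n - 1] are grouped, as [fold_pair] does. *)
Lemma chi_half_pairs s b w : 0 < s ->
  let t := PI * s in let B := PI * b in
  chi s b (1 / 2 - w) - chi s b (1 / 2)
  = 2 * exp (- t / 4) * Series (fun n => exp (- t * (INR n ^ 2 + INR n)) *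
     (cos ((2 * INR n + 1) * B) * (exp (- t * w ^ 2) * cosh ((2 * INR n + 1) * (t * w)) * cos (2 * B * w) - 1)
      + exp (- t * w ^ 2) * sinh ((2 * INR n + 1) * (t * w)) * sin ((2 * INR n + 1) * B) * sin (2 * B * w))).
Proof.
  intros Hs t B. unfold chi. rewrite <- zsum_minus by now apply gb1_chi.
  rewrite zsum_fold by (apply gb1_minus; now apply gb1_chi).
  rewrite <- Series_scal_l. apply Series_ext. intros n. unfold fold_pair.
  rewrite opp_IZR, <- !INR_IZR_INZ, S_INR.
  set (k := INR n + 1 / 2).
  replace (2 * INR n + 1) with (2 * k) by (unfold k; field).
  replace (INR n + (1 / 2 - w)) with (k - w) by (unfold k; field).
  replace (- (INR n + 1) + (1 / 2 - w)) with (- (k + w)) by (unfold k; field).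
  replace (INR n + 1 / 2) with k by reflexivity.
  replace (- (INR n + 1) + 1 / 2) with (- k) by (unfold k; field).
  replace (2 * PI * b * (k - w)) with (2 * k * B - 2 * B * w) by (unfold B; ring).
  replace (2 * PI * b * - (k + w)) with (- (2 * k * B + 2 * B * w)) by (unfold B; ring).
  replace (2 * PI * b * k) with (2 * k * B) by (unfold B; ring).
  replace (2 * PI * b * - k) with (- (2 * k * B)) by (unfold B; ring).
  rewrite !cos_neg, cos_plus, cos_minus.
  replace (- PI * s * (k - w) ^ 2) with (- t * k ^ 2 + (- t * w ^ 2 + 2 * k * (t * w))) by (unfold t; ring).
  replace (- PI * s * (- (k + w)) ^ 2) with (- t * k ^ 2 + (- t * w ^ 2 + - (2 * k * (t * w)))) by (unfold t; ring).
  replace (- PI * s * k ^ 2) with (- t * k ^ 2) by (unfold t; ring).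
  replace (- PI * s * (- k) ^ 2) with (- t * k ^ 2) by (unfold t; ring).
  assert (E : 2 * exp (- t / 4) * exp (- t * (INR n ^ 2 + INR n)) = 2 * exp (- t * k ^ 2)).
  { rewrite Rmult_assoc, <- exp_plus. do 2 f_equal. unfold k. field. }
  match goal with |- _ = ?a * (?b * ?c) => rewrite <- (Rmult_assoc a b c), E end.
  rewrite !exp_plus. unfold cosh, sinh. field.
Qed.

(** The first pair equals [C * U + D], and the later pairs add up to at most a third of [A + D] with
    [A = C * |U|]. Positivity is clear for [U >= 0]; for [U < 0] it reduces to [2 * A < D]. The
    bound [b >= 1/3] enters as [cos B <= 1/2]. *)
Lemma chi_half_min s b w : 2 <= s -> 1 / 3 <= b <= 1 / 2 -> 0 < w <= 1 / 2 ->
  chi s b (1 / 2) < chi s b (1 / 2 - w).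
Proof.
  intros Hs Hb Hw. assert (PB := PI_bounds).
  apply Rlt_0_minus. rewrite chi_half_pairs by lra.
  set (t := PI * s). set (B := PI * b). assert (Ht : 6 <= t) by (unfold t; nra). clearbody t.
  apply Rmult_lt_0_compat; [generalize (exp_pos (- t / 4)); lra|].
  set (e := exp (- t * w ^ 2)). set (X := cos (2 * B * w)). set (Y := sin (2 * B * w)).
  set (C := cos B). set (S := sin B). set (Sh := sinh (t * w)).
  assert (HB : PI / 3 <= B <= PI / 2) by (unfold B; nra).
  assert (He : 0 < e <= 1).
  { split; [apply exp_pos|]. rewrite <- exp_0. apply exp_le. nra. }
  assert (HX : 0 <= X <= 1).
  { split; [apply cos_ge_0; nra | apply COS_bound]. }
  assert (HY : w <= Y).
  { unfold Y. assert (T := sin_taylor3_le (2 * B * w) ltac:(nra)). eapply Rle_trans; [|apply T].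
    set (v := 2 * B * w) in *. assert (2 * w <= v) by (unfold v; nra).
    assert (v <= 1.571) by (unfold v; nra).
    replace (v ^ 3 / 6) with (v * (v ^ 2 / 6)) by field. nra. }
  assert (HC : 0 <= C <= 1 / 2).
  { split; [apply cos_ge_0; lra|]. unfold C. rewrite <- cos_PI3. apply cos_decr_1; lra. }
  assert (HS : 0.86 <= S <= 1).
  { split; [|apply SIN_bound]. assert (E := sin2_cos2 B). fold S C in E. unfold Rsqr in E.
    assert (0 <= S) by (apply sin_ge_0; lra). nra. }
  assert (HSh : t * w / 2 <= e * Sh) by (apply gauss_sinh_ge; lra).
  assert (HSh0 : 0 < Sh) by (generalize (sinh_ge (t * w) ltac:(nra)); unfold Sh; nra).
  assert (ESh : sinh (t * w) = Sh) by reflexivity. clearbody Sh.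
  set (U := e * cosh (t * w) * X - 1).
  assert (HU : - (1 - X) <= U).
  { assert (G := gauss_cosh_ge1 t w Ht ltac:(lra)). fold e in G. unfold U. nra. }
  set (A := C * Rabs U). set (D := S * e * Sh * Y).
  assert (HA : 0 <= A) by (apply Rmult_le_pos; [lra | apply Rabs_pos]).
  assert (HD : 0 < D) by (unfold D; repeat apply Rmult_lt_0_compat; lra).
  (* Every further pair is a small multiple of the leading one. *)
  set (d := fun n : nat => exp (- t * (INR n ^ 2 + INR n)) *
     (cos ((2 * INR n + 1) * B) * (e * cosh ((2 * INR n + 1) * (t * w)) * X - 1)
      + e * sinh ((2 * INR n + 1) * (t * w)) * sin ((2 * INR n + 1) * B) * Y)).
  change (0 < Series d).
  assert (Bd : forall n, Rabs (d n) <= (A + D) * (/ 4) ^ n).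
  { intros n. assert (N0 := pos_INR n). set (N := 2 * INR n + 1).
    assert (T4 := gauss_tail_term t n Ht).
    assert (CN := Rabs_cos_odd n B). assert (SN := Rabs_sin_odd n B). fold N in CN, SN, T4.
    fold C in CN. fold S in SN. rewrite (Rabs_pos_eq C) in CN by lra. rewrite (Rabs_pos_eq S) in SN by lra.
    assert (Hz : 0 <= t * w) by nra.
    assert (ChN := cosh_odd_bound n (t * w) Hz). assert (ShN := sinh_odd_bound n (t * w) Hz).
    fold N in ChN, ShN. rewrite ESh in ChN, ShN.
    assert (ShN0 := sinh_ge (N * (t * w)) ltac:(unfold N; nra)).
    assert (HN : 1 <= N) by (unfold N; lra).
    set (eps := exp (- t * (INR n ^ 2 + INR n))).
    set (g := exp (- t * INR n ^ 2)) in *.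
    assert (Peps : 0 < eps) by apply exp_pos.
    (* The growth of [sinh] and [cosh] costs at most [exp (n * t)], exactly what separates [eps]
       from [g]. *)
    assert (Heps : eps * exp (2 * INR n * (t * w)) <= g).
    { unfold eps, g. rewrite <- exp_plus. apply exp_le. assert (t * w <= t / 2) by nra. nra. }
    assert (Heps1 : eps <= g) by (apply exp_le; nra).
    set (F := exp (2 * INR n * (t * w))) in *. assert (PF : 0 < F) by apply exp_pos.
    assert (UN : Rabs (e * cosh (N * (t * w)) * X - 1)
                 <= Rabs U + 2 * INR n * (INR n + 1) * t * F * (e * Sh * Y)).
    { replace (e * cosh (N * (t * w)) * X - 1) with (U + e * X * (cosh (N * (t * w)) - cosh (t * w)))
        by (unfold U; ring).
      eapply Rle_trans; [apply Rabs_triang|]. apply Rplus_le_compat_l.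
      rewrite Rabs_pos_eq by (repeat apply Rmult_le_pos; lra).
      apply Rle_trans with (e * 1 * (2 * INR n * (INR n + 1) * (t * w) * F * Sh)).
      - apply Rmult_le_compat; try lra; [apply Rmult_le_pos; lra|]. apply Rmult_le_compat_l; lra.
      - replace (e * 1 * (2 * INR n * (INR n + 1) * (t * w) * F * Sh))
          with ((2 * INR n * (INR n + 1) * t * F * e * Sh) * w) by ring.
        replace (2 * INR n * (INR n + 1) * t * F * (e * Sh * Y))
          with ((2 * INR n * (INR n + 1) * t * F * e * Sh) * Y) by ring.
        apply Rmult_le_compat_l; [|assumption].
        repeat apply Rmult_le_pos; lra. }
    unfold d. fold N eps. rewrite Rabs_mult, (Rabs_pos_eq eps) by lra.
    apply Rle_trans with (eps * (N * C * (Rabs U + 2 * INR n * (INR n + 1) * t * F * (e * Sh * Y))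
                                  + e * (N * Sh * F) * (N * S) * Y)).
    { apply Rmult_le_compat_l; [lra|]. eapply Rle_trans; [apply Rabs_triang|].
      apply Rplus_le_compat.
      - rewrite Rabs_mult. apply Rmult_le_compat; try apply Rabs_pos; assumption.
      - rewrite !Rabs_mult, (Rabs_pos_eq e), (Rabs_pos_eq (sinh (N * (t * w)))), (Rabs_pos_eq Y)
          by (try lra; assert (0 <= N * (t * w)) by (apply Rmult_le_pos; lra); lra).
        apply Rmult_le_compat_r; [lra|]. apply Rmult_le_compat; try apply Rabs_pos; try assumption.
        + assert (0 <= N * (t * w)) by (apply Rmult_le_pos; lra). apply Rmult_le_pos; lra.
        + apply Rmult_le_compat_l; lra. }
    set (Q := e * Sh * Y). assert (PQ : 0 < Q) by (repeat apply Rmult_lt_0_compat; lra).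
    assert (HDQ : D = S * Q) by (unfold D, Q; ring).
    set (m := 2 * INR n * (INR n + 1) * t) in *.
    assert (Pm : 0 <= m) by (unfold m; repeat apply Rmult_le_pos; lra).
    replace (eps * (N * C * (Rabs U + m * F * Q) + e * (N * Sh * F) * (N * S) * Y))
      with (N * eps * A + N * (m * C + N * S) * Q * (eps * F)) by (unfold A, Q; ring).
    apply Rle_trans with (N * g * A + N * (m * S + N * S) * Q * g).
    { apply Rplus_le_compat.
      - apply Rmult_le_compat_r; [assumption|]. apply Rmult_le_compat_l; lra.
      - apply Rmult_le_compat; try lra.
        + repeat apply Rmult_le_pos; try lra. apply Rplus_le_le_0_compat; apply Rmult_le_pos; lra.
        + apply Rmult_le_pos; lra.
        + apply Rmult_le_compat_r; [lra|]. apply Rmult_le_compat_l; [lra|].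
          apply Rplus_le_compat_r. apply Rmult_le_compat_l; lra. }
    apply Rle_trans with ((A + D) * (N * (m + N) * g)).
    - rewrite HDQ. assert (0 <= A * (N * g * (m + N - 1))) by (apply Rmult_le_pos; [assumption | repeat apply Rmult_le_pos; lra]).
      replace ((A + S * Q) * (N * (m + N) * g))
        with (N * g * A + N * (m * S + N * S) * Q * g + A * (N * g * (m + N - 1))) by ring. lra.
    - apply Rmult_le_compat_l; lra. }
  assert (Ex4 : ex_series (fun n => (A + D) * (/ 4) ^ n)).
  { apply (ex_series_scal (A + D) (fun n => (/ 4) ^ n)), ex_series_geom. rewrite Rabs_pos_eq; lra. }
  assert (Exd : ex_series d) by (apply (@ex_series_le R_AbsRing R_CompleteNormedModule _ _ Bd Ex4)).
  rewrite Series_incr_1 by assumption.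
  assert (Tail : Rabs (Series (fun n => d (Datatypes.S n))) <= (A + D) / 3).
  { apply Rle_trans with (Series (fun n => (A + D) * / 4 * (/ 4) ^ n)).
    - eapply Rle_trans; [apply Series_Rabs|].
      + apply (@ex_series_le R_AbsRing R_CompleteNormedModule _ (fun n => (A + D) * (/ 4) ^ (Datatypes.S n))).
        * intros n. change (norm ?x) with (Rabs x). rewrite Rabs_Rabsolu. apply Bd.
        * now apply (ex_series_incr_1 (fun n => (A + D) * (/ 4) ^ n)).
      + apply Series_le.
        * intros n. split; [apply Rabs_pos|]. eapply Rle_trans; [apply Bd|]. right. simpl. ring.
        * apply (ex_series_scal ((A + D) * / 4) (fun n => (/ 4) ^ n)), ex_series_geom. rewrite Rabs_pos_eq; lra.
    - rewrite Series_scal_l, Series_geom by (rewrite Rabs_pos_eq; lra). right. field. }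
  apply Rabs_le_between in Tail.
  assert (D0 : d 0%nat = C * U + D).
  { unfold d. simpl INR. replace (- t * (0 ^ 2 + 0)) with 0 by ring. rewrite exp_0.
    replace (2 * 0 + 1) with 1 by ring. rewrite !Rmult_1_l. unfold U, D, C, S. rewrite ESh. ring. }
  rewrite D0.
  destruct (Rle_lt_dec 0 U) as [U0|U0].
  - assert (A = C * U) by (unfold A; now rewrite Rabs_pos_eq). lra.
  - assert (EA : A = - (C * U)) by (unfold A; rewrite Rabs_left by assumption; ring).
    assert (2 * A < D); [|lra].
    (* [(1 - X) / Y] is [tan (B * w)]; 2.29 exceeds 1.571 / 0.69, where 0.69 bounds [cos (B * w)]
       from below for [B * w <= PI / 4]. Finally [4.58 * C <= 2.29] is compared with
       [3 * S >= 2.58]. *)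
    assert (H1X : 1 - X <= Y * ((229 / 100) * w)).
    { unfold X, Y. replace (2 * B * w) with (2 * (B * w)) by ring. rewrite cos_2a_sin, sin_2a.
      assert (Hv : 0 <= B * w <= 0.7855) by nra.
      assert (S1 : 0 <= sin (B * w) <= B * w).
      { split; [apply sin_ge_0; lra|]. destruct (Rle_lt_or_eq_dec 0 (B * w) ltac:(lra)) as [P|P].
        - left. now apply sin_lt_x. - rewrite <- P, sin_0. lra. }
      assert (C1 : 0.69 <= cos (B * w)).
      { replace (B * w) with (2 * (B * w / 2)) by field. rewrite cos_2a_sin.
        assert (0 <= sin (B * w / 2) <= 0.39275).
        { split; [apply sin_ge_0; lra|]. destruct (Rle_lt_or_eq_dec 0 (B * w / 2) ltac:(lra)) as [P|P].
          - generalize (sin_lt_x _ P). lra. - rewrite <- P, sin_0. lra. }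
        nra. }
      assert (sin (B * w) <= 1.571 * w) by nra.
      assert (1.571 * w <= cos (B * w) * ((229 / 100) * w)) by nra. nra. }
    assert (A <= C * (Y * ((229 / 100) * w))).
    { rewrite EA. nra. }
    assert (S * (3 * w) * Y <= D).
    { unfold D. apply Rmult_le_compat_r; [lra|]. rewrite Rmult_assoc. apply Rmult_le_compat_l; [lra|]. nra. }
    assert (2 * (C * (Y * ((229 / 100) * w))) < S * (3 * w) * Y); [|lra].
    replace (2 * (C * (Y * ((229 / 100) * w)))) with ((w * Y) * (C * (458 / 100))) by field.
    replace (S * (3 * w) * Y) with ((w * Y) * (S * 3)) by ring.
    apply Rmult_lt_compat_l; lra.
Qed.

Lemma chi_half_min_all s b u : 2 <= s -> 1 / 3 <= b <= 1 / 2 -> chi s b (1 / 2) <= chi s b u.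
Proof.
  intros Hs Hb.
  assert (Base : forall w, 0 <= w <= 1 / 2 -> chi s b (1 / 2) <= chi s b (1 / 2 - w)).
  { intros w Hw. destruct (Rle_lt_or_eq_dec 0 w ltac:(lra)) as [P|P].
    - left. apply chi_half_min; lra.
    - rewrite <- P, Rminus_0_r. lra. }
  destruct (archimed u) as [U1 U2]. set (n := up u) in *.
  destruct (Rle_lt_dec (u - IZR n) (- (1 / 2))) as [H|H].
  - replace u with (1 / 2 - (- (1 / 2) - (u - IZR n)) + IZR (n - 1)) by (rewrite minus_IZR; field).
    rewrite chi_shift by lra. apply Base. lra.
  - replace u with (- (1 / 2 - (1 / 2 + (u - IZR n))) + IZR n) by field.
    rewrite chi_shift, chi_opp by lra. apply Base. lra.
Qed.

(** The cases fit without gap: [a / y <= 2] is the hypothesis [(1 / a) * y >= 1/2] of [theta_step1]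
    after dualizing. In the other case odd rows enter negatively and sit at the minimum of [chi]
    when [x = 1/2], even rows positively at its maximum; row 1 gives strictness. *)
Lemma thetahat_step1 x y a : 0 < a -> sqrt 3 / 2 <= y -> 0 <= x < 1 / 2 ->
  thetahat x y (b1 x y) (b2 x y) a < thetahat (1 / 2) y (b1 (1 / 2) y) (b2 (1 / 2) y) a.
Proof.
  intros Ha Hy Hx. assert (0 < sqrt 3) by (apply sqrt_lt_R0; lra). assert (Hy0 : 0 < y) by lra.
  destruct (Rle_lt_dec (a / y) 2) as [Hs|Hs].
  - rewrite !thetahat_theta by assumption. apply Rmult_lt_compat_r; [now apply Rinv_0_lt_compat|].
    apply theta_step1; try assumption.
    + now apply Rinv_0_lt_compat.
    + apply (Rle_div_l a 2 y Hy0) in Hs.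
      replace (/ a * y) with (y / a) by (unfold Rdiv; ring). apply (Rle_div_r (1 / 2) y a Ha). lra.
  - rewrite !thetahat_rows by assumption. change (b2 (1 / 2) y) with (b2 x y).
    assert (Hb := b2_range x y Hy). set (b := b2 x y) in *. clearbody b.
    set (s := a / y) in *. set (t := a * y). assert (Ht : 0 < t) by now apply Rmult_lt_0_compat.
    clearbody s t.
    set (W := fun l => exp (- PI * t * IZR l ^ 2)).
    assert (PW : forall l, 0 < W l) by (intros; apply exp_pos).
    assert (GW : gb1 W).
    { apply (gb1_ext (fun l => exp (- PI * t * (IZR l + 0) ^ 2))); [|now apply gb1_gauss].
      intros l. unfold W. now rewrite Rplus_0_r. }
    assert (GC : forall v : Z -> R, gb1 (fun l => sgn l * W l * chi s b (v l))).
    { intros v. apply (gb1_le _ (fun l => chi s b 0 * W l)); [now apply gb1_scal|].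
      intros l. rewrite !Rabs_mult, (Rabs_pos_eq (W l)) by (left; apply PW).
      assert (C := chi_le_0 s b (v l) ltac:(lra) ltac:(lra)). assert (S := Rabs_sgn l).
      rewrite Rmult_comm. apply Rmult_le_compat; [apply Rabs_pos | | assumption |].
      - apply Rmult_le_pos; [apply Rabs_pos | left; apply PW].
      - specialize (PW l). nra. }
    set (u := chi s b x - chi s b (1 / 2)).
    assert (Hu : 0 < u).
    { unfold u. assert (chi s b (1 / 2) < chi s b (1 / 2 - (1 / 2 - x))) by (apply chi_half_min; lra).
      replace (1 / 2 - (1 / 2 - x)) with x in H0 by ring. lra. }
    assert (Row : forall l, single 1 (W 1%Z * u) l <=
       sgn l * W l * chi s b (1 / 2 * IZR l) - sgn l * W l * chi s b (x * IZR l)).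
    { intros l. assert (Pl := PW l). destruct (Z.Even_or_Odd l) as [[j Hj]|[j Hj]].
      - rewrite (sgn_even l j Hj).
        replace (1 / 2 * IZR l) with (0 + IZR j) by (rewrite Hj, mult_IZR; field).
        rewrite chi_shift by lra.
        assert (C := chi_le_0 s b (x * IZR l) ltac:(lra) ltac:(lra)). apply Rabs_le_between in C.
        unfold single. destruct (Z.eqb_spec l 1); [lia|]. nra.
      - rewrite (sgn_odd l j Hj).
        replace (1 / 2 * IZR l) with (1 / 2 + IZR j) by (rewrite Hj, plus_IZR, mult_IZR; field).
        rewrite chi_shift by lra.
        unfold single. destruct (Z.eqb_spec l 1) as [->|].
        + replace (x * 1) with x by ring. unfold u. lra.
        + assert (C := chi_half_min_all s b (x * IZR l) ltac:(lra) ltac:(lra)). nra. }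
    apply zsum_le in Row; [|apply gb1_single | apply gb1_minus; apply GC].
    rewrite zsum_single, (zsum_minus (fun l => sgn l * W l * _)) in Row by apply GC.
    assert (0 < W 1%Z * u) by (apply Rmult_lt_0_compat; [apply PW | assumption]).
    unfold W in *. lra.
Qed.

(** * Vertical deformation of the translated sum *)

(* For [x = 1/2] and [v = 1/y], the triangle spanned by three neighbouring lattice points has
   squared sides [v], [wv v], [wv v] and squared circumradius [r2 v], with circumcenter the
   point b. In barycentric coordinates the squared distance to b is [r2 v] plus an integral
   combination of the squared sides, with coefficients [Kq] and [Lq]. *)
Definition wv (v : R) : R := / v + v / 4.
Definition r2 (v : R) : R := / (4 * v) + v / 8 + v ^ 3 / 64.
Definition Kq (k l : Z) : Z := (k * (k + l + 1))%Z.
Definition Lq (l : Z) : Z := (l * (l + 1))%Z.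
(** The Gaussian with the common factor [exp (- (a * r2 v))] removed and [a] standing for [PI] times
    the parameter, so that the three vertices of the triangle contribute exactly 1 each. *)
Definition Nt (a v : R) (k l : Z) : R := exp (- (a * (IZR (Kq k l) * v + IZR (Lq l) * wv v))).

Lemma theta_exponent v k l : 0 < v ->
  qform (1 / 2) (/ v) (IZR k + b1 (1 / 2) (/ v)) (IZR l + b2 (1 / 2) (/ v))
  = r2 v + (IZR (Kq k l) * v + IZR (Lq l) * wv v).
Proof.
  intros Hv. unfold qform, b1, b2, r2, wv, Kq, Lq. rewrite !mult_IZR, !plus_IZR. field. lra.
Qed.

Lemma gb2_Nt a v : 0 < a -> 0 < v -> gb2 (Nt a v).
Proof.
  intros Ha Hv. assert (Ppi := PI_RGT_0).
  apply (gb2_ext (fun k l => exp (a * r2 v) * exp (- PI * (a / PI) *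
     qform (1 / 2) (/ v) (IZR k + b1 (1 / 2) (/ v)) (IZR l + b2 (1 / 2) (/ v))))).
  - intros k l. rewrite theta_exponent, <- exp_plus by assumption. unfold Nt. f_equal. field. lra.
  - apply gb2_scal, gb2_qform; [now apply Rinv_0_lt_compat | now apply Rdiv_lt_0_compat].
Qed.

Lemma theta_half v al : 0 < v -> 0 < al ->
  theta (1 / 2) (/ v) (b1 (1 / 2) (/ v)) (b2 (1 / 2) (/ v)) al
  = exp (- (PI * al * r2 v)) * zsum2 (Nt (PI * al) v).
Proof.
  intros Hv Hal. unfold theta. rewrite <- zsum2_scal. apply zsum2_ext. intros k l.
  rewrite theta_exponent by assumption. unfold Nt. rewrite <- exp_plus. f_equal. ring.
Qed.

(* The value of [v] at the hexagonal lattice, where [v = wv v]. *)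
Definition v0 : R := 2 / sqrt 3.

Lemma v0_sqr : v0 ^ 2 = 4 / 3.
Proof.
  unfold v0. assert (0 < sqrt 3) by (apply sqrt_lt_R0; lra).
  replace ((2 / sqrt 3) ^ 2) with (4 / (sqrt 3 * sqrt 3)) by (field; lra).
  rewrite sqrt_sqrt; lra.
Qed.

Lemma v0_bounds : 1.1547 < v0 < 1.1548.
Proof.
  assert (E := v0_sqr). assert (0 < v0).
  { unfold v0. apply Rdiv_lt_0_compat; [lra | apply sqrt_lt_R0; lra]. }
  split; apply Rnot_le_lt; intros H'.
  - assert (v0 * v0 <= 1.1547 * 1.1547) by (apply Rmult_le_compat; lra). lra.
  - assert (1.1548 * 1.1548 <= v0 * v0) by (apply Rmult_le_compat; lra). lra.
Qed.

Lemma wv_v0 : wv v0 = v0.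
Proof.
  unfold wv. assert (B := v0_bounds). assert (E := v0_sqr).
  apply Rmult_eq_reg_l with v0; [|lra]. field_simplify; lra.
Qed.

(** The tangent of the convex function [wv] at [v0], where its slope is -1/2; multiplied by [v], the
    difference is [3/4 * (v0 - v) ^ 2]. *)
Lemma wv_lower v : 0 < v <= v0 -> v0 + (v0 - v) / 2 <= wv v.
Proof.
  intros Hv. unfold wv. assert (E := v0_sqr).
  apply Rmult_le_reg_l with v; [lra|].
  replace (v * (/ v + v / 4)) with (1 + v ^ 2 / 4) by (field; lra).
  assert (0 <= (v0 - v) ^ 2) by apply pow2_ge_0. lra.
Qed.

Lemma Kq_Lq_nonneg k l : (0 <= Kq k l + Lq l)%Z.
Proof. unfold Kq, Lq. assert (0 <= (k + l + 1) ^ 2 + k ^ 2 + l ^ 2)%Z by nia. nia. Qed.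

Lemma Lq_nonneg l : (0 <= Lq l)%Z.
Proof. unfold Lq. nia. Qed.

(** [v0] is a critical point of [r2], whence the square. This exact quadratic gap is the gain that
    all error terms of the translated sum have to stay below. *)
Lemma r2_gap v : 0 < v <= v0 ->
  r2 v - r2 v0 = (v0 - v) ^ 2 * (3 / (16 * v) + (v + 2 * v0) / 64).
Proof.
  intros Hv. assert (E := v0_sqr).
  assert (I : / v0 = 3 / 4 * v0) by (apply Rmult_eq_reg_l with v0; [field_simplify|]; lra).
  assert (E3 : v0 ^ 3 = 4 / 3 * v0) by (replace (v0 ^ 3) with (v0 * v0 ^ 2) by ring; rewrite E; ring).
  unfold r2. rewrite !Rinv_mult, I, E3.
  apply Rmult_eq_reg_l with v; [|lra].
  replace (v * ((v0 - v) ^ 2 * (3 / (16 * v) + (v + 2 * v0) / 64)))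
    with ((v0 ^ 2 - 2 * v0 * v + v ^ 2) * (3 / 16 + (v ^ 2 + 2 * (v0 * v)) / 64)) by (field; lra).
  replace (v * (/ 4 * / v + v / 8 + v ^ 3 / 64 - (/ 4 * (3 / 4 * v0) + v0 / 8 + 4 / 3 * v0 / 64)))
    with (1 / 4 + v ^ 2 / 8 + v ^ 4 / 64 - (v0 * v) * (3 / 16 + 1 / 8 + 1 / 48)) by (field; lra).
  rewrite E. set (p := v0 * v). assert (Ep : p ^ 2 = 4 / 3 * v ^ 2) by (unfold p; rewrite Rpow_mult_distr, E; ring).
  assert (Ev : 2 * v0 * v = 2 * p) by (unfold p; ring). rewrite Ev. 
  clearbody p.
  replace ((4 / 3 - 2 * p + v ^ 2) * (3 / 16 + (v ^ 2 + 2 * p) / 64))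
    with (1 / 4 + v ^ 2 / 48 + p / 24 - 3 / 8 * p - v ^ 2 * p / 32 - p ^ 2 / 16 + 3 / 16 * v ^ 2 + v ^ 4 / 64 + v ^ 2 * p / 32) by field.
  rewrite Ep. field.
Qed.

(** * Enumeration of shells and numerical exponential bounds *)

Lemma lsum_le S f h : (forall k l, In (k, l) S -> f k l <= h k l) -> lsum S f <= lsum S h.
Proof.
  induction S as [|[k l] S IH]; intros H; [simpl; lra|]. unfold lsum; simpl.
  apply Rplus_le_compat; [apply H; now left | apply IH; intros; apply H; now right].
Qed.

Lemma lsum_le_zsum2 S f : NoDup S -> gb2 f -> (forall k l, 0 <= f k l) -> lsum S f <= zsum2 f.
Proof.
  intros HS Hf H. destruct (spikes_sum S f) as [G <-].
  apply zsum2_le; try assumption. intros k l.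
  assert (D : forall p q : Z * Z, {p = q} + {p <> q}) by (decide equality; apply Z.eq_dec).
  destruct (in_dec D (k, l) S) as [I|I].
  - rewrite spikes_in by assumption. lra.
  - rewrite spikes_out by assumption. apply H.
Qed.

Definition zrange (b : Z) : list Z := map (fun i => (Z.of_nat i - b)%Z) (seq 0 (Z.to_nat (2 * b + 1))).

Lemma box_forall (b : Z) (f : Z -> Z -> bool) :
  forallb (fun k => forallb (fun l => f k l) (zrange b)) (zrange b) = true ->
  forall k l, (Z.abs k <= b)%Z -> (Z.abs l <= b)%Z -> f k l = true.
Proof.
  intros H k l Hk Hl.
  assert (R : forall i, (Z.abs i <= b)%Z -> In i (zrange b)).
  { intros i Hi. unfold zrange. apply in_map_iff. exists (Z.to_nat (i + b)). split; [lia|].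
    apply in_seq. lia. }
  rewrite forallb_forall in H. specialize (H k (R k Hk)). rewrite forallb_forall in H. apply H, R, Hl.
Qed.

Definition inb (S : list (Z * Z)) (k l : Z) : bool :=
  existsb (fun p => andb (Z.eqb (fst p) k) (Z.eqb (snd p) l)) S.

Lemma inb_In S k l : inb S k l = true -> In (k, l) S.
Proof.
  unfold inb. intros H. apply existsb_exists in H. destruct H as [[k' l'] [H E]].
  apply andb_prop in E. destruct E as [E1 E2]. apply Z.eqb_eq in E1, E2. simpl in *. now subst.
Qed.

(* All (k, l) with [Kq k l + Lq l <= 2]. *)
Definition shells12 : list (Z * Z) :=
  ((0, 0) :: (-1, 0) :: (0, -1) :: (1, -1) :: (-1, -1) :: (-1, 1)
   :: (1, 0) :: (-2, 0) :: (0, 1) :: (-2, 1) :: (0, -2) :: (1, -2) :: nil)%Z.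

(** Inside a box the claim is checked by evaluation; outside it follows from [2 (Kq + Lq) + 1 = (k +
    l + 1)^2 + k^2 + l^2]. The second inequality trades the quadratic form for decay in [|k| + |l|]
    while keeping a constant factor. *)
Lemma shells12_out k l : ~ In (k, l) shells12 ->
  (4 <= Kq k l + Lq l)%Z /\ (12 + Z.abs k + Z.abs l <= 4 * (Kq k l + Lq l))%Z.
Proof.
  intros H.
  assert (B := box_forall 7 (fun k l => orb (inb shells12 k l)
    (andb (Z.leb 4 (Kq k l + Lq l)) (Z.leb (12 + Z.abs k + Z.abs l) (4 * (Kq k l + Lq l))))) eq_refl k l).
  destruct (Z_le_gt_dec (Z.abs k) 7) as [Hk|Hk], (Z_le_gt_dec (Z.abs l) 7) as [Hl|Hl].
  { specialize (B Hk Hl). apply Bool.orb_prop in B. destruct B as [B|B]; [now apply inb_In in B|].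
    apply andb_prop in B. destruct B as [B1 B2]. apply Z.leb_le in B1, B2. now split. }
  all: assert (E : (2 * (Kq k l + Lq l) + 1 = (k + l + 1) * (k + l + 1) + Z.abs k * Z.abs k + Z.abs l * Z.abs l)%Z)
    by (rewrite <- !Z.abs_mul, (Z.abs_eq (k * k)), (Z.abs_eq (l * l)) by apply Z.square_nonneg; unfold Kq, Lq; ring).
  all: assert (0 <= (k + l + 1) * (k + l + 1))%Z by apply Z.square_nonneg.
  all: assert (0 <= Z.abs k)%Z by lia; assert (0 <= Z.abs l)%Z by lia.
  all: set (K := Z.abs k) in *; set (L := Z.abs l) in *.
  all: assert (K <= K * K)%Z by nia; assert (L <= L * L)%Z by nia.
  - lia.
  - lia.
  - lia.
Qed.

Lemma shells12_NoDup : NoDup shells12.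
Proof. repeat constructor; simpl; intuition congruence. Qed.

Lemma exp_neg_ge3 q : 0 <= q -> 1 - q + q ^ 2 / 2 - q ^ 3 / 6 <= exp (- q).
Proof.
  intros [Hq| <-].
  2:{ rewrite Ropp_0, exp_0. lra. }
  destruct (MVT_cor2 (fun s => exp (- s) - (1 - s + s ^ 2 / 2 - s ^ 3 / 6))
    (fun s => - exp (- s) - (- 1 + s - s ^ 2 / 2)) 0 q Hq) as [c [E Hc]].
  - intros c Hc. apply is_derive_Reals. auto_derive; [trivial|]. field.
  - cbv beta in E. rewrite Ropp_0, exp_0 in E.
    assert (B := exp_neg_le2 c ltac:(lra)).
    assert (0 <= (- exp (- c) - (-1 + c - c ^ 2 / 2)) * (q - 0)) by (apply Rmult_le_pos; lra).
    lra.
Qed.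

(** Taylor's formula with the larger endpoint value of the second derivative. For [0 <= s <= 2] it
    amounts to [1 - s ^ 2 / 2 <= (1 + s) * exp (- s)]; for [s > 2] already [s ^ 2 / 2 > 1]. *)
Lemma exp_second_order s :
  exp s <= 1 + s + s ^ 2 / 2 * (if Rle_dec 0 s then exp s else 1).
Proof.
  destruct (Rle_dec 0 s) as [H|H].
  - assert (E : exp s * exp (- s) = 1) by (rewrite <- exp_plus, <- exp_0; f_equal; ring).
    assert (P := exp_pos s).
    destruct (Rle_lt_dec s 2) as [H2|H2].
    + assert (B := exp_neg_ge3 s H).
      assert (1 - s ^ 2 / 2 <= (1 + s) * exp (- s)).
      { apply Rle_trans with ((1 + s) * (1 - s + s ^ 2 / 2 - s ^ 3 / 6)); [|apply Rmult_le_compat_l; lra].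
        assert (0 <= s ^ 3 * (2 - s)) by (apply Rmult_le_pos; [apply pow_le|]; lra). lra. }
      assert (exp s * (1 - s ^ 2 / 2) <= exp s * ((1 + s) * exp (- s))) by (apply Rmult_le_compat_l; lra).
      replace (exp s * ((1 + s) * exp (- s))) with ((1 + s) * (exp s * exp (- s))) in H1 by ring.
      rewrite E in H1. lra.
    + assert (2 * 2 <= s * s) by (apply Rmult_le_compat; lra).
      assert (exp s * 1 <= exp s * (s ^ 2 / 2)) by (apply Rmult_le_compat_l; lra). lra.
  - assert (B := exp_neg_le2 (- s) ltac:(lra)). rewrite Ropp_involutive in B.
    replace ((- s) ^ 2) with (s ^ 2) in B by ring. lra.
Qed.

Lemma exp_lower8 c : 0 <= c ->
  (1 + c / 8 + (c / 8) ^ 2 / 2 + (c / 8) ^ 3 / 6 + (c / 8) ^ 4 / 24) ^ 8 <= exp c.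
Proof.
  intros Hc. replace c with (INR 8 * (c / 8)) at 5 by (simpl; field). rewrite <- exp_mult_nat.
  assert (P : forall n, 0 <= (c / 8) ^ n) by (intros; apply pow_le; lra).
  apply pow_incr. split.
  - generalize (P 2%nat) (P 3%nat) (P 4%nat). lra.
  - eapply Rle_trans; [|apply (exp_ge_taylor (c / 8) 4); lra]. simpl. lra.
Qed.

(** The tool for numerical values: for rational [c] and [d] the last hypothesis is a rational
    inequality that [lra] evaluates. Taking the eighth power of a Taylor polynomial at [c / 8] keeps
    degree 4 accurate up to about [c = 10]. *)
Lemma exp_neg_bound c c' d : 0 <= c <= c' -> 0 < d ->
  1 <= d * (1 + c / 8 + (c / 8) ^ 2 / 2 + (c / 8) ^ 3 / 6 + (c / 8) ^ 4 / 24) ^ 8 -> exp (- c') <= d.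
Proof.
  intros Hc Hd. assert (L := exp_lower8 c ltac:(lra)). set (X := (_ ^ 8)) in *. clearbody X. intros H.
  apply Rle_trans with (exp (- c)); [apply exp_le; lra|].
  rewrite exp_Ropp. assert (P := exp_pos c). apply Rmult_le_reg_l with (exp c); [assumption|].
  rewrite Rinv_r by lra. nra.
Qed.

(** [a * exp (- (c * a))] decreases from [a = 1 / c] on; this moves the worst case to the smallest
    parameter in spite of the prefactor. *)
Lemma mult_exp_decreasing a0 a c : 0 < a0 <= a -> 1 <= c * a0 -> a * exp (- (c * a)) <= a0 * exp (- (c * a0)).
Proof.
  intros Ha Hc.
  replace (- (c * a)) with (- (c * a0) + - (c * (a - a0))) by ring. rewrite exp_plus.
  assert (P := exp_pos (- (c * a0))). assert (Q := exp_pos (c * (a - a0))).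
  assert (a <= a0 * exp (c * (a - a0))).
  { apply Rle_trans with (a0 * (1 + c * (a - a0))).
    - assert (0 <= (c * a0 - 1) * (a - a0)) by (apply Rmult_le_pos; lra). lra.
    - apply Rmult_le_compat_l; [lra | apply exp_ineq1_le]. }
  rewrite (exp_Ropp (c * (a - a0))). replace (a * (exp (- (c * a0)) * / exp (c * (a - a0))))
    with (exp (- (c * a0)) * (a / exp (c * (a - a0)))) by (field; lra).
  rewrite (Rmult_comm a0). apply Rmult_le_compat_l; [lra|].
  apply (Rle_div_l a a0 (exp (c * (a - a0)))); [lra|assumption].
Qed.

(** * The translated sum near the hexagonal lattice *)

Lemma Nt_v0 a k l : Nt a v0 k l = exp (- (a * v0 * IZR (Kq k l + Lq l))).
Proof. unfold Nt. rewrite wv_v0, plus_IZR. f_equal. ring. Qed.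

Lemma Nt_v0_swap a k l : Nt a v0 l k = Nt a v0 k l.
Proof. rewrite !Nt_v0. do 4 f_equal. unfold Kq, Lq. ring. Qed.

Lemma Nt_v0_reflect a k l : Nt a v0 k (-1 - k - l) = Nt a v0 k l.
Proof. rewrite !Nt_v0. do 4 f_equal. unfold Kq, Lq. ring. Qed.

Lemma gb2_poly a (p : Z -> Z -> R) c0 c1 c2 c3 c4 c5 : 0 < a ->
  (forall k l, p k l = c0 + c1 * IZR k + c2 * IZR l + c3 * IZR k ^ 2 + c4 * (IZR k * IZR l) + c5 * IZR l ^ 2) ->
  gb2 (fun k l => p k l * Nt a v0 k l).
Proof.
  intros Ha Hp. assert (B := v0_bounds).
  assert (G := gb2_Nt a v0 Ha ltac:(lra)).
  assert (G1 := gb2_mul_l _ G). assert (G2 := gb2_mul_r _ G).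
  assert (G3 := gb2_mul_l _ G1). assert (G4 := gb2_mul_l _ G2). assert (G5 := gb2_mul_r _ G2).
  apply (gb2_ext (fun k l => c0 * Nt a v0 k l + (c1 * (IZR k * Nt a v0 k l) + (c2 * (IZR l * Nt a v0 k l)
    + (c3 * (IZR k * (IZR k * Nt a v0 k l)) + (c4 * (IZR k * (IZR l * Nt a v0 k l))
    + c5 * (IZR l * (IZR l * Nt a v0 k l)))))))).
  - intros k l. rewrite Hp. ring.
  - repeat apply gb2_plus; now apply gb2_scal.
Qed.

(* The three edge forms of the lattice are permuted by the symmetries of the hexagonal
   point, so the first variation vanishes. *)
Lemma first_variation a : 0 < a ->
  zsum2 (fun k l => (IZR (Kq k l) - IZR (Lq l) / 2) * Nt a v0 k l) = 0.
Proof.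
  intros Ha.
  set (F := fun k l => IZR (Kq k l) * Nt a v0 k l).
  assert (GF : gb2 F).
  { apply (gb2_poly a (fun k l => IZR (Kq k l)) 0 1 0 1 1 0 Ha).
    intros k l. unfold Kq. rewrite mult_IZR, !plus_IZR. ring. }
  assert (GB : gb2 (fun k l => (IZR k * IZR l) * Nt a v0 k l)).
  { apply (gb2_poly a (fun k l => IZR k * IZR l) 0 0 0 0 1 0 Ha). intros; ring. }
  assert (GFs : gb2 (fun k l => F l k)) by apply (gb2_swap F GF).
  assert (E1 : zsum2 (fun k l => F l k) = zsum2 F) by (symmetry; now apply zsum2_swap).
  (* The row reflection turns [Kq k l] into [- k l], the third edge form. Since
     [Lq l = Kq l k - k l], the weighted sum of [Lq] is twice that of [Kq]. *)
  assert (E2 : zsum2 (fun k l => F k (-1 - k - l)%Z) = zsum2 F).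
  { apply (zsum2_inner (fun k l => (-1 - k - l)%Z)); [|assumption].
    intros k g Hg. now apply zsum_reflect. }
  rewrite (zsum2_ext _ (fun k l => -1 * ((IZR k * IZR l) * Nt a v0 k l))) in E2.
  2:{ intros k l. unfold F. rewrite Nt_v0_reflect.
      replace (Kq k (-1 - k - l)) with (- (k * l))%Z by (unfold Kq; ring).
      rewrite opp_IZR, mult_IZR. ring. }
  rewrite (zsum2_ext _ (fun k l => F k l + (- / 2) * (F l k + -1 * ((IZR k * IZR l) * Nt a v0 k l)))).
  - rewrite zsum2_plus, zsum2_scal, zsum2_plus, E1, E2; try assumption.
    + lra.
    + now apply gb2_scal.
    + apply gb2_scal, gb2_plus; [assumption | now apply gb2_scal].
  - intros k l. unfold F. rewrite Nt_v0_swap. unfold Kq, Lq. rewrite !mult_IZR, !plus_IZR. field.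
Qed.

Lemma N0_ge3 a v : 0 < a -> 0 < v -> 3 <= zsum2 (Nt a v).
Proof.
  intros Ha Hv.
  apply Rle_trans with (lsum ((0, 0) :: (-1, 0) :: (0, -1) :: nil)%Z (Nt a v)).
  - unfold lsum, Nt, Kq, Lq. simpl. rewrite !Rmult_0_l, !Rplus_0_l, !Rmult_0_r, Ropp_0, exp_0. lra.
  - apply lsum_le_zsum2; [repeat constructor; simpl; intuition congruence | now apply gb2_Nt |].
    intros; left; apply exp_pos.
Qed.

(* [lam2 / 2] is the first-order coefficient, in [a * (v0 - v)], of the exponent. *)
Definition lam2 (k l : Z) : Z := (2 * Kq k l - Lq l)%Z.

(** The square of half of [lam2] times the larger of the exponentials at the two ends: a positive
    first-order coefficient lets the term grow as [v] decreases, but to no more than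
    [exp (- (a * v * n))] with [n = Kq + Lq]. *)
Definition second_majorant (a v : R) (k l : Z) : R :=
  IZR (lam2 k l) ^ 2 / 4 *
  (if Z.leb 0 (lam2 k l) then exp (- (a * v * IZR (Kq k l + Lq l)))
   else exp (- (a * v0 * IZR (Kq k l + Lq l)))).

(** Replacing [wv] by its tangent only increases the term, because [Lq >= 0]; the exponent is then
    linear in [v0 - v] and [exp_second_order] applies. *)
Lemma near_remainder a v k l : 0 < a -> 0 < v <= v0 ->
  Nt a v k l - Nt a v0 k l - a * (v0 - v) * ((IZR (Kq k l) - IZR (Lq l) / 2) * Nt a v0 k l)
  <= (a * (v0 - v)) ^ 2 / 2 * second_majorant a v k l.
Proof.
  intros Ha Hv. set (z := a * (v0 - v)). assert (Hz : 0 <= z) by (apply Rmult_le_pos; lra).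
  set (K := IZR (Kq k l)). set (L := IZR (Lq l)). set (la := K - L / 2).
  assert (HL : 0 <= L) by (apply IZR_le, Lq_nonneg).
  assert (El : IZR (lam2 k l) = 2 * la).
  { unfold lam2, la, K, L. rewrite minus_IZR, mult_IZR. field. }
  assert (U : Nt a v k l <= Nt a v0 k l * exp (z * la)).
  { rewrite Nt_v0. unfold Nt. rewrite <- exp_plus, plus_IZR. apply exp_le. fold K L.
    assert (W := wv_lower v Hv). unfold z, la.
    assert (0 <= a * (L * (wv v - (v0 + (v0 - v) / 2)))) by (repeat apply Rmult_le_pos; lra). nra. }
  assert (P := exp_pos (- (a * v0 * IZR (Kq k l + Lq l)))). rewrite <- Nt_v0 in P.
  assert (T := exp_second_order (z * la)).
  unfold second_majorant. rewrite El.
  assert (Main : Nt a v0 k l * (if Rle_dec 0 (z * la) then exp (z * la) else 1) * ((z * la) ^ 2 / 2)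
     <= z ^ 2 / 2 * ((2 * la) ^ 2 / 4 * (if Z.leb 0 (lam2 k l) then exp (- (a * v * IZR (Kq k l + Lq l)))
      else exp (- (a * v0 * IZR (Kq k l + Lq l)))))).
  { replace (z ^ 2 / 2 * ((2 * la) ^ 2 / 4 * (if Z.leb 0 (lam2 k l) then exp (- (a * v * IZR (Kq k l + Lq l)))
      else exp (- (a * v0 * IZR (Kq k l + Lq l))))))
    with ((if Z.leb 0 (lam2 k l) then exp (- (a * v * IZR (Kq k l + Lq l)))
      else exp (- (a * v0 * IZR (Kq k l + Lq l)))) * ((z * la) ^ 2 / 2)) by field.
    destruct (Rle_dec 0 (z * la)) as [D|D], (Z.leb_spec 0 (lam2 k l)) as [D'|D'].
    - apply Rmult_le_compat_r; [generalize (pow2_ge_0 (z * la)); lra|].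
      rewrite Nt_v0, <- exp_plus, plus_IZR. fold K L. apply exp_le. unfold z, la.
      assert (0 <= a * ((v0 - v) * L)) by (repeat apply Rmult_le_pos; lra). nra.
    - apply IZR_lt in D'. rewrite El in D'.
      assert (Ez : z * la = 0) by nra. rewrite Ez. lra.
    - apply IZR_le in D'. rewrite El in D'. exfalso. apply D. apply Rmult_le_pos; lra.
    - rewrite <- Nt_v0. lra. }
  assert (Nt a v0 k l * exp (z * la) <= Nt a v0 k l * (1 + z * la + (z * la) ^ 2 / 2 * (if Rle_dec 0 (z * la) then exp (z * la) else 1)))
    by (apply Rmult_le_compat_l; lra).
  lra.
Qed.

(** [|lam2| <= 4 n] and [n ^ 2 <= 16 * exp ((n - 4) / 2)]: the polynomial weight costs 1/2 of the
    rate [a * v]. The rest is distributed by [4 n >= 12 + |k| + |l|]. *)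
Lemma second_majorant_tail a v k l : 0 < a -> 0 < v <= v0 -> ~ In (k, l) shells12 -> 1 / 2 <= a * v ->
  second_majorant a v k l <=
  64 * exp (- 2) * exp (- (3 * (a * v - 1 / 2))) * (decay ((a * v - 1 / 2) / 4) k * decay ((a * v - 1 / 2) / 4) l).
Proof.
  intros Ha Hv HS Hav. destruct (shells12_out k l HS) as [H1 H2].
  set (n := IZR (Kq k l + Lq l)).
  assert (Hn4 : 4 <= n) by (apply IZR_le in H1; exact H1).
  assert (Hnm : 12 + Rabs (IZR k) + Rabs (IZR l) <= 4 * n).
  { apply IZR_le in H2. rewrite mult_IZR, (plus_IZR (12 + _)), (plus_IZR 12), !abs_IZR in H2. exact H2. }
  assert (Hlam : IZR (lam2 k l) ^ 2 / 4 <= 4 * n ^ 2).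
  { assert (Hq : Rabs (IZR (lam2 k l)) <= 4 * n).
    { rewrite <- abs_IZR. unfold n. rewrite <- mult_IZR. apply IZR_le. unfold lam2, Kq, Lq.
      generalize (Lq_nonneg (k + l)) (Lq_nonneg k) (Lq_nonneg l). unfold Lq. intros.
      apply Z.abs_le. split; lia. }
    rewrite <- pow2_abs. assert (Rabs (IZR (lam2 k l)) ^ 2 <= (4 * n) ^ 2) by (apply pow_incr; split; [apply Rabs_pos | assumption]).
    lra. }
  apply Rle_trans with (4 * n ^ 2 * exp (- (a * v * n))).
  { unfold second_majorant. fold n. apply Rmult_le_compat.
    - generalize (pow2_ge_0 (IZR (lam2 k l))). lra.
    - destruct (Z.leb _ _); left; apply exp_pos.
    - assumption.
    - destruct (Z.leb _ _); [lra|]. apply exp_le. assert (0 <= a * ((v0 - v) * n)) by (repeat apply Rmult_le_pos; lra). nra. }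
  assert (N16 : n ^ 2 <= 16 * exp ((n - 4) / 2)).
  { assert (E := exp_ineq1_le ((n - 4) / 4)).
    replace ((n - 4) / 2) with ((n - 4) / 4 + (n - 4) / 4) by field. rewrite exp_plus.
    nra. }
  apply Rle_trans with (4 * (16 * exp ((n - 4) / 2)) * exp (- (a * v * n))).
  { apply Rmult_le_compat_r; [left; apply exp_pos|]. lra. }
  unfold decay. set (p := a * v - 1 / 2).
  replace (4 * (16 * exp ((n - 4) / 2)) * exp (- (a * v * n))) with (64 * (exp ((n - 4) / 2) * exp (- (a * v * n)))) by ring.
  rewrite <- exp_plus, !Rmult_assoc, <- !exp_plus. apply Rmult_le_compat_l; [lra|]. apply exp_le.
  assert (0 <= p * (4 * n - (12 + Rabs (IZR k) + Rabs (IZR l)))) by (apply Rmult_le_pos; unfold p; lra).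
  unfold p in *. lra.
Qed.

Lemma near_hexagonal a v : 3.14 <= a -> 0.9 <= v < v0 ->
  zsum2 (Nt a v) < zsum2 (Nt a v0) * exp (a * (r2 v - r2 v0)).
Proof.
  intros Ha Hv. assert (B := v0_bounds).
  set (z := a * (v0 - v)). assert (Hz : 0 < z) by (apply Rmult_lt_0_compat; lra).
  set (p := a * v - 1 / 2).
  assert (Hp : 2.326 <= p) by (unfold p; nra).
  set (T := 64 * exp (- 2) * exp (- (3 * p))).
  set (rem := fun k l => Nt a v k l - Nt a v0 k l - z * ((IZR (Kq k l) - IZR (Lq l) / 2) * Nt a v0 k l)).
  assert (Gv := gb2_Nt a v ltac:(lra) ltac:(lra)). assert (G0 := gb2_Nt a v0 ltac:(lra) ltac:(lra)).
  assert (GL : gb2 (fun k l => (IZR (Kq k l) - IZR (Lq l) / 2) * Nt a v0 k l)).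
  { apply (gb2_poly a (fun k l => IZR (Kq k l) - IZR (Lq l) / 2) 0 1 (- / 2) 1 1 (- / 2)); [lra|].
    intros k l. unfold Kq, Lq. rewrite !mult_IZR, !plus_IZR. field. }
  assert (Grem : gb2 rem /\ zsum2 rem = zsum2 (Nt a v) - zsum2 (Nt a v0)).
  { assert (E : forall k l, Nt a v k l + (-1 * Nt a v0 k l + - z * ((IZR (Kq k l) - IZR (Lq l) / 2) * Nt a v0 k l)) = rem k l)
      by (intros; unfold rem; ring).
    split.
    - apply (gb2_ext _ _ E). repeat apply gb2_plus; try assumption; now apply gb2_scal.
    - rewrite <- (zsum2_ext _ _ E), zsum2_plus, zsum2_plus, !zsum2_scal, first_variation; try lra; try assumption;
        try (now apply gb2_scal). apply gb2_plus; now apply gb2_scal. }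
  destruct Grem as [Grem Erem].
  assert (Gg : gb2 (fun k l => z ^ 2 / 2 * T * (decay (p / 4) k * decay (p / 4) l)))
    by (apply gb2_scal, gb2_decay; lra).
  assert (PT : 0 <= T) by (unfold T; repeat apply Rmult_le_pos; try (left; apply exp_pos); lra).
  assert (Pz : 0 < z ^ 2) by (apply pow_lt; assumption).
  assert (Main : zsum2 rem <= lsum shells12 rem + z ^ 2 / 2 * T * ((1 + exp (- (p / 4))) / (1 - exp (- (p / 4)))) ^ 2).
  { rewrite <- zsum2_decay, <- zsum2_scal by lra.
    apply zsum2_finite_part; try assumption; [apply shells12_NoDup | |].
    - intros k l. apply Rmult_le_pos; [apply Rmult_le_pos; lra | apply Rmult_le_pos; left; apply decay_pos].
    - intros k l HS. eapply Rle_trans; [apply near_remainder; lra|]. fold z. rewrite (Rmult_assoc _ T).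
      apply Rmult_le_compat_l; [lra|]. apply second_majorant_tail; try assumption; unfold p in Hp; lra. }
  set (q := exp (- (v * a))). set (q0 := exp (- (v0 * a))).
  assert (Fin : lsum shells12 rem <= z ^ 2 / 2 * (2 * q + 4 * q0 + 8 * q ^ 2 + 4 * q0 ^ 2)).
  { apply Rle_trans with (lsum shells12 (fun k l => z ^ 2 / 2 * second_majorant a v k l)).
    - apply lsum_le. intros k l _. apply near_remainder; lra.
    - right. unfold q, q0. rewrite !exp_mult_nat. unfold lsum, shells12, second_majorant. simpl.
      replace ((1 + 1) * - (v * a)) with (- (a * v * 2)) by ring.
      replace ((1 + 1) * - (v0 * a)) with (- (a * v0 * 2)) by ring.
      rewrite (Rmult_comm v a), (Rmult_comm v0 a), !Rmult_1_r. unfold lam2, Kq, Lq. simpl. field. }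
  set (r := exp (- (p / 4))) in *.
  assert (Hr : 0 < r <= 0.56).
  { split; [apply exp_pos|]. apply (exp_neg_bound 0.5815); lra. }
  assert (Hq : 0 < q <= 0.0594).
  { split; [apply exp_pos|]. apply (exp_neg_bound 2.826); [nra | lra | lra]. }
  assert (Hq0 : 0 < q0 <= 0.0268).
  { split; [apply exp_pos|]. apply (exp_neg_bound 3.6257); [nra | lra | lra]. }
  assert (Haq : a * q <= 3.14 * 0.0594).
  { eapply Rle_trans; [apply mult_exp_decreasing with (a0 := 3.14); lra|].
    apply Rmult_le_compat_l; [lra|]. apply (exp_neg_bound 2.826); lra. }
  assert (Haq0 : a * q0 <= 3.14 * 0.0268).
  { eapply Rle_trans; [apply mult_exp_decreasing with (a0 := 3.14); lra|].
    apply Rmult_le_compat_l; [lra|]. apply (exp_neg_bound 3.6257); lra. }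
  assert (HT : T = 64 * exp (- (1 / 2)) * q ^ 3).
  { unfold T, q. rewrite exp_mult_nat, !Rmult_assoc, <- !exp_plus. do 2 f_equal. unfold p. simpl. field. }
  assert (He : exp (- (1 / 2)) <= 0.61) by (apply (exp_neg_bound (1 / 2)); lra).
  assert (He0 := exp_pos (- (1 / 2))).
  set (R := ((1 + r) / (1 - r)) ^ 2) in *.
  assert (HR : 0 <= R <= 12.6).
  { unfold R. split; [apply pow2_ge_0|].
    apply Rle_trans with ((1.56 / 0.44) ^ 2); [|lra].
    apply pow_incr. split; [apply Rdiv_le_0_compat; lra|].
    unfold Rdiv. apply Rmult_le_compat; try lra; [left; apply Rinv_0_lt_compat; lra | apply Rinv_le_contravar; lra]. }
  (* The exponents behind the constants are [3.14 * 0.9 = 2.826] for [q] and at most [3.14 * 1.1547]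
     for [q0]. *)
  assert (Tot : a * (2 * q + 4 * q0 + 8 * q ^ 2 + 4 * q0 ^ 2 + T * R) <= 1.27).
  { assert (A1 : a * q * q <= 3.14 * 0.0594 * 0.0594) by (apply Rmult_le_compat; nra).
    assert (A2 : a * q0 * q0 <= 3.14 * 0.0268 * 0.0268) by (apply Rmult_le_compat; nra).
    assert (A3 : a * q * q * q <= 3.14 * 0.0594 * 0.0594 * 0.0594) by (apply Rmult_le_compat; nra).
    assert (A4 : a * T * R <= 64 * 0.61 * (3.14 * 0.0594 * 0.0594 * 0.0594) * 12.6).
    { rewrite HT. replace (a * (64 * exp (- (1 / 2)) * q ^ 3)) with (64 * exp (- (1 / 2)) * (a * q * q * q)) by ring.
      assert (0 <= a * q * q * q) by (repeat apply Rmult_le_pos; lra).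
      apply Rmult_le_compat; try lra; [apply Rmult_le_pos; lra|].
      apply Rmult_le_compat; try lra. }
    replace (a * (2 * q + 4 * q0 + 8 * q ^ 2 + 4 * q0 ^ 2 + T * R))
      with (2 * (a * q) + 4 * (a * q0) + 8 * (a * q * q) + 4 * (a * q0 * q0) + a * T * R) by ring.
    lra. }
  assert (N3 := N0_ge3 a v0 ltac:(lra) ltac:(lra)).
  assert (Gap : z ^ 2 * 0.212 <= a * (a * (r2 v - r2 v0))).
  { rewrite r2_gap by lra. replace (a * (a * ((v0 - v) ^ 2 * (3 / (16 * v) + (v + 2 * v0) / 64))))
      with (z ^ 2 * (3 / (16 * v) + (v + 2 * v0) / 64)) by (unfold z; field; lra).
    apply Rmult_le_compat_l; [lra|].
    assert (0.1623 <= 3 / (16 * v)) by (apply (Rle_div_r 0.1623 3 (16 * v)); lra). lra. }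
  assert (Ex := exp_ineq1_le (a * (r2 v - r2 v0))).
  (* The 3 comes from the vertices of the triangle ([N0_ge3]). The comparison boils down to
     [1.27 / 2 < 3 * 0.212]. *)
  apply Rlt_le_trans with (zsum2 (Nt a v0) + 3 * (a * (r2 v - r2 v0))).
  - assert (zsum2 (Nt a v) - zsum2 (Nt a v0) < 3 * (a * (r2 v - r2 v0))); [|lra].
    rewrite <- Erem. eapply Rle_lt_trans; [apply Main|].
    apply Rle_lt_trans with (z ^ 2 / 2 * (2 * q + 4 * q0 + 8 * q ^ 2 + 4 * q0 ^ 2 + T * R)); [lra|].
    apply Rmult_lt_reg_l with a; [lra|].
    replace (a * (z ^ 2 / 2 * (2 * q + 4 * q0 + 8 * q ^ 2 + 4 * q0 ^ 2 + T * R)))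
      with (z ^ 2 / 2 * (a * (2 * q + 4 * q0 + 8 * q ^ 2 + 4 * q0 ^ 2 + T * R))) by field.
    apply Rle_lt_trans with (z ^ 2 / 2 * 1.27); [apply Rmult_le_compat_l; lra|]. lra.
  - assert (0 <= a * (r2 v - r2 v0)).
    { apply Rmult_le_reg_l with a; [lra|]. lra. }
    apply Rle_trans with (zsum2 (Nt a v0) * (1 + a * (r2 v - r2 v0))); [|apply Rmult_le_compat_l; lra].
    assert (3 * (a * (r2 v - r2 v0)) <= zsum2 (Nt a v0) * (a * (r2 v - r2 v0))) by (apply Rmult_le_compat_r; lra). lra.
Qed.

(** * The translated sum away from the hexagonal lattice *)

Lemma zsum_geom_le f r c c' : gb1 f -> 0 < r < 1 ->
  (forall n : nat, f (Z.of_nat n) <= c * r ^ n) ->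
  (forall n : nat, f (- Z.of_nat (S n))%Z <= c' * r ^ n) -> (forall k, 0 <= f k) ->
  zsum f <= (c + c') / (1 - r).
Proof.
  intros Hf Hr H H' Hpos.
  assert (Ex : forall d, ex_series (fun n => d * r ^ n)).
  { intros d. apply (ex_series_scal d (fun n => r ^ n)), ex_series_geom. rewrite Rabs_pos_eq; lra. }
  assert (Sd : forall d, Series (fun n => d * r ^ n) = d / (1 - r)).
  { intros d. rewrite Series_scal_l, Series_geom by (rewrite Rabs_pos_eq; lra). reflexivity. }
  replace ((c + c') / (1 - r)) with (c / (1 - r) + c' / (1 - r)) by (field; lra).
  rewrite <- !Sd. unfold zsum. apply Rplus_le_compat; apply Series_le; auto.
Qed.

(** For [k <> 0] one has [k ^ 2 >= 3 |k| - 2], with equality at 1 and 2 in absolute value; the term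
    at 0 is corrected by a spike. *)
Lemma zsum_gauss_le c : 0 < c ->
  zsum (fun k => exp (- (c * IZR k ^ 2))) <= 1 + 2 * (exp (- c) / (1 - exp (- c) ^ 3)).
Proof.
  intros Hc. assert (Hq := exp_neg_lt1 c Hc). set (q := exp (- c)) in *.
  assert (Hq3 : 0 < q ^ 3 < 1).
  { split; [apply pow_lt; lra|]. rewrite <- (pow1 3). simpl. nra. }
  assert (E3 : exp (- (3 * c)) = q ^ 3) by (unfold q; rewrite exp_mult_nat; f_equal; simpl; ring).
  assert (E2 : exp (2 * c) * q ^ 3 = q) by (rewrite <- E3, <- exp_plus; unfold q; f_equal; ring).
  apply Rle_trans with (zsum (fun k => exp (2 * c) * decay (3 * c) k + single 0 (1 - exp (2 * c)) k)).
  - assert (Pi := PI_RGT_0). apply zsum_le.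
    + apply (gb1_ext (fun k => exp (- PI * (c / PI) * (IZR k + 0) ^ 2))).
      * intros k. f_equal. field. lra.
      * apply gb1_gauss. now apply Rdiv_lt_0_compat.
    + apply gb1_plus; [apply gb1_scal, gb1_decay; lra | apply gb1_single].
    + intros k. unfold single, decay. destruct (Z.eqb_spec k 0) as [->|Hk].
      * rewrite Rabs_R0. replace (- (c * 0 ^ 2)) with 0 by ring. replace (- (3 * c) * 0) with 0 by ring.
        rewrite exp_0. lra.
      * rewrite Rplus_0_r, <- exp_plus. apply exp_le. rewrite <- pow2_abs.
        destruct (Z.eq_dec (Z.abs k) 1) as [E|E].
        { rewrite <- abs_IZR, E. lra. }
        assert (2 <= Rabs (IZR k)) by (rewrite <- abs_IZR; apply IZR_le; lia).
        assert (0 <= c * ((Rabs (IZR k) - 1) * (Rabs (IZR k) - 2))) by (repeat apply Rmult_le_pos; lra). lra.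
  - rewrite zsum_plus, zsum_scal, zsum_single, zsum_decay;
      [ | lra | apply gb1_scal, gb1_decay; lra | apply gb1_single].
    rewrite E3. right.
    replace (exp (2 * c) * ((1 + q ^ 3) / (1 - q ^ 3)) + (1 - exp (2 * c)))
      with (1 + 2 * (exp (2 * c) * q ^ 3) / (1 - q ^ 3)) by (field; lra).
    rewrite E2. field. lra.
Qed.

Lemma zsum_pronic_le c : 0 < c ->
  zsum (fun k => exp (- (c * IZR (k * (k + 1))))) <= 2 / (1 - exp (- c) ^ 2).
Proof.
  intros Hc. assert (Hq := exp_neg_lt1 c Hc). set (q := exp (- c)) in *.
  replace 2 with (1 + 1) at 1 by ring.
  assert (B : forall n k, (2 * Z.of_nat n <= k * (k + 1))%Z -> exp (- (c * IZR (k * (k + 1)))) <= 1 * (q ^ 2) ^ n).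
  { intros n k H. rewrite Rmult_1_l, <- pow_mult. unfold q. rewrite exp_mult_nat. apply exp_le.
    apply IZR_le in H. rewrite mult_IZR, <- INR_IZR_INZ in H. rewrite mult_INR. simpl (INR 2). nra. }
  apply zsum_geom_le.
  - assert (Pi := PI_RGT_0).
    apply (gb1_ext (fun k => exp (c / 4) * exp (- PI * (c / PI) * (IZR k + 1 / 2) ^ 2))).
    + intros k. rewrite <- exp_plus, mult_IZR, plus_IZR. f_equal. field. lra.
    + apply gb1_scal, gb1_gauss. now apply Rdiv_lt_0_compat.
  - split; [apply pow_lt; lra|]. simpl. nra.
  - intros n. apply B. nia.
  - intros n. apply B. nia.
  - intros k. left. apply exp_pos.
Qed.

Lemma Nt_row a v l : 0 < a -> 0 < v ->
  zsum (fun k => Nt a v k l)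
  = exp (- (a * ((IZR l + 1) * (IZR l / v - v / 4)))) * chi (a * v / PI) 0 ((IZR l + 1) / 2).
Proof.
  intros Ha Hv. assert (Ppi := PI_RGT_0). unfold chi. rewrite <- zsum_scal. apply zsum_ext. intros k.
  rewrite !Rmult_0_r, Rmult_0_l, cos_0, Rmult_1_r, <- exp_plus. unfold Nt, Kq, Lq, wv.
  rewrite !mult_IZR, !plus_IZR. f_equal. field. lra.
Qed.

(** Row 0 is the sum over [k (k + 1)]. Every other row is at most its weight times [chi s 0 0]: the
    weight is 1 for row -1, [X] for row 1, and at most [r ^ |l|] for [|l| >= 2], which sums to
    [2 * r ^ 2 / (1 - r)]. *)
Lemma theta_rows_bound a v : 0 < a -> 0 < v <= 1 ->
  let q := exp (- (a * v)) in let X := exp (- (a * (2 / v - v / 2))) in let r := exp (- (a / v)) in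
  zsum2 (Nt a v) <= 2 / (1 - q ^ 2) + (1 + 2 * (q / (1 - q ^ 3))) * (1 + X + 2 * r ^ 2 / (1 - r)).
Proof.
  intros Ha Hv q X r. assert (Ppi := PI_RGT_0).
  assert (G := gb2_Nt a v Ha ltac:(lra)). rewrite zsum2_swap by assumption.
  set (s := a * v / PI). assert (Hav : 0 < a * v) by (apply Rmult_lt_0_compat; lra).
  assert (Hs : 0 < s) by now apply Rdiv_lt_0_compat.
  set (C := chi s 0 0).
  assert (HC : C <= 1 + 2 * (q / (1 - q ^ 3))).
  { unfold C, chi, q. eapply Rle_trans; [|apply (zsum_gauss_le (a * v) Hav)]. right. apply zsum_ext. intros k.
    rewrite Rmult_0_r, Rmult_0_l, cos_0, Rmult_1_r. f_equal. unfold s. field. lra. }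
  set (R0 := zsum (fun k => Nt a v k 0)).
  assert (HR0 : R0 <= 2 / (1 - q ^ 2)).
  { unfold R0, q. eapply Rle_trans; [|apply (zsum_pronic_le (a * v) Hav)]. right. apply zsum_ext. intros k.
    unfold Nt, Kq, Lq. simpl. rewrite Z.add_0_r, Rmult_0_l, Rplus_0_r. f_equal. ring. }
  assert (He : 0 < a / v) by (apply Rdiv_lt_0_compat; lra).
  assert (Hr : 0 < r < 1) by (apply exp_neg_lt1; assumption).
  set (tail := fun l => decay (a / v) l - single 0 1 l - single 1 r l - single (-1) r l).
  assert (Gt : gb1 tail) by (repeat apply gb1_minus; try apply gb1_single; now apply gb1_decay).
  assert (St : zsum tail = 2 * r ^ 2 / (1 - r)).
  { unfold tail. rewrite !zsum_minus, !zsum_single, zsum_decay; try apply gb1_single; try assumption;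
      repeat apply gb1_minus; try apply gb1_single; try (now apply gb1_decay).
    fold r. field. lra. }
  assert (D1 : decay (a / v) 1 = r) by (unfold decay, r; rewrite Rabs_R1; f_equal; ring).
  assert (D1' : decay (a / v) (-1) = r).
  { change (-1)%Z with (Z.opp 1). rewrite decay_neg. exact D1. }
  assert (D0 : decay (a / v) 0 = 1) by (unfold decay; rewrite Rabs_R0, Rmult_0_r, exp_0; reflexivity).
  set (w := fun l => single (-1) 1 l + single 1 X l + tail l).
  assert (Gw : gb1 w) by (apply gb1_plus; [apply gb1_plus; apply gb1_single | exact Gt]).
  apply Rle_trans with (zsum (fun l => single 0 R0 l + C * w l)).
  - unfold zsum2. apply zsum_le.
    + apply (gb2_zsum (fun l k => Nt a v k l)). now apply gb2_swap.
    + apply gb1_plus; [apply gb1_single | now apply gb1_scal].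
    + intros l. unfold w, tail, single.
      destruct (Z.eqb_spec l 0) as [->|H0].
      { simpl. rewrite D0. unfold R0. lra. }
      assert (B := chi_le_0 s 0 ((IZR l + 1) / 2) Hs ltac:(lra)). fold C in B. apply Rabs_le_between in B.
      rewrite Nt_row by lra. fold s.
      assert (Wt : forall W, exp (- (a * ((IZR l + 1) * (IZR l / v - v / 4)))) <= W ->
         exp (- (a * ((IZR l + 1) * (IZR l / v - v / 4)))) * chi s 0 ((IZR l + 1) / 2) <= C * W).
      { intros W HW. assert (P := exp_pos (- (a * ((IZR l + 1) * (IZR l / v - v / 4))))).
        rewrite (Rmult_comm C). apply Rle_trans with (exp (- (a * ((IZR l + 1) * (IZR l / v - v / 4)))) * C).
        - apply Rmult_le_compat_l; lra.
        - apply Rmult_le_compat_r; lra. }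
      rewrite Rplus_0_l. apply Wt.
      destruct (Z.eqb_spec l 1) as [->|H1].
      { destruct (Z.eqb_spec 1 (-1)); [lia|]. rewrite D1. 
        assert (exp (- (a * ((1 + 1) * (1 / v - v / 4)))) = X) by (unfold X; f_equal; field; lra). lra. }
      destruct (Z.eqb_spec l (-1)) as [->|H2].
      { rewrite D1'. replace (- (a * ((-1 + 1) * (-1 / v - v / 4)))) with 0 by (field; lra). rewrite exp_0. lra. }
      assert (exp (- (a * ((IZR l + 1) * (IZR l / v - v / 4)))) <= decay (a / v) l); [|lra].
      unfold decay. apply exp_le. 
      assert (Iv : 1 <= / v) by (rewrite <- Rinv_1; apply Rinv_le_contravar; lra).
      assert (Rabs (IZR l) * / v <= (IZR l + 1) * (IZR l * / v - v / 4)).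
      { destruct (Z_lt_ge_dec l 0) as [Hl|Hl].
        - assert (Hl2 : IZR l <= -2) by (apply IZR_le; lia). rewrite Rabs_left by lra.
          assert (0 <= (- IZR l - 2) * (- IZR l) * / v) by (repeat apply Rmult_le_pos; lra).
          nra.
        - assert (Hl2 : 2 <= IZR l) by (apply IZR_le; lia). rewrite Rabs_pos_eq by lra.
          nra. }
      unfold Rdiv at 1 2. unfold Rdiv in H. nra.
  - rewrite zsum_plus, zsum_scal, zsum_single by (apply gb1_single || now apply gb1_scal).
    apply Rplus_le_compat; [assumption|].
    unfold w. rewrite zsum_plus, zsum_plus, !zsum_single, St;
      [ | apply gb1_single | apply gb1_single | apply gb1_plus; apply gb1_single | exact Gt].
    apply Rmult_le_compat_r; [|assumption].
    assert (0 <= 2 * r ^ 2 / (1 - r)) by (apply Rdiv_le_0_compat; [generalize (pow2_ge_0 r)|]; lra).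
    generalize (exp_pos (- (a * (2 / v - v / 2)))). fold X. lra.
Qed.

(** No lattice point is closer to b than the circumradius, so every exponent is nonpositive. *)
Lemma Nt_decreasing a a' v : 0 < a <= a' -> 0 < v <= v0 -> zsum2 (Nt a' v) <= zsum2 (Nt a v).
Proof.
  intros Ha Hv. apply zsum2_le; try (apply gb2_Nt; lra). intros k l. unfold Nt. apply exp_le.
  assert (W := wv_lower v Hv). assert (HL := IZR_le _ _ (Lq_nonneg l)).
  assert (HK := IZR_le _ _ (Kq_Lq_nonneg k l)). rewrite plus_IZR in HK.
  assert (0 <= IZR (Kq k l) * v + IZR (Lq l) * wv v).
  { assert (0 <= (IZR (Kq k l) + IZR (Lq l)) * v) by (apply Rmult_le_pos; lra).
    assert (0 <= IZR (Lq l) * (wv v - v)) by (apply Rmult_le_pos; lra). lra. }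
  nra.
Qed.

Lemma r2_gap_lower v v' : 0 < v <= v' -> v' <= 1.1547 ->
  (1.1547 - v') ^ 2 * (3 / (16 * v') + 0.036) <= r2 v - r2 v0.
Proof.
  intros Hv Hv'. assert (B := v0_bounds). rewrite r2_gap by lra. apply Rmult_le_compat.
  - apply pow2_ge_0.
  - assert (0 < 3 / (16 * v')) by (apply Rdiv_lt_0_compat; lra). lra.
  - apply pow_incr. lra.
  - apply Rplus_le_compat; [|lra]. unfold Rdiv. apply Rmult_le_compat_l; [lra|].
    apply Rinv_le_contravar; lra.
Qed.

(* Away from the hexagonal lattice it suffices to treat [a = 3.14 < PI], since [Nt] decreases
   in its first argument. *)
Lemma crude_interval v v1 v2 Q X r : 0 < v1 -> v1 <= v <= v2 -> v2 <= 1 -> 0 < Q < 1 -> 0 < r < 1 -> 0 < X ->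
  exp (- (3.14 * v1)) <= Q -> exp (- (3.14 * (2 / v2 - v2 / 2))) <= X -> exp (- (3.14 / v2)) <= r ->
  2 / (1 - Q ^ 2) + (1 + 2 * (Q / (1 - Q ^ 3))) * (1 + X + 2 * r ^ 2 / (1 - r))
    < 3 * (1 + 3.14 * ((1.1547 - v2) ^ 2 * (3 / (16 * v2) + 0.036))) ->
  zsum2 (Nt 3.14 v) < 3 * exp (3.14 * (r2 v - r2 v0)).
Proof.
  intros H1 Hv Hv2 HQ Hr HX EQ EX Er H.
  eapply Rle_lt_trans; [apply theta_rows_bound; lra|].
  set (q := exp (- (3.14 * v))). set (X' := exp (- (3.14 * (2 / v - v / 2)))). set (r' := exp (- (3.14 / v))).
  assert (Hq : 0 < q <= Q).
  { split; [apply exp_pos|]. eapply Rle_trans; [|apply EQ]. apply exp_le. lra. }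
  assert (Iv : / v2 <= / v) by (apply Rinv_le_contravar; lra).
  assert (HX' : 0 < X' <= X).
  { split; [apply exp_pos|]. eapply Rle_trans; [|apply EX]. apply exp_le. unfold Rdiv. lra. }
  assert (Hr' : 0 < r' <= r).
  { split; [apply exp_pos|]. eapply Rle_trans; [|apply Er]. apply exp_le. unfold Rdiv. lra. }
  (* The bound increases in each of [q], [X'] and [r']. The first is largest at [v1], the other two
     at [v2], where the circumradius gap is also smallest. *)
  apply Rle_lt_trans with (2 / (1 - Q ^ 2) + (1 + 2 * (Q / (1 - Q ^ 3))) * (1 + X + 2 * r ^ 2 / (1 - r))).
  - assert (P2 : q ^ 2 <= Q ^ 2) by (apply pow_incr; lra).
    assert (P3 : q ^ 3 <= Q ^ 3) by (apply pow_incr; lra).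
    assert (Q2 : Q ^ 2 < 1) by (simpl; nra).
    assert (Q3 : Q ^ 3 < 1) by (simpl; nra).
    assert (R2 : r' ^ 2 <= r ^ 2) by (apply pow_incr; lra).
    assert (A1 : / (1 - q ^ 2) <= / (1 - Q ^ 2)) by (apply Rinv_le_contravar; lra).
    assert (A2 : q / (1 - q ^ 3) <= Q / (1 - Q ^ 3)).
    { apply Rmult_le_compat; try lra; [left; apply Rinv_0_lt_compat | apply Rinv_le_contravar]; lra. }
    assert (A2' : 0 <= q / (1 - q ^ 3)) by (apply Rdiv_le_0_compat; lra).
    assert (A3 : 2 * r' ^ 2 / (1 - r') <= 2 * r ^ 2 / (1 - r)).
    { apply Rmult_le_compat; try lra; [generalize (pow2_ge_0 r'); lra | left; apply Rinv_0_lt_compat; lra | apply Rinv_le_contravar; lra]. }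
    assert (A3' : 0 <= 2 * r' ^ 2 / (1 - r')) by (apply Rdiv_le_0_compat; [generalize (pow2_ge_0 r')|]; lra).
    apply Rplus_le_compat; [unfold Rdiv; lra|]. apply Rmult_le_compat; lra.
  - eapply Rlt_le_trans; [apply H|]. apply Rmult_le_compat_l; [lra|].
    eapply Rle_trans; [|apply exp_ineq1_le]. apply Rplus_le_compat_l. apply Rmult_le_compat_l; [lra|].
    apply r2_gap_lower; lra.
Qed.

(** Here both sides grow like [1 / c] with [c = 3.14 * v], so no finite set of intervals would do.
    The coefficients of [1 / c] are about 3.0004 on the left and 3.12 on the right. *)
Lemma crude_small v : 0 < v <= 0.4 -> zsum2 (Nt 3.14 v) < 3 * exp (3.14 * (r2 v - r2 v0)).
Proof.
  intros Hv. eapply Rle_lt_trans; [apply theta_rows_bound; lra|].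
  set (q := exp (- (3.14 * v))). set (X' := exp (- (3.14 * (2 / v - v / 2)))). set (r' := exp (- (3.14 / v))).
  set (c := 3.14 * v). assert (Hc : 0 < c <= 1.256) by (unfold c; lra).
  assert (Iv : 2.5 <= / v).
  { apply Rmult_le_reg_l with v; [lra|]. rewrite Rinv_r; lra. }
  assert (HX' : 0 < X' <= 0.0001).
  { split; [apply exp_pos|]. apply (exp_neg_bound 10); [unfold Rdiv; lra | lra | lra]. }
  assert (Hr' : 0 < r' <= 0.001).
  { split; [apply exp_pos|]. apply (exp_neg_bound 7.5); [unfold Rdiv; lra | lra | lra]. }
  assert (Hq : 0 < q < 1) by (apply exp_neg_lt1; lra).
  assert (Hq' : q * (1 + c) <= 1).
  { unfold q. fold c. rewrite exp_Ropp. apply Rmult_le_reg_l with (exp c); [apply exp_pos|].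
    rewrite <- Rmult_assoc, Rinv_r by (apply Rgt_not_eq, exp_pos). generalize (exp_ineq1_le c). lra. }
  assert (A1 : 2 / (1 - q ^ 2) <= 2 + 1 / c).
  { apply Rle_div_l; [nra|]. apply Rmult_le_reg_l with c; [lra|].
    replace (c * ((2 + 1 / c) * (1 - q ^ 2))) with ((2 * c + 1) * (1 - q ^ 2)) by (field; lra).
    assert ((2 * c + 1) * q ^ 2 <= 1); nra. }
  assert (A2 : q / (1 - q ^ 3) <= 1 / c).
  { apply Rle_trans with (q / (1 - q)).
    - apply Rmult_le_compat_l; [lra|]. apply Rinv_le_contravar; [lra|]. assert (q ^ 3 <= q) by (simpl; nra). lra.
    - apply Rle_div_l; [lra|]. apply Rmult_le_reg_l with c; [lra|].
      replace (c * (1 / c * (1 - q))) with (1 - q) by (field; lra). lra. }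
  assert (A2' : 0 <= q / (1 - q ^ 3)).
  { apply Rdiv_le_0_compat; [lra|]. assert (q ^ 3 < 1) by (simpl; nra). lra. }
  assert (A3 : 2 * r' ^ 2 / (1 - r') <= 0.0001).
  { apply Rle_div_l; [lra|]. assert (r' ^ 2 <= 0.001 ^ 2) by (apply pow_incr; lra). lra. }
  assert (Pc' : 1 <= 1.256 * (1 / c)).
  { apply Rmult_le_reg_l with c; [lra|]. replace (c * (1.256 * (1 / c))) with (1.256 * (c * / c)) by (unfold Rdiv; ring). rewrite Rinv_r; lra. }
  apply Rle_lt_trans with (2 + 1 / c + (1 + 2 * (1 / c)) * (1 + 0.0001 + 0.0001)).
  { apply Rplus_le_compat; [assumption|]. apply Rmult_le_compat; try lra.
    assert (0 <= 2 * r' ^ 2 / (1 - r')) by (apply Rdiv_le_0_compat; [generalize (pow2_ge_0 r')|]; lra). lra. }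
  apply Rlt_le_trans with (3 * (1 + 1.04 * (1 / c))); [lra|].
  apply Rmult_le_compat_l; [lra|]. eapply Rle_trans; [|apply exp_ineq1_le]. apply Rplus_le_compat_l.
  assert (B := v0_bounds). rewrite r2_gap by lra.
  (* [0.7547 = 1.1547 - 0.4], and [3.14 ^ 2 * 0.7547 ^ 2 * 3 / 16] exceeds 1.04. *)
  apply Rle_trans with (3.14 * (0.7547 ^ 2 * (3 / (16 * v)))).
  - unfold c. apply Rmult_le_reg_l with v; [lra|].
    unfold Rdiv. rewrite !Rinv_mult.
    replace (v * (1.04 * (1 * (/ 3.14 * / v)))) with (1.04 * / 3.14 * (v * / v)) by ring.
    replace (v * (3.14 * (0.7547 ^ 2 * (3 * (/ 16 * / v))))) with (3.14 * 0.7547 ^ 2 * 3 * / 16 * (v * / v)) by ring.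
    rewrite Rinv_r by lra. lra.
  - apply Rmult_le_compat_l; [lra|]. apply Rmult_le_compat.
    + lra.
    + left. apply Rdiv_lt_0_compat; lra.
    + apply pow_incr. lra.
    + lra.
Qed.

(** The intervals get shorter towards 0.9, where the gap of the circumradius shrinks
    quadratically. *)
Lemma crude_all v : 0 < v <= 0.9 -> zsum2 (Nt 3.14 v) < 3 * exp (3.14 * (r2 v - r2 v0)).
Proof.
  intros Hv.
  destruct (Rle_lt_dec v 0.4); [apply crude_small; lra|].
  destruct (Rle_lt_dec v 0.55).
  { apply (crude_interval v 0.4 0.55 0.29 0.01 0.01); try lra.
    - apply (exp_neg_bound 1.256); lra.
    - apply (exp_neg_bound 6); lra.
    - apply (exp_neg_bound 5); lra. }
  destruct (Rle_lt_dec v 0.7).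
  { apply (crude_interval v 0.55 0.7 0.18 0.01 0.02); try lra.
    - apply (exp_neg_bound 1.727); lra.
    - apply (exp_neg_bound 6); lra.
    - apply (exp_neg_bound 4.4); lra. }
  destruct (Rle_lt_dec v 0.8).
  { apply (crude_interval v 0.7 0.8 0.112 0.01 0.03); try lra.
    - apply (exp_neg_bound 2.198); lra.
    - apply (exp_neg_bound 6); lra.
    - apply (exp_neg_bound 3.9); lra. }
  destruct (Rle_lt_dec v 0.85).
  { apply (crude_interval v 0.8 0.85 0.082 0.003 0.03); try lra.
    - apply (exp_neg_bound 2.512); lra.
    - apply (exp_neg_bound 6); lra.
    - apply (exp_neg_bound 3.69); lra. }
  destruct (Rle_lt_dec v 0.875).
  { apply (crude_interval v 0.85 0.875 0.07 0.004 0.03); try lra.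
    - apply (exp_neg_bound 2.669); lra.
    - apply (exp_neg_bound 5.8); lra.
    - apply (exp_neg_bound 3.58); lra. }
  apply (crude_interval v 0.875 0.9 0.0645 0.0039 0.031); try lra.
  - apply (exp_neg_bound 2.7475); lra.
  - apply (exp_neg_bound 5.564); lra.
  - apply (exp_neg_bound 3.488); lra.
Qed.

Lemma theta_step2 v al : 0 < v < v0 -> 1 <= al ->
  theta (1 / 2) (/ v) (b1 (1 / 2) (/ v)) (b2 (1 / 2) (/ v)) al
  < theta (1 / 2) (/ v0) (b1 (1 / 2) (/ v0)) (b2 (1 / 2) (/ v0)) al.
Proof.
  intros Hv Hal. assert (PB := PI_bounds).
  rewrite !theta_half by lra. set (a := PI * al). assert (Ha : 3.14 <= a) by (unfold a; nra).
  assert (Main : zsum2 (Nt a v) < zsum2 (Nt a v0) * exp (a * (r2 v - r2 v0))).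
  { destruct (Rle_lt_dec 0.9 v) as [H|H]; [apply near_hexagonal; lra|].
    eapply Rle_lt_trans; [apply (Nt_decreasing 3.14 a); lra|].
    eapply Rlt_le_trans; [apply crude_all; lra|].
    apply Rmult_le_compat; [lra | left; apply exp_pos | apply N0_ge3; lra |].
    apply exp_le. apply Rmult_le_compat_r; [|lra].
    eapply Rle_trans; [|apply (r2_gap_lower v 0.9); lra].
    apply Rmult_le_pos; [apply pow2_ge_0|]. lra. }
  apply (Rmult_lt_compat_l (exp (- (a * r2 v)))) in Main; [|apply exp_pos].
  eapply Rlt_le_trans; [apply Main|]. right.
  replace (- (a * r2 v0)) with (- (a * r2 v) + a * (r2 v - r2 v0)) by ring. rewrite exp_plus. ring.
Qed.

(** * Vertical deformation of the twisted sum *)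

(* As before with [v = 1/y]: [bv] is b_2, and [phase] is the argument of the cosine, split into
   its hexagonal value and a deviation. *)
Definition bv (v : R) : R := 1 / 2 - v ^ 2 / 8.
Definition Kh (k l : Z) : Z := (k * (k + l))%Z.
Definition hexf (k l : Z) : Z := (k * k + k * l + l * l)%Z.
Definition Ge (a v : R) (k l : Z) : R := exp (- (a * (IZR (Kh k l) * v + IZR (l * l) * wv v))).
Definition phase (v : R) (k l : Z) : R :=
  2 * PI / 3 * (IZR k - IZR l) + 2 * PI * (bv v - 1 / 3) * (IZR k + IZR l / 2).
Definition Ht (a v : R) (k l : Z) : R := Ge a v k l * cos (phase v k l).

Lemma thetahat_half v al : 0 < v ->
  thetahat (1 / 2) (/ v) (b1 (1 / 2) (/ v)) (b2 (1 / 2) (/ v)) al = zsum2 (Ht (PI * al) v).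
Proof.
  intros Hv. apply zsum2_ext. intros k l. unfold Ht, Ge, phase. f_equal; f_equal.
  - unfold qform, wv, Kh. rewrite !mult_IZR, plus_IZR. field. lra.
  - unfold b1, b2, bv. field. lra.
Qed.

Lemma gb2_Ge a v : 0 < a -> 0 < v -> gb2 (Ge a v).
Proof.
  intros Ha Hv. assert (Ppi := PI_RGT_0).
  apply (gb2_ext (fun k l => exp (- PI * (a / PI) * qform (1 / 2) (/ v) (IZR k + 0) (IZR l + 0)))).
  - intros k l. unfold Ge, qform, wv, Kh. rewrite !mult_IZR, plus_IZR. f_equal. field. lra.
  - apply gb2_qform; [now apply Rinv_0_lt_compat | now apply Rdiv_lt_0_compat].
Qed.

Lemma gb2_Ht a v : 0 < a -> 0 < v -> gb2 (Ht a v).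
Proof.
  intros Ha Hv. apply (gb2_le _ (Ge a v)); [now apply gb2_Ge|]. intros k l. apply Rabs_exp_cos.
Qed.

Lemma hexf_split k l : hexf k l = (Kh k l + l * l)%Z.
Proof. unfold hexf, Kh. ring. Qed.

Lemma hexf_nonneg k l : (0 <= hexf k l)%Z.
Proof.
  unfold hexf. assert (0 <= (k + l) * (k + l))%Z by apply Z.square_nonneg.
  generalize (Z.square_nonneg k) (Z.square_nonneg l). lia.
Qed.

Lemma Ge_le a v k l : 0 < a -> 0 < v <= v0 -> Ge a v k l <= exp (- (a * v * IZR (hexf k l))).
Proof.
  intros Ha Hv. unfold Ge. apply exp_le. rewrite hexf_split, plus_IZR.
  assert (W := wv_lower v Hv). assert (HL := IZR_le _ _ (Z.square_nonneg l)).
  assert (0 <= a * (IZR (l * l) * (wv v - v))) by (repeat apply Rmult_le_pos; lra). lra.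
Qed.

Lemma Ge_v0 a k l : Ge a v0 k l = exp (- (a * v0 * IZR (hexf k l))).
Proof. unfold Ge. rewrite wv_v0, hexf_split, plus_IZR. f_equal. ring. Qed.

Lemma bv_v0 : bv v0 = 1 / 3.
Proof. unfold bv. rewrite v0_sqr. field. Qed.

Lemma phase_v0 k l : phase v0 k l = 2 * PI / 3 * (IZR k - IZR l).
Proof. unfold phase. rewrite bv_v0. ring. Qed.

(* The shells [hexf <= 1] and [3 <= hexf <= 4] of the hexagonal form. *)
Definition hex7 : list (Z * Z) :=
  ((0, 0) :: (1, 0) :: (-1, 0) :: (0, 1) :: (0, -1) :: (1, -1) :: (-1, 1) :: nil)%Z.

Definition hex12 : list (Z * Z) :=
  ((1, 1) :: (-1, -1) :: (2, -1) :: (-2, 1) :: (1, -2) :: (-1, 2)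
   :: (2, 0) :: (-2, 0) :: (0, 2) :: (0, -2) :: (2, -2) :: (-2, 2) :: nil)%Z.

Lemma hex19_NoDup : NoDup (hex7 ++ hex12).
Proof. repeat constructor; simpl; intuition congruence. Qed.

(** Evaluation inside a box and [2 hexf = (k + l)^2 + k^2 + l^2] outside. At decay rate [p], the
    constant 15 yields the factor [exp (- (5 * p))] of [hat_shells]. *)
Lemma hex19_out k l : ~ In (k, l) (hex7 ++ hex12) ->
  (7 <= hexf k l)%Z /\ (15 + Z.abs k + Z.abs l <= 3 * hexf k l)%Z.
Proof.
  intros H.
  assert (B := box_forall 7 (fun k l => orb (inb (hex7 ++ hex12) k l)
    (andb (Z.leb 7 (hexf k l)) (Z.leb (15 + Z.abs k + Z.abs l) (3 * hexf k l)))) eq_refl k l).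
  destruct (Z_le_gt_dec (Z.abs k) 7) as [Hk|Hk], (Z_le_gt_dec (Z.abs l) 7) as [Hl|Hl].
  { specialize (B Hk Hl). apply Bool.orb_prop in B. destruct B as [B|B]; [now apply inb_In in B|].
    apply andb_prop in B. destruct B as [B1 B2]. apply Z.leb_le in B1, B2. now split. }
  all: assert (E : (2 * hexf k l = (k + l) * (k + l) + Z.abs k * Z.abs k + Z.abs l * Z.abs l)%Z)
    by (rewrite <- !Z.abs_mul, (Z.abs_eq (k * k)), (Z.abs_eq (l * l)) by apply Z.square_nonneg; unfold hexf; ring).
  all: assert (0 <= (k + l) * (k + l))%Z by apply Z.square_nonneg.
  all: assert (0 <= Z.abs k)%Z by lia; assert (0 <= Z.abs l)%Z by lia.
  all: set (K := Z.abs k) in *; set (L := Z.abs l) in *.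
  all: assert (K <= K * K)%Z by nia; assert (L <= L * L)%Z by nia.
  - lia.
  - lia.
  - lia.
Qed.

Lemma lsum_app S S' f : lsum (S ++ S') f = lsum S f + lsum S' f.
Proof. unfold lsum. induction S as [|p S IH]; simpl; [ring|]. rewrite IH. ring. Qed.

(* The rate [p] may be taken below the actual decay rate of [f], to absorb a polynomial weight. *)
Lemma hat_shells f B3 B4 Bt p : gb2 f -> 0 < p -> 0 <= Bt ->
  (forall k l, In (k, l) hex12 -> hexf k l = 3%Z -> f k l <= B3) ->
  (forall k l, In (k, l) hex12 -> hexf k l = 4%Z -> f k l <= B4) ->
  (forall k l, (7 <= hexf k l)%Z -> f k l <= Bt * exp (- (p * IZR (hexf k l)))) ->
  zsum2 f <= lsum hex7 f + (6 * B3 + 6 * B4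
     + Bt * exp (- (5 * p)) * ((1 + exp (- (p / 3))) / (1 - exp (- (p / 3)))) ^ 2).
Proof.
  intros Hf Hp HB H3 H4 Ht.
  assert (M : zsum2 f <= lsum (hex7 ++ hex12) f
     + zsum2 (fun k l => Bt * exp (- (5 * p)) * (decay (p / 3) k * decay (p / 3) l))).
  { apply zsum2_finite_part; try assumption.
    - apply hex19_NoDup.
    - apply gb2_scal, gb2_decay. lra.
    - intros k l. apply Rmult_le_pos; [|apply Rmult_le_pos; left; apply decay_pos].
      apply Rmult_le_pos; [assumption | left; apply exp_pos].
    - intros k l HS. destruct (hex19_out k l HS) as [N1 N2].
      eapply Rle_trans; [now apply Ht|]. rewrite (Rmult_assoc Bt). apply Rmult_le_compat_l; [assumption|].
      unfold decay. rewrite <- !exp_plus. apply exp_le.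
      apply IZR_le in N2. rewrite mult_IZR, (plus_IZR (15 + _)), (plus_IZR 15), !abs_IZR in N2.
      assert (0 <= p * (3 * IZR (hexf k l) - (15 + Rabs (IZR k) + Rabs (IZR l)))) by (apply Rmult_le_pos; lra).
      lra. }
  rewrite zsum2_scal, zsum2_decay, lsum_app in M by lra.
  assert (lsum hex12 f <= 6 * B3 + 6 * B4); [|lra].
  assert (A3 : forall k l, In (k, l) hex12 -> Z.eqb (hexf k l) 3 = true -> f k l <= B3).
  { intros k l I E. apply H3; [assumption | now apply Z.eqb_eq]. }
  assert (A4 : forall k l, In (k, l) hex12 -> Z.eqb (hexf k l) 4 = true -> f k l <= B4).
  { intros k l I E. apply H4; [assumption | now apply Z.eqb_eq]. }
  clear H3 H4. unfold lsum. unfold hex12 at 1. cbn [fold_right fst snd].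
  assert (C1 := A3 1%Z 1%Z ltac:(simpl; tauto) eq_refl). assert (C2 := A3 (-1)%Z (-1)%Z ltac:(simpl; tauto) eq_refl).
  assert (C3 := A3 2%Z (-1)%Z ltac:(simpl; tauto) eq_refl). assert (C4 := A3 (-2)%Z 1%Z ltac:(simpl; tauto) eq_refl).
  assert (C5 := A3 1%Z (-2)%Z ltac:(simpl; tauto) eq_refl). assert (C6 := A3 (-1)%Z 2%Z ltac:(simpl; tauto) eq_refl).
  assert (D1 := A4 2%Z 0%Z ltac:(simpl; tauto) eq_refl). assert (D2 := A4 (-2)%Z 0%Z ltac:(simpl; tauto) eq_refl).
  assert (D3 := A4 0%Z 2%Z ltac:(simpl; tauto) eq_refl). assert (D4 := A4 0%Z (-2)%Z ltac:(simpl; tauto) eq_refl).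
  assert (D5 := A4 2%Z (-2)%Z ltac:(simpl; tauto) eq_refl). assert (D6 := A4 (-2)%Z 2%Z ltac:(simpl; tauto) eq_refl).
  lra.
Qed.

Lemma cos_2PI3 : cos (2 * PI / 3) = -1 / 2.
Proof.
  replace (2 * PI / 3) with (PI - PI / 3) by field.
  rewrite Rtrigo_facts.cos_pi_minus, cos_PI3. field.
Qed.

Lemma hat_first_shell a v : 0 < v ->
  lsum hex7 (Ht a v) = 1 + 2 * exp (- (a * v)) * cos (2 * PI * bv v) - 4 * exp (- (a * wv v)) * cos (PI * bv v).
Proof.
  intros Hv. unfold lsum, hex7, Ht, Ge, phase, Kh. cbn [fold_right fst snd]. simpl Z.mul. simpl Z.add.
  set (b := bv v). set (w := wv v).
  replace (2 * PI / 3 * (0 - 0) + 2 * PI * (b - 1 / 3) * (0 + 0 / 2)) with 0 by field.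
  replace (2 * PI / 3 * (1 - 0) + 2 * PI * (b - 1 / 3) * (1 + 0 / 2)) with (2 * PI * b) by field.
  replace (2 * PI / 3 * (-1 - 0) + 2 * PI * (b - 1 / 3) * (-1 + 0 / 2)) with (- (2 * PI * b)) by field.
  replace (2 * PI / 3 * (0 - 1) + 2 * PI * (b - 1 / 3) * (0 + 1 / 2)) with (PI * b - PI) by field.
  replace (2 * PI / 3 * (0 - -1) + 2 * PI * (b - 1 / 3) * (0 + -1 / 2)) with (- (PI * b - PI)) by field.
  replace (2 * PI / 3 * (1 - -1) + 2 * PI * (b - 1 / 3) * (1 + -1 / 2)) with (PI * b + PI) by field.
  replace (2 * PI / 3 * (-1 - 1) + 2 * PI * (b - 1 / 3) * (-1 + 1 / 2)) with (- (PI * b + PI)) by field.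
  rewrite !cos_neg, neg_cos, cos_0.
  replace (cos (PI * b - PI)) with (- cos (PI * b)) by (rewrite cos_minus, cos_PI, sin_PI; ring).
  replace (- (a * (0 * v + 0 * w))) with 0 by ring. rewrite exp_0.
  replace (- (a * (1 * v + 0 * w))) with (- (a * v)) by ring.
  replace (- (a * (0 * v + 1 * w))) with (- (a * w)) by ring. ring.
Qed.

(* Change of the first shell, divided by [- exp (- (a * v))]. *)
Definition Rm (a v : R) : R :=
  let c := cos (PI * bv v) in
  2 - 4 * c ^ 2 + 4 * c * exp (- (a * (wv v - v))) - 3 * exp (- (a * (v0 - v))).

Lemma hat_first_shell_v0 a : lsum hex7 (Ht a v0) = 1 - 3 * exp (- (a * v0)).
Proof.
  assert (B := v0_bounds). rewrite hat_first_shell, wv_v0, bv_v0 by lra.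
  replace (2 * PI * (1 / 3)) with (2 * PI / 3) by field. rewrite cos_2PI3.
  replace (PI * (1 / 3)) with (PI / 3) by field. rewrite cos_PI3. field.
Qed.

Lemma hat_first_shell_diff a v : 0 < v ->
  lsum hex7 (Ht a v) - lsum hex7 (Ht a v0) = - (exp (- (a * v)) * Rm a v).
Proof.
  intros Hv. rewrite hat_first_shell, hat_first_shell_v0 by assumption. unfold Rm. cbv zeta.
  replace (2 * PI * bv v) with (2 * (PI * bv v)) by ring. rewrite cos_2a_cos.
  set (c := cos (PI * bv v)).
  replace (exp (- (a * wv v))) with (exp (- (a * v)) * exp (- (a * (wv v - v)))) by (rewrite <- exp_plus; f_equal; ring).
  replace (exp (- (a * v0))) with (exp (- (a * v)) * exp (- (a * (v0 - v)))) by (rewrite <- exp_plus; f_equal; ring).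
  ring.
Qed.

Lemma Ht_abs_le a v k l : 0 < a -> 0 < v <= v0 -> Rabs (Ht a v k l) <= exp (- (a * v * IZR (hexf k l))).
Proof.
  intros Ha Hv. eapply Rle_trans; [apply Rabs_exp_cos|]. now apply Ge_le.
Qed.

(** Outside the first shell no cancellation is used: both sums are bounded in absolute value at [v],
    whence the factor 2. *)
Lemma hat_crude a v : 0 < a -> 0 < v <= v0 ->
  let q := exp (- (a * v)) in let r := exp (- (a * v / 3)) in
  zsum2 (Ht a v) - zsum2 (Ht a v0)
  <= - (q * Rm a v) + 2 * (6 * q ^ 3 + 6 * q ^ 4 + q ^ 5 * ((1 + r) / (1 - r)) ^ 2).
Proof.
  intros Ha Hv q r.
  assert (G := gb2_Ht a v Ha ltac:(lra)). assert (G0 := gb2_Ht a v0 Ha ltac:(lra)).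
  set (f := fun k l => Ht a v k l + -1 * Ht a v0 k l).
  assert (Gf : gb2 f) by (apply gb2_plus; [assumption | now apply gb2_scal]).
  replace (zsum2 (Ht a v) - zsum2 (Ht a v0)) with (zsum2 f).
  2:{ unfold f. rewrite zsum2_plus, zsum2_scal by (assumption || now apply gb2_scal). ring. }
  assert (Hav : 0 < a * v) by (apply Rmult_lt_0_compat; lra).
  assert (Bd : forall k l, f k l <= 2 * exp (- (a * v * IZR (hexf k l)))).
  { intros k l. assert (H1 := Ht_abs_le a v k l Ha Hv). assert (H2 := Ht_abs_le a v0 k l Ha ltac:(lra)).
    assert (exp (- (a * v0 * IZR (hexf k l))) <= exp (- (a * v * IZR (hexf k l)))).
    { apply exp_le. assert (N := IZR_le _ _ (hexf_nonneg k l)).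
      assert (0 <= a * ((v0 - v) * IZR (hexf k l))) by (repeat apply Rmult_le_pos; lra). lra. }
    apply Rabs_le_between in H1, H2. unfold f. lra. }
  eapply Rle_trans; [apply (hat_shells f (2 * q ^ 3) (2 * q ^ 4) 2 (a * v)); try assumption; try lra|].
  - intros k l _ E. eapply Rle_trans; [apply Bd|]. rewrite E. right. unfold q. rewrite exp_mult_nat.
    do 3 f_equal. simpl. ring.
  - intros k l _ E. eapply Rle_trans; [apply Bd|]. rewrite E. right. unfold q. rewrite exp_mult_nat.
    do 3 f_equal. simpl. ring.
  - intros k l _. apply Bd.
  - replace (lsum hex7 f) with (- (q * Rm a v)).
    + replace (exp (- (5 * (a * v)))) with (q ^ 5) by (unfold q; rewrite exp_mult_nat; f_equal; simpl; ring).
      fold r. lra.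
    + unfold q. rewrite <- hat_first_shell_diff by lra. unfold f, lsum, hex7. cbn [fold_right fst snd]. ring.
Qed.

(** A benchmark for very large y, where the twisted sum is small and no comparison of shells is
    attempted. *)
Lemma hat_v0_lower a : 3.14 <= a -> 0.9 <= zsum2 (Ht a v0).
Proof.
  intros Ha. assert (B := v0_bounds).
  assert (G0 := gb2_Ht a v0 ltac:(lra) ltac:(lra)).
  assert (Gf : gb2 (fun k l => -1 * Ht a v0 k l)) by now apply gb2_scal.
  assert (Hav : 3.6 <= a * v0) by nra.
  set (q := exp (- (a * v0))). set (r := exp (- (a * v0 / 3))).
  assert (Hq : 0 < q <= 0.03).
  { split; [apply exp_pos|]. apply (exp_neg_bound 3.6); lra. }
  assert (Hr : 0 < r <= 0.4).
  { split; [apply exp_pos|]. apply (exp_neg_bound 1.2); lra. }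
  assert (Bd : forall k l, -1 * Ht a v0 k l <= 1 * exp (- (a * v0 * IZR (hexf k l)))).
  { intros k l. assert (H1 := Ht_abs_le a v0 k l ltac:(lra) ltac:(lra)).
    apply Rabs_le_between in H1. lra. }
  assert (M := hat_shells (fun k l => -1 * Ht a v0 k l) (q ^ 3) (q ^ 4) 1 (a * v0) Gf ltac:(lra) ltac:(lra)).
  fold r in M.
  replace (exp (- (5 * (a * v0)))) with (q ^ 5) in M by (unfold q; rewrite exp_mult_nat; f_equal; simpl; ring).
  rewrite zsum2_scal in M.
  replace (lsum hex7 (fun k l => -1 * Ht a v0 k l)) with (-1 * lsum hex7 (Ht a v0)) in M
    by (unfold lsum, hex7; cbn [fold_right fst snd]; ring).
  rewrite hat_first_shell_v0 in M. fold q in M.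
  assert (M' : -1 * zsum2 (Ht a v0) <= -1 * (1 - 3 * q) + (6 * q ^ 3 + 6 * q ^ 4 + 1 * q ^ 5 * ((1 + r) / (1 - r)) ^ 2)).
  { apply M.
    - intros k l _ E. eapply Rle_trans; [apply Bd|]. rewrite E. right. unfold q. rewrite exp_mult_nat, Rmult_1_l.
      f_equal. simpl. ring.
    - intros k l _ E. eapply Rle_trans; [apply Bd|]. rewrite E. right. unfold q. rewrite exp_mult_nat, Rmult_1_l.
      f_equal. simpl. ring.
    - intros k l _. apply Bd. }
  assert (Q3 : q ^ 3 <= 0.03 ^ 3) by (apply pow_incr; lra).
  assert (Q4 : q ^ 4 <= 0.03 ^ 4) by (apply pow_incr; lra).
  assert (Q5 : q ^ 5 <= 0.03 ^ 5) by (apply pow_incr; lra).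
  assert (Q5' : 0 <= q ^ 5) by (apply pow_le; lra).
  assert (HG : 0 <= ((1 + r) / (1 - r)) ^ 2 <= 9).
  { split; [apply pow2_ge_0|]. replace 9 with (3 ^ 2) by ring. apply pow_incr. split.
    - apply Rdiv_le_0_compat; lra. - apply Rle_div_l; lra. }
  assert (q ^ 5 * ((1 + r) / (1 - r)) ^ 2 <= 0.03 ^ 5 * 9) by (apply Rmult_le_compat; lra).
  lra.
Qed.

(** * Symmetries and first variation of the twisted sum *)

Definition tri (k l : Z) : R := 2 * PI / 3 * (IZR k - IZR l).
Definition Gcos (a : R) (k l : Z) : R := Ge a v0 k l * cos (tri k l).
Definition Gsin (a : R) (k l : Z) : R := Ge a v0 k l * sin (tri k l).

Lemma gb2_Gcos a : 0 < a -> gb2 (Gcos a).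
Proof.
  intros Ha. assert (B := v0_bounds).
  apply (gb2_le _ (Ge a v0)); [apply gb2_Ge; lra|]. intros k l. apply Rabs_exp_cos.
Qed.

Lemma gb2_Gsin a : 0 < a -> gb2 (Gsin a).
Proof.
  intros Ha. assert (B := v0_bounds).
  apply (gb2_le _ (Ge a v0)); [apply gb2_Ge; lra|]. intros k l. unfold Gsin.
  rewrite <- cos_shift. apply Rabs_exp_cos.
Qed.

Lemma Gcos_swap a k l : Gcos a l k = Gcos a k l.
Proof.
  unfold Gcos, tri. rewrite !Ge_v0. replace (hexf l k) with (hexf k l) by (unfold hexf; ring).
  f_equal. rewrite <- cos_neg. f_equal. ring.
Qed.

Lemma Gsin_swap a k l : Gsin a l k = - Gsin a k l.
Proof.
  unfold Gsin, tri. rewrite !Ge_v0. replace (hexf l k) with (hexf k l) by (unfold hexf; ring).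
  match goal with |- _ = - (?e * ?s) => replace (- (e * s)) with (e * - s) by ring end.
  rewrite <- sin_neg. do 2 f_equal. ring.
Qed.

(** The reflection maps [k - l] to [- (k - l) + 3 k], so the phase changes sign modulo [2 * PI]. *)
Lemma Gcos_reflect a k l : Gcos a k (- k - l) = Gcos a k l.
Proof.
  unfold Gcos, tri. rewrite !Ge_v0. replace (hexf k (- k - l)) with (hexf k l) by (unfold hexf; ring).
  f_equal. rewrite <- cos_neg, <- (cos_2PI_Z _ k), minus_IZR, opp_IZR. f_equal. field.
Qed.

Lemma Gsin_reflect a k l : Gsin a k (- k - l) = - Gsin a k l.
Proof.
  unfold Gsin, tri. rewrite !Ge_v0. replace (hexf k (- k - l)) with (hexf k l) by (unfold hexf; ring).
  match goal with |- _ = - (?e * ?s) => replace (- (e * s)) with (e * - s) by ring end.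
  rewrite <- sin_neg, <- (sin_2PI_Z (- _) k), minus_IZR, opp_IZR. do 2 f_equal. field.
Qed.

Lemma zsum2_reflect f : gb2 f -> zsum2 (fun k l => f k (- k - l)%Z) = zsum2 f.
Proof.
  intros Hf. apply (zsum2_inner (fun k l => (- k - l)%Z)); [|assumption].
  intros k g Hg. now apply zsum_reflect.
Qed.

(** The swap equates the moments of [k ^ 2] and [l ^ 2]; the reflection makes the mixed moment minus
    half of them. The stated combination then cancels. *)
Lemma gcos_variation a : 0 < a ->
  zsum2 (fun k l => (- (IZR k ^ 2 + IZR k * IZR l) + IZR l ^ 2 / 2) * Gcos a k l) = 0.
Proof.
  intros Ha. assert (G := gb2_Gcos a Ha).
  set (A := fun k l => IZR k * (IZR k * Gcos a k l)).
  set (B := fun k l => IZR k * (IZR l * Gcos a k l)).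
  set (D := fun k l => IZR l * (IZR l * Gcos a k l)).
  assert (GA : gb2 A) by now apply gb2_mul_l, gb2_mul_l.
  assert (GB : gb2 B) by now apply gb2_mul_l, gb2_mul_r.
  assert (GD : gb2 D) by now apply gb2_mul_r, gb2_mul_r.
  assert (E1 : zsum2 D = zsum2 A).
  { rewrite (zsum2_swap D GD). apply zsum2_ext. intros k l. unfold A, D. now rewrite Gcos_swap. }
  assert (E2 : zsum2 D = zsum2 A + 2 * zsum2 B + zsum2 D).
  { rewrite <- (zsum2_reflect D GD) at 1.
    rewrite (zsum2_ext _ (fun k l => (A k l + 2 * B k l) + D k l)).
    - rewrite zsum2_plus, zsum2_plus, zsum2_scal; try assumption; try (now apply gb2_scal); [reflexivity|].
      apply gb2_plus; [assumption | now apply gb2_scal].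
    - intros k l. unfold D, A, B. rewrite Gcos_reflect, minus_IZR, opp_IZR. ring. }
  rewrite (zsum2_ext _ (fun k l => -1 * (A k l + B k l) + / 2 * D k l)).
  - rewrite zsum2_plus, !zsum2_scal, zsum2_plus; try assumption; try (now apply gb2_scal).
    + lra.
    + now apply gb2_scal, gb2_plus.
  - intros k l. unfold A, B, D. field.
Qed.

(** [Gsin] is odd under the reflection, which fixes [k], so the first moment in [k] vanishes; the
    swap carries this over to [l]. *)
Lemma gsin_variation a : 0 < a -> zsum2 (fun k l => (IZR k + IZR l / 2) * Gsin a k l) = 0.
Proof.
  intros Ha. assert (G := gb2_Gsin a Ha).
  set (I := fun k l => IZR k * Gsin a k l). set (J := fun k l => IZR l * Gsin a k l).
  assert (GI : gb2 I) by now apply gb2_mul_l. assert (GJ : gb2 J) by now apply gb2_mul_r.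
  assert (E1 : zsum2 I = - zsum2 I).
  { rewrite <- (zsum2_reflect I GI) at 1. replace (- zsum2 I) with (-1 * zsum2 I) by ring.
    rewrite <- zsum2_scal. apply zsum2_ext. intros k l. unfold I. rewrite Gsin_reflect. ring. }
  assert (E2 : zsum2 J = - zsum2 I).
  { rewrite (zsum2_swap J GJ). replace (- zsum2 I) with (-1 * zsum2 I) by ring.
    rewrite <- zsum2_scal. apply zsum2_ext. intros k l. unfold I, J. rewrite Gsin_swap. ring. }
  rewrite (zsum2_ext _ (fun k l => I k l + / 2 * J k l)).
  - rewrite zsum2_plus, zsum2_scal by (assumption || now apply gb2_scal). lra.
  - intros k l. unfold I, J. field.
Qed.

(* First variation of the twisted sum: of the two edge lengths and of the point b. *)
Definition hat_lin (a v : R) (k l : Z) : R :=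
  - (a * (v0 - v)) * ((- (IZR k ^ 2 + IZR k * IZR l) + IZR l ^ 2 / 2) * Gcos a k l)
  + - (2 * PI * (bv v - 1 / 3)) * ((IZR k + IZR l / 2) * Gsin a k l).

Lemma hat_lin_sum a v : 0 < a -> gb2 (hat_lin a v) /\ zsum2 (hat_lin a v) = 0.
Proof.
  intros Ha. assert (GC := gb2_Gcos a Ha). assert (GS := gb2_Gsin a Ha).
  assert (G1 : gb2 (fun k l => (- (IZR k ^ 2 + IZR k * IZR l) + IZR l ^ 2 / 2) * Gcos a k l)).
  { apply (gb2_ext (fun k l => -1 * (IZR k * (IZR k * Gcos a k l) + IZR k * (IZR l * Gcos a k l))
       + / 2 * (IZR l * (IZR l * Gcos a k l)))).
    - intros k l. field.
    - apply gb2_plus; apply gb2_scal.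
      + apply gb2_plus; [now apply gb2_mul_l, gb2_mul_l | now apply gb2_mul_l, gb2_mul_r].
      + now apply gb2_mul_r, gb2_mul_r. }
  assert (G2 : gb2 (fun k l => (IZR k + IZR l / 2) * Gsin a k l)).
  { apply (gb2_ext (fun k l => IZR k * Gsin a k l + / 2 * (IZR l * Gsin a k l))).
    - intros k l. field.
    - apply gb2_plus; [now apply gb2_mul_l | now apply gb2_scal, gb2_mul_r]. }
  split.
  - apply gb2_plus; now apply gb2_scal.
  - unfold hat_lin. rewrite zsum2_plus, !zsum2_scal, gcos_variation, gsin_variation by (assumption || now apply gb2_scal).
    ring.
Qed.

(** The first shell is itself invariant under the symmetries. Hence the linear part may be
    subtracted outside it while the first shell is still compared exactly. *)
Lemma hat_lin_first_shell a v : lsum hex7 (hat_lin a v) = 0.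
Proof.
  unfold lsum, hex7, hat_lin, Gcos, Gsin. cbn [fold_right fst snd]. rewrite !Ge_v0. unfold hexf. simpl Z.mul. simpl Z.add.
  unfold tri. set (T := 2 * PI / 3).
  replace (T * (0 - 0)) with 0 by ring.
  replace (T * (1 - 0)) with T by ring. replace (T * (-1 - 0)) with (- T) by ring.
  replace (T * (0 - 1)) with (- T) by ring. replace (T * (0 - -1)) with T by ring.
  replace (T * (1 - -1)) with (- T + 2 * PI * IZR 1) by (unfold T; simpl; field).
  replace (T * (-1 - 1)) with (T + 2 * PI * IZR (-1)) by (unfold T; simpl; field).
  rewrite !cos_2PI_Z, !sin_2PI_Z, !cos_neg, !sin_neg. simpl. field.
Qed.

Lemma Rabs_sin_le_abs x : Rabs (sin x) <= Rabs x.
Proof.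
  destruct (Rtotal_order x 0) as [H|[->|H]].
  - rewrite <- (Rabs_Ropp x), <- (Rabs_Ropp (sin x)), <- sin_neg. apply Rabs_le.
    rewrite (Rabs_pos_eq (- x)) by lra. generalize (sin_lt_x (- x) ltac:(lra)) (SIN_bound (- x)). intros.
    split; [|lra]. destruct (Rle_lt_dec (- x) PI).
    + generalize (sin_ge_0 (- x)). lra.
    + generalize PI_gt_3. lra.
  - rewrite sin_0. lra.
  - apply Rabs_le. rewrite (Rabs_pos_eq x) by lra. generalize (sin_lt_x x H) (SIN_bound x). intros.
    split; [|lra]. destruct (Rle_lt_dec x PI).
    + generalize (sin_ge_0 x). lra.
    + generalize PI_gt_3. lra.
Qed.

Lemma one_minus_cos_le x : 0 <= 1 - cos x <= x ^ 2 / 2.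
Proof.
  split; [generalize (COS_bound x); lra|].
  replace x with (2 * (x / 2)) at 1 by field. rewrite cos_2a_sin.
  assert (H := Rabs_sin_le_abs (x / 2)).
  assert (Rabs (sin (x / 2)) ^ 2 <= Rabs (x / 2) ^ 2) by (apply pow_incr; split; [apply Rabs_pos | assumption]).
  rewrite !pow2_abs in H0. replace (1 - (1 - 2 * sin (x / 2) * sin (x / 2))) with (2 * sin (x / 2) ^ 2) by ring. lra.
Qed.

Lemma sin_minus_id x : Rabs (sin x - x) <= x ^ 2 / 2.
Proof.
  assert (P : forall y, 0 <= y -> Rabs (sin y - y) <= y ^ 2 / 2).
  { intros y Hy. apply Rabs_le. split.
    - destruct (Rle_lt_dec y 3).
      + assert (T := sin_taylor3_le y ltac:(lra)). assert (0 <= y ^ 2 * (3 - y)) by (apply Rmult_le_pos; [apply pow2_ge_0|lra]). lra.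
      + generalize (SIN_bound y). nra.
    - generalize (Rabs_sin_le_abs y) (Rle_abs (sin y)) (pow2_ge_0 y). rewrite (Rabs_pos_eq y) by assumption. lra. }
  destruct (Rle_lt_dec 0 x); [now apply P|].
  assert (H := P (- x) ltac:(lra)). rewrite sin_neg in H.
  rewrite <- Rabs_Ropp. replace (- (sin x - x)) with (- sin x - - x) by ring.
  replace (x ^ 2) with ((- x) ^ 2) by ring. exact H.
Qed.

(** [mu] is meant to be the part of [s] linear in the deformation; keeping it apart from [s] leaves
    the linear term summable to zero and moves the curvature of [wv] into [|s - mu|]. *)
Lemma exp_cos_expansion s mu th eta :
  Rabs (exp (- s) * cos (th + eta) - cos th + mu * cos th + eta * sin th)
  <= (s ^ 2 / 2) * Rmax 1 (exp (- s)) + eta ^ 2 + Rabs s * Rabs eta + Rabs (s - mu).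
Proof.
  replace (exp (- s) * cos (th + eta) - cos th + mu * cos th + eta * sin th)
    with ((exp (- s) - 1 + s) * cos (th + eta) + (- s * (cos (th + eta) - cos th)
      + ((cos th * (cos eta - 1) - sin th * (sin eta - eta)) + - ((s - mu) * cos th))))
    by (rewrite cos_plus; ring).
  assert (Cb := Rabs_cos_le1). assert (Sb : forall x, Rabs (sin x) <= 1) by (intros x; apply Rabs_le; generalize (SIN_bound x); lra).
  assert (E1 : Rabs (exp (- s) - 1 + s) <= (s ^ 2 / 2) * Rmax 1 (exp (- s))).
  { assert (L := exp_ineq1_le (- s)). assert (U := exp_second_order (- s)).
    rewrite Rabs_pos_eq by lra.
    replace ((- s) ^ 2) with (s ^ 2) in U by ring. assert (0 <= s ^ 2 / 2) by (generalize (pow2_ge_0 s); lra).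
    assert ((s ^ 2 / 2) * (if Rle_dec 0 (- s) then exp (- s) else 1) <= (s ^ 2 / 2) * Rmax 1 (exp (- s))).
    { apply Rmult_le_compat_l; [assumption|]. destruct (Rle_dec 0 (- s)); [apply Rmax_r | apply Rmax_l]. }
    lra. }
  assert (E2 : Rabs (cos (th + eta) - cos th) <= Rabs eta).
  { rewrite form2. replace ((th + eta - th) / 2) with (eta / 2) by field.
    rewrite !Rabs_mult. rewrite (Rabs_left (-2)) by lra.
    assert (H := Rabs_sin_le_abs (eta / 2)). rewrite Rabs_div, (Rabs_pos_eq 2) in H by lra.
    assert (H2 := Sb ((th + eta + th) / 2)). generalize (Rabs_pos (sin (eta / 2))) (Rabs_pos (sin ((th + eta + th) / 2))). nra. }
  assert (E3 : Rabs (cos th * (cos eta - 1) - sin th * (sin eta - eta)) <= eta ^ 2).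
  { unfold Rminus at 1. eapply Rle_trans; [apply Rabs_triang|]. rewrite Rabs_Ropp, !Rabs_mult.
    assert (H1 := one_minus_cos_le eta). assert (H2 := sin_minus_id eta).
    assert (H3 : Rabs (cos eta - 1) <= eta ^ 2 / 2) by (rewrite Rabs_left1; lra).
    generalize (Cb th) (Sb th) (Rabs_pos (cos th)) (Rabs_pos (sin th)) (Rabs_pos (cos eta - 1)) (Rabs_pos (sin eta - eta)). nra. }
  eapply Rle_trans; [apply Rabs_triang|]. rewrite !Rplus_assoc. apply Rplus_le_compat.
  - rewrite Rabs_mult. generalize (Cb (th + eta)) (Rabs_pos (exp (- s) - 1 + s)) (Rabs_pos (cos (th + eta))). nra.
  - eapply Rle_trans; [apply Rabs_triang|]. 
    assert (Rabs (- s * (cos (th + eta) - cos th)) <= Rabs s * Rabs eta).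
    { rewrite Rabs_mult, Rabs_Ropp. apply Rmult_le_compat_l; [apply Rabs_pos | assumption]. }
    assert (Rabs (- ((s - mu) * cos th)) <= Rabs (s - mu)).
    { rewrite Rabs_Ropp, Rabs_mult. generalize (Cb th) (Rabs_pos (s - mu)) (Rabs_pos (cos th)). nra. }
    generalize (Rabs_triang (cos th * (cos eta - 1) - sin th * (sin eta - eta)) (- ((s - mu) * cos th))). lra.
Qed.

(** With [h = v0 - v] and [z = a * h], each of the four errors in [exp_cos_expansion] is a multiple
    of [(z * n) ^ 2] for [n = hexf k l]; their sum stays below 1.2. *)
Lemma hat_remainder a v k l : 3.14 <= a -> 1.05 <= v <= v0 -> (3 <= hexf k l)%Z ->
  Ht a v k l - Ht a v0 k l - hat_lin a v k l
  <= 1.2 * (a * (v0 - v)) ^ 2 * (IZR (hexf k l) ^ 2 * exp (- (a * v * IZR (hexf k l)))).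
Proof.
  intros Ha Hv Hn. assert (B := v0_bounds). assert (B2 := v0_sqr). assert (PB := PI_bounds).
  set (h := v0 - v). set (z := a * h). assert (Hh : 0 <= h <= 0.1048) by (unfold h; lra).
  assert (Hz : 0 <= z) by (apply Rmult_le_pos; lra).
  set (n := IZR (hexf k l)). assert (Hn3 : 3 <= n) by (apply IZR_le in Hn; exact Hn).
  set (K := IZR k ^ 2 + IZR k * IZR l). set (L := IZR l ^ 2). set (m := IZR k + IZR l / 2).
  assert (En : n = K + L) by (unfold n, K, L, hexf; rewrite !plus_IZR, !mult_IZR; ring).
  assert (Em : n = m ^ 2 + 3 / 4 * L) by (rewrite En; unfold K, L, m; field).
  assert (HL : 0 <= L) by apply pow2_ge_0.
  assert (Hm2 := pow2_ge_0 m).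
  (* [wv v = v0 + h / 2 + g * h] holds exactly, so [g] carries everything beyond the tangent. *)
  set (g := 3 / 4 * h / v). assert (Hg : 0 <= g <= 0.075).
  { unfold g. split; [apply Rdiv_le_0_compat; lra | apply Rle_div_l; lra]. }
  set (s := z * (- K + (1 / 2 + g) * L)). set (mu := z * (- K + L / 2)).
  set (eta := 2 * PI * (bv v - 1 / 3) * m).
  assert (Ew : wv v = v0 + (1 / 2 + g) * h).
  { unfold wv, g, h. apply Rmult_eq_reg_l with v; [|lra].
    replace (v * (v0 + (1 / 2 + 3 / 4 * (v0 - v) / v) * (v0 - v)))
      with (3 / 4 * v0 ^ 2 + v ^ 2 / 4) by (field; lra).
    rewrite B2. field. lra. }
  assert (ES : Ge a v k l = Ge a v0 k l * exp (- s)).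
  { rewrite Ge_v0. unfold Ge. rewrite <- exp_plus. f_equal. fold n. rewrite En, Ew.
    replace (IZR (Kh k l)) with K by (unfold Kh, K; rewrite mult_IZR, plus_IZR; ring).
    replace (IZR (l * l)) with L by (unfold L; rewrite mult_IZR; ring).
    unfold s, z, h. ring. }
  assert (EQ : Ht a v k l - Ht a v0 k l - hat_lin a v k l
     = Ge a v0 k l * (exp (- s) * cos (tri k l + eta) - cos (tri k l) + mu * cos (tri k l) + eta * sin (tri k l))).
  { unfold Ht, hat_lin, Gcos, Gsin. rewrite ES, phase_v0. fold h z. fold (tri k l).
    replace (phase v k l) with (tri k l + eta) by (unfold phase, tri, eta, m; ring).
    fold K L m. unfold eta, mu. field. }
  rewrite EQ.
  assert (P0 : 0 < Ge a v0 k l) by apply exp_pos.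
  assert (X := exp_cos_expansion s mu (tri k l) eta).
  apply Rle_trans with (Ge a v0 k l * ((s ^ 2 / 2) * Rmax 1 (exp (- s)) + eta ^ 2 + Rabs s * Rabs eta + Rabs (s - mu))).
  { apply Rmult_le_compat_l; [lra|]. eapply Rle_trans; [apply Rle_abs | exact X]. }
  (* [- K + L / 2 = 3/2 * L - n] lies between [- n] and [n] because [L <= 4/3 * n]; the term with
     [g] adds at most [0.1 * n]. *)
  assert (Hs : Rabs s <= 1.1 * (z * n)).
  { unfold s. rewrite Rabs_mult, (Rabs_pos_eq z) by assumption.
    replace (1.1 * (z * n)) with (z * (1.1 * n)) by ring. apply Rmult_le_compat_l; [assumption|].
    assert (HgL : 0 <= g * L <= 0.075 * L) by (split; [apply Rmult_le_pos | apply Rmult_le_compat_r]; lra).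
    apply Rabs_le. split; lra. }
  assert (Hsm : Rabs (s - mu) <= 0.102 * (z * n) ^ 2).
  { replace (s - mu) with (z * (g * L)) by (unfold s, mu; field).
    rewrite Rabs_pos_eq by (apply Rmult_le_pos; [assumption | apply Rmult_le_pos; lra]).
    assert (Hg' : g <= 0.2276 * z).
    { unfold g, z. apply Rle_trans with (3 / 4 * h / 1.05).
      - unfold Rdiv. apply Rmult_le_compat_l; [lra|]. apply Rinv_le_contravar; lra.
      - assert (3.14 * h <= a * h) by (apply Rmult_le_compat_r; lra). lra. }
    assert (HLn : L <= 4 / 9 * n ^ 2) by nra.
    apply Rle_trans with (z * (0.2276 * z * (4 / 9 * n ^ 2))).
    - apply Rmult_le_compat_l; [assumption|]. apply Rmult_le_compat; lra.
    - assert (0 <= z ^ 2 * n ^ 2) by (apply Rmult_le_pos; apply pow2_ge_0). 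
      replace ((z * n) ^ 2) with (z ^ 2 * n ^ 2) by ring. lra. }
  assert (Heta : Rabs eta <= 0.334 * (z * n)).
  { unfold eta. rewrite Rabs_mult.
    assert (Hb : 0 <= 2 * PI * (bv v - 1 / 3) <= 0.578 * z).
    { replace (bv v - 1 / 3) with (h * (v0 + v) / 8) by (unfold bv, h; replace (1 / 2) with (1 / 3 + 1 / 8 * (4 / 3)) by field; rewrite <- B2; field).
      split.
      - assert (0 <= h * (v0 + v)) by (apply Rmult_le_pos; lra). assert (0 <= PI * (h * (v0 + v))) by (apply Rmult_le_pos; lra). lra.
      - apply Rle_trans with (h * 1.8145).
        + replace (2 * PI * (h * (v0 + v) / 8)) with (h * (PI * (v0 + v) / 4)) by field.
          apply Rmult_le_compat_l; [lra|].
          assert (PI * (v0 + v) <= 3.142 * (2 * 1.1548)) by (apply Rmult_le_compat; lra). lra.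
        + unfold z. assert (3.14 * h <= a * h) by (apply Rmult_le_compat_r; lra). lra. }
    rewrite (Rabs_pos_eq (2 * PI * (bv v - 1 / 3))) by lra.
    (* [m ^ 2 <= n] and [n >= 3], hence [|m| <= n / sqrt 3]. *)
    assert (Hmn : Rabs m <= 0.5774 * n).
    { apply Rsqr_incr_0_var; [|lra]. rewrite <- Rsqr_abs. unfold Rsqr.
      nra. }
    apply Rle_trans with (0.578 * z * (0.5774 * n)).
    - apply Rmult_le_compat; try lra. apply Rabs_pos.
    - assert (0 <= z * n) by (apply Rmult_le_pos; lra). lra. }
  set (zn := z * n) in *.
  assert (S2 : s ^ 2 <= 1.21 * zn ^ 2).
  { rewrite <- pow2_abs. replace (1.21 * zn ^ 2) with ((1.1 * zn) ^ 2) by (rewrite Rpow_mult_distr; lra).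
    apply pow_incr. split; [apply Rabs_pos | assumption]. }
  assert (Et2 : eta ^ 2 <= 0.111556 * zn ^ 2).
  { rewrite <- pow2_abs. replace (0.111556 * zn ^ 2) with ((0.334 * zn) ^ 2) by (rewrite Rpow_mult_distr; lra).
    apply pow_incr. split; [apply Rabs_pos | assumption]. }
  assert (SE : Rabs s * Rabs eta <= 0.3674 * zn ^ 2).
  { replace (0.3674 * zn ^ 2) with (1.1 * zn * (0.334 * zn)) by lra.
    apply Rmult_le_compat; try apply Rabs_pos; assumption. }
  assert (HM1 := Rmax_l 1 (exp (- s))).
  set (M := Rmax 1 (exp (- s))) in *.
  assert (HGM : Ge a v0 k l * M <= exp (- (a * v * n))).
  { unfold M. apply Rmax_case.
    - rewrite Rmult_1_r, Ge_v0. fold n. apply exp_le.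
      assert (0 <= a * (h * n)) by (repeat apply Rmult_le_pos; lra). unfold h in *. lra.
    - rewrite <- ES. apply Ge_le; lra. }
  (* [1.21 / 2] from the exponential and [0.111556 + 0.3674 + 0.102] from the other terms give less
     than 1.2. *)
  apply Rle_trans with (Ge a v0 k l * M * (1.2 * zn ^ 2)).
  - rewrite Rmult_assoc. apply Rmult_le_compat_l; [lra|].
    assert (Pz := pow2_ge_0 zn).
    assert (eta ^ 2 + Rabs s * Rabs eta + Rabs (s - mu) <= M * (0.580956 * zn ^ 2)).
    { apply Rle_trans with (1 * (0.580956 * zn ^ 2)); [lra|]. apply Rmult_le_compat_r; lra. }
    assert (s ^ 2 / 2 * M <= M * (0.605 * zn ^ 2)).
    { rewrite Rmult_comm. apply Rmult_le_compat_l; lra. }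
    assert (0 <= M * zn ^ 2) by (apply Rmult_le_pos; lra). lra.
  - replace (1.2 * z ^ 2 * (n ^ 2 * exp (- (a * v * n)))) with (exp (- (a * v * n)) * (1.2 * zn ^ 2)) by (unfold zn; ring).
    apply Rmult_le_compat_r; [generalize (pow2_ge_0 zn); lra | assumption].
Qed.

(** The coefficient 2 has to stay below the 2.5 that [Rm_near] provides for the first shell; the
    common factor [exp (- (a * v))] then drops out. *)
Lemma hat_near a v : 3.14 <= a -> 1.05 <= v <= v0 ->
  zsum2 (Ht a v) - zsum2 (Ht a v0) <= - (exp (- (a * v)) * Rm a v) + exp (- (a * v)) * (2 * (v0 - v) ^ 2).
Proof.
  intros Ha Hv.
  assert (G := gb2_Ht a v ltac:(lra) ltac:(lra)). assert (G0 := gb2_Ht a v0 ltac:(lra) ltac:(lra)).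
  destruct (hat_lin_sum a v ltac:(lra)) as [GL EL].
  set (f := fun k l => Ht a v k l + (-1 * Ht a v0 k l + -1 * hat_lin a v k l)).
  assert (Gf : gb2 f) by (apply gb2_plus; [assumption | apply gb2_plus; now apply gb2_scal]).
  replace (zsum2 (Ht a v) - zsum2 (Ht a v0)) with (zsum2 f).
  2:{ unfold f. rewrite zsum2_plus, zsum2_plus, !zsum2_scal, EL; try assumption; try (now apply gb2_scal); [ring|].
      apply gb2_plus; now apply gb2_scal. }
  set (h := v0 - v). set (D := 1.2 * (a * h) ^ 2). assert (HD : 0 <= D) by (unfold D; generalize (pow2_ge_0 (a * h)); lra).
  assert (Bd : forall k l, (3 <= hexf k l)%Z -> f k l <= D * (IZR (hexf k l) ^ 2 * exp (- (a * v * IZR (hexf k l))))).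
  { intros k l Hn. assert (R := hat_remainder a v k l Ha Hv Hn). fold h D in R. unfold f. lra. }
  (* The part [2 / 7] of the rate pays for [n ^ 2]: from [n / 7 <= exp ((n - 7) / 7)] follows
     [n ^ 2 <= 49 * exp (2 / 7 * (n - 7))]. *)
  set (q := exp (- (a * v))). set (p := a * v - 2 / 7).
  assert (Hav : 3.297 <= a * v) by nra.
  assert (Hp : 3.01 <= p) by (unfold p; lra).
  set (r := exp (- (p / 3))).
  eapply Rle_trans; [apply (hat_shells f (D * (9 * q ^ 3)) (D * (16 * q ^ 4)) (D * (49 * exp (- 2))) p); try assumption; try lra|].
  - apply Rmult_le_pos; [assumption|]. generalize (exp_pos (- 2)). lra.
  - intros k l _ E. eapply Rle_trans; [apply Bd; lia|]. rewrite E. right. unfold q. rewrite exp_mult_nat.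
    f_equal. simpl. replace ((1 + 1 + 1) * - (a * v)) with (- (a * v * 3)) by ring. ring.
  - intros k l _ E. eapply Rle_trans; [apply Bd; lia|]. rewrite E. right. unfold q. rewrite exp_mult_nat.
    f_equal. simpl. replace ((1 + 1 + 1 + 1) * - (a * v)) with (- (a * v * 4)) by ring. ring.
  - intros k l Hn. eapply Rle_trans; [apply Bd; lia|].
    rewrite (Rmult_assoc D). apply Rmult_le_compat_l; [assumption|].
    apply IZR_le in Hn. set (n := IZR (hexf k l)) in *.
    assert (n ^ 2 <= 49 * exp (2 / 7 * (n - 7))).
    { replace (2 / 7 * (n - 7)) with ((n - 7) / 7 + (n - 7) / 7) by field. rewrite exp_plus.
      assert (E := exp_ineq1_le ((n - 7) / 7)).
      assert (n * n <= (7 * exp ((n - 7) / 7)) * (7 * exp ((n - 7) / 7))) by (apply Rmult_le_compat; lra). lra. }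
    apply Rle_trans with (49 * exp (2 / 7 * (n - 7)) * exp (- (a * v * n))).
    + apply Rmult_le_compat_r; [left; apply exp_pos | assumption].
    + rewrite !Rmult_assoc, <- !exp_plus. apply Rmult_le_compat_l; [lra|]. apply exp_le. unfold p. lra.
  - replace (lsum hex7 f) with (- (q * Rm a v)).
    2:{ unfold q. rewrite <- hat_first_shell_diff by lra.
        assert (Z0 := hat_lin_first_shell a v). unfold f, lsum, hex7 in *. cbn [fold_right fst snd] in *. lra. }
    apply Rplus_le_compat_l. fold r.
    assert (Hq : 0 < q <= 0.0371).
    { split; [apply exp_pos|]. apply (exp_neg_bound 3.297); lra. }
    assert (Haq : a * q <= 3.14 * 0.0371).
    { apply Rle_trans with (a * exp (- (1.05 * a))).
      - apply Rmult_le_compat_l; [lra|]. apply exp_le. nra.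
      - eapply Rle_trans; [apply mult_exp_decreasing with (a0 := 3.14); lra|].
        apply Rmult_le_compat_l; [lra|]. apply (exp_neg_bound 3.297); lra. }
    assert (Hr : 0 < r <= 0.37).
    { split; [apply exp_pos|]. apply (exp_neg_bound 1.003); lra. }
    assert (HG : 0 <= ((1 + r) / (1 - r)) ^ 2 <= 5).
    { split; [apply pow2_ge_0|]. apply Rle_trans with (2.2 ^ 2); [|lra]. apply pow_incr. split.
      - apply Rdiv_le_0_compat; lra. - apply Rle_div_l; lra. }
    assert (He5 : exp (- (5 * p)) = q ^ 5 * exp (10 / 7)).
    { unfold q. rewrite exp_mult_nat, <- exp_plus. f_equal. unfold p. simpl. field. }
    assert (He2 : exp (- 2) * exp (10 / 7) <= 1).
    { rewrite <- exp_plus, <- exp_0. apply exp_le. lra. }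
    rewrite He5. set (GG := ((1 + r) / (1 - r)) ^ 2) in *.
    assert (0 <= a * q) by (apply Rmult_le_pos; lra).
    assert (Haq2 : (a * q) * (a * q) <= 0.0136).
    { apply Rle_trans with ((3.14 * 0.0371) * (3.14 * 0.0371)); [apply Rmult_le_compat; lra | lra]. }
    set (A := (a * q) * (a * q)) in *. assert (HA : 0 <= A) by (apply Rmult_le_pos; lra).
    assert (T1 : D * (49 * exp (-2)) * (q ^ 5 * exp (10 / 7)) * GG <= D * q ^ 5 * 245).
    { replace (D * (49 * exp (-2)) * (q ^ 5 * exp (10 / 7)) * GG)
        with ((D * q ^ 5) * (49 * ((exp (- 2) * exp (10 / 7)) * GG))) by ring.
      apply Rmult_le_compat_l; [apply Rmult_le_pos; [assumption | apply pow_le; lra]|].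
      assert (0 < exp (-2) * exp (10 / 7)) by (apply Rmult_lt_0_compat; apply exp_pos).
      assert (exp (-2) * exp (10 / 7) * GG <= 1 * 5) by (apply Rmult_le_compat; lra). lra. }
    apply Rle_trans with (6 * (D * (9 * q ^ 3)) + 6 * (D * (16 * q ^ 4)) + D * q ^ 5 * 245); [lra|].
    replace (6 * (D * (9 * q ^ 3)) + 6 * (D * (16 * q ^ 4)) + D * q ^ 5 * 245)
      with (q * (1.2 * h ^ 2 * (A * (54 + 96 * q + 245 * q ^ 2)))) by (unfold D, A; ring).
    apply Rmult_le_compat_l; [lra|].
    assert (q ^ 2 <= 0.0371 ^ 2) by (apply pow_incr; lra).
    assert (A * (54 + 96 * q + 245 * q ^ 2) <= 0.0136 * 60).
    { apply Rmult_le_compat; try lra. assert (0 <= q ^ 2) by apply pow2_ge_0. lra. }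
    assert (0 <= h ^ 2) by apply pow2_ge_0.
    assert (1.2 * h ^ 2 * (A * (54 + 96 * q + 245 * q ^ 2)) <= 1.2 * h ^ 2 * (0.0136 * 60)) by (apply Rmult_le_compat_l; lra).
    lra.
Qed.

(** * The change of the first dual shell *)

Lemma bernoulli_exp G s : 1 <= G -> 1 - exp (- (G * s)) <= G * (1 - exp (- s)).
Proof.
  intros HG.
  assert (E1 : exp (- s) * (1 - (G - 1) * s) <= exp (- (G * s))).
  { replace (- (G * s)) with (- s + - ((G - 1) * s)) by ring. rewrite exp_plus.
    apply Rmult_le_compat_l; [left; apply exp_pos|]. generalize (exp_ineq1_le (- ((G - 1) * s))). lra. }
  assert (E2 : exp (- s) * (1 + s) <= 1).
  { apply Rle_trans with (exp (- s) * exp s).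
    - apply Rmult_le_compat_l; [left; apply exp_pos | apply exp_ineq1_le].
    - rewrite <- exp_plus, Rplus_opp_l, exp_0. lra. }
  assert ((G - 1) * (exp (- s) * (1 + s)) <= (G - 1) * 1) by (apply Rmult_le_compat_l; lra). lra.
Qed.

Lemma exp_neg_le4 q : 0 <= q -> exp (- q) <= 1 - q + q ^ 2 / 2 - q ^ 3 / 6 + q ^ 4 / 24.
Proof.
  intros [Hq| <-].
  2:{ rewrite Ropp_0, exp_0. lra. }
  destruct (MVT_cor2 (fun s => (1 - s + s ^ 2 / 2 - s ^ 3 / 6 + s ^ 4 / 24) - exp (- s))
    (fun s => (- 1 + s - s ^ 2 / 2 + s ^ 3 / 6) + exp (- s)) 0 q Hq) as [c [E Hc]].
  - intros c Hc. apply is_derive_Reals. auto_derive; [trivial|]. field.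
  - cbv beta in E. rewrite Ropp_0, exp_0 in E.
    assert (B := exp_neg_ge3 c ltac:(lra)).
    assert (0 <= (-1 + c - c ^ 2 / 2 + c ^ 3 / 6 + exp (- c)) * (q - 0)) by (apply Rmult_le_pos; lra).
    lra.
Qed.

Lemma cos_bv v : cos (PI * bv v) = sin (PI * v ^ 2 / 8).
Proof.
  rewrite <- cos_shift. f_equal. unfold bv. field.
Qed.

Lemma cos_bv_range v : 0 < v <= v0 -> 0 <= cos (PI * bv v) <= PI * v ^ 2 / 8.
Proof.
  intros Hv. assert (B2 := v0_sqr). assert (PB := PI_bounds). rewrite cos_bv.
  assert (0 < v ^ 2 <= 4 / 3).
  { split; [apply pow_lt; lra|]. rewrite <- B2. apply pow_incr. lra. }
  assert (0 < PI * v ^ 2 / 8) by (apply Rdiv_lt_0_compat; [apply Rmult_lt_0_compat|]; lra).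
  assert (PI * v ^ 2 / 8 <= PI) by nra.
  split; [apply sin_ge_0; lra|]. left. now apply sin_lt_x.
Qed.

(** The cosine equals [sin (PI * v ^ 2 / 8)], whose slope at [v0] is [PI / 4 < 0.786]; 0.69 allows
    for the curvature down to [v = 0.9]. *)
Lemma cos_bv_deficit v : 0.9 <= v <= v0 ->
  0.69 * (v0 - v) <= 1 / 2 - cos (PI * bv v) <= 0.786 * (v0 - v).
Proof.
  intros Hv. assert (B := v0_bounds). assert (B2 := v0_sqr). assert (PB := PI_bounds).
  set (h := v0 - v). assert (Hh : 0 <= h <= 0.2548) by (unfold h; lra).
  set (x := PI * (h * (v0 + v)) / 8).
  assert (Ex : PI * bv v = PI / 3 + x).
  { unfold x, bv, h. replace (1 / 2) with (1 / 3 + 1 / 8 * (4 / 3)) by field. rewrite <- B2. field. }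
  rewrite Ex, cos_plus, cos_PI3, sin_PI3.
  assert (S3 : 1.732 < sqrt 3 < 1.7321).
  { split; apply Rsqr_incrst_0; try apply sqrt_pos; try lra; rewrite Rsqr_sqrt by lra; unfold Rsqr; lra. }
  assert (Hx : 0.8066 * h <= x <= 0.9071 * h - 0.3926 * h ^ 2).
  { unfold x. replace (PI * (h * (v0 + v)) / 8) with (h * (PI * (v0 + v) / 8)) by field. split.
    - rewrite (Rmult_comm 0.8066). apply Rmult_le_compat_l; [lra|].
      assert (3.141 * (1.1547 + 0.9) <= PI * (v0 + v)) by (apply Rmult_le_compat; lra). lra.
    - replace (0.9071 * h - 0.3926 * h ^ 2) with (h * (0.9071 - 0.3926 * h)) by lra.
      apply Rmult_le_compat_l; [lra|]. replace (v0 + v) with (2 * v0 - h) by (unfold h; ring).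
      assert (PI * (2 * v0 - h) <= 3.142 * (2 * 1.1548 - h)) by (apply Rmult_le_compat; lra). lra. }
  assert (H2 := pow2_ge_0 h).
  assert (C1 := one_minus_cos_le x).
  assert (S1 := sin_taylor3_le x ltac:(lra)).
  assert (S2 : sin x <= x) by (generalize (Rabs_sin_le_abs x) (Rle_abs (sin x)); rewrite (Rabs_pos_eq x); lra).
  assert (X2 : x ^ 2 <= 0.83 * h ^ 2).
  { apply Rle_trans with ((0.9071 * h) ^ 2); [apply pow_incr; lra|]. rewrite Rpow_mult_distr. lra. }
  assert (X3 : x ^ 3 <= 0.054 * x).
  { replace (x ^ 3) with (x * x ^ 2) by ring. rewrite (Rmult_comm 0.054). apply Rmult_le_compat_l; [lra|].
    apply Rle_trans with (0.232 ^ 2); [apply pow_incr; lra | lra]. }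
  split.
  - assert (1.732 / 2 * (0.99 * x) <= sqrt 3 / 2 * sin x) by (apply Rmult_le_compat; lra). lra.
  -
    assert (sqrt 3 / 2 * sin x <= 1.7321 / 2 * x) by (apply Rmult_le_compat; lra). lra.
Qed.

(** With [h = v0 - v], the terms of first order in [h] cancel. Bernoulli's inequality replaces the
    exponent [G * z] by [3/2 * z]; what remains is [3 * ((1 - E) - 2/3 * P)], the correction
    [kappa * 2/3 * P] from cosine and curvature, and the loss [4 * zeta ^ 2]. *)
Lemma Rm_near a v : 3.14 <= a -> 0.9 <= v <= v0 -> 2.5 * (v0 - v) ^ 2 <= Rm a v.
Proof.
  intros Ha Hv. assert (B := v0_bounds). assert (B2 := v0_sqr).
  assert (Hd := cos_bv_deficit v Hv).
  unfold Rm. cbv zeta. set (c := cos (PI * bv v)) in *.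
  set (h := v0 - v) in *. assert (Hh : 0 <= h <= 0.2548) by (unfold h; lra).
  set (zeta := 1 / 2 - c) in *. assert (Ec : c = 1 / 2 - zeta) by (unfold zeta; ring).
  set (g := 3 / 4 * h / v). assert (Hg : 0 <= g <= 0.8334 * h).
  { unfold g. split; [apply Rdiv_le_0_compat; lra|]. apply Rle_div_l; [lra|].
    assert (0 <= h * (v - 0.9)) by (apply Rmult_le_pos; lra). lra. }
  set (G := 3 / 2 + g).
  assert (Ew : wv v - v = G * h).
  { unfold wv, G, g, h. apply Rmult_eq_reg_l with v; [|lra].
    replace (v * ((3 / 2 + 3 / 4 * (v0 - v) / v) * (v0 - v)))
      with (3 / 4 * v0 ^ 2 - 3 / 4 * v ^ 2) by (field; lra).
    rewrite B2. field. lra. }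
  rewrite Ew. set (z := a * h). set (z1 := 3.14 * h).
  assert (Hz : z1 <= z) by (apply Rmult_le_compat_r; lra).
  replace (a * (G * h)) with (G / (3 / 2) * (3 / 2 * z)) by (unfold z; field).
  assert (BG := bernoulli_exp (G / (3 / 2)) (3 / 2 * z) ltac:(unfold G; lra)).
  set (P := 1 - exp (- (3 / 2 * z))) in *. set (EG := exp (- (G / (3 / 2) * (3 / 2 * z)))) in *.
  set (E := exp (- z)).
  (* Chosen so that [4 * c * G = 3 - kappa - 4 * zeta * g], where 3 is the value at the hexagonal
     lattice. *)
  set (kappa := 6 * zeta - 2 * g).
  assert (Hk : 2.473 * h <= kappa) by (unfold kappa; lra).
  (* The lower bound is monotone in [z], so the worst case is [z1]. *)
  set (P1 := 1 - exp (- (3 / 2 * z1))). set (E1 := exp (- z1)).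
  assert (HP0 : 0 <= P1).
  { unfold P1. assert (exp (- (3 / 2 * z1)) <= exp 0) by (apply exp_le; unfold z1; lra). rewrite exp_0 in H. lra. }
  assert (HP : P1 <= P).
  { unfold P, P1. assert (exp (- (3 / 2 * z)) <= exp (- (3 / 2 * z1))) by (apply exp_le; lra). lra. }
  assert (Hpsi : (1 - E1) - 2 / 3 * P1 <= (1 - E) - 2 / 3 * P).
  { set (s := z - z1).
    assert (BS := bernoulli_exp (3 / 2) s ltac:(lra)).
    assert (X1 : E = E1 * exp (- s)) by (unfold E, E1, s; rewrite <- exp_plus; f_equal; ring).
    assert (X2 : exp (- (3 / 2 * z)) = exp (- (3 / 2 * z1)) * exp (- (3 / 2 * s)))
      by (unfold s; rewrite <- exp_plus; f_equal; ring).
    assert (X3 : exp (- (3 / 2 * z1)) <= E1) by (apply exp_le; unfold z1; lra).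
    assert (X4 : 0 <= 1 - exp (- (3 / 2 * s))).
    { assert (exp (- (3 / 2 * s)) <= exp 0) by (apply exp_le; unfold s; lra). rewrite exp_0 in H. lra. }
    unfold P, P1. rewrite X1, X2.
    assert (exp (- (3 / 2 * z1)) * (1 - exp (- (3 / 2 * s))) <= E1 * (3 / 2 * (1 - exp (- s)))).
    { apply Rmult_le_compat; try lra. left; apply exp_pos. }
    lra. }
  assert (Hz1 : 0 <= z1 <= 0.8001) by (unfold z1; lra).
  assert (TE := exp_neg_le4 z1 ltac:(lra)). fold E1 in TE.
  assert (TP := exp_neg_ge3 (3 / 2 * z1) ltac:(lra)).
  assert (TP' := exp_neg_le4 (3 / 2 * z1) ltac:(lra)).
  assert (Psi1 : z1 ^ 2 / 4 - 0.2084 * z1 ^ 3 - 0.0417 * z1 ^ 4 <= (1 - E1) - 2 / 3 * P1).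
  { unfold P1. assert (0 <= z1 ^ 3) by (apply pow_le; lra). lra. }
  assert (PP1 : z1 - 3 / 4 * z1 ^ 2 + 3 / 8 * z1 ^ 3 - 0.140625 * z1 ^ 4 <= 2 / 3 * P1) by (unfold P1; lra).
  assert (Main : - 4 * zeta ^ 2 + 3 * ((1 - E1) - 2 / 3 * P1) + kappa * (2 / 3 * P1)
      <= 2 - 4 * c ^ 2 + 4 * c * EG - 3 * E).
  { assert (c * (1 - EG) <= c * (G / (3 / 2) * P)) by (apply Rmult_le_compat_l; lra).
    assert (K : 4 * (c * G) <= 3 - kappa).
    { assert (0 <= zeta * g) by (apply Rmult_le_pos; lra). unfold kappa, G. rewrite Ec. lra. }
    assert (Q : 4 * (c * (G / (3 / 2) * P)) <= (3 - kappa) * (2 / 3 * P)).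
    { replace (4 * (c * (G / (3 / 2) * P))) with (4 * (c * G) * (2 / 3 * P)) by field.
      apply Rmult_le_compat_r; lra. }
    assert (kappa * (2 / 3 * P1) <= kappa * (2 / 3 * P)) by (apply Rmult_le_compat_l; lra).
    replace (2 - 4 * c ^ 2 + 4 * c * EG - 3 * E)
      with (- 4 * zeta ^ 2 - 4 * (c * (1 - EG)) + 3 * (1 - E)) by (unfold zeta; field). lra. }
  eapply Rle_trans; [|apply Main].
  assert (Z2 : zeta ^ 2 <= (0.786 * h) ^ 2) by (apply pow_incr; lra).
  assert (KP : 2.473 * h * (z1 - 3 / 4 * z1 ^ 2 + 3 / 8 * z1 ^ 3 - 0.140625 * z1 ^ 4) <= kappa * (2 / 3 * P1)).
  { apply Rle_trans with (2.473 * h * (2 / 3 * P1)).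
    - apply Rmult_le_compat_l; lra. - apply Rmult_le_compat_r; lra. }
  apply Rle_trans with (- 4 * (0.786 * h) ^ 2 + 3 * (z1 ^ 2 / 4 - 0.2084 * z1 ^ 3 - 0.0417 * z1 ^ 4)
     + 2.473 * h * (z1 - 3 / 4 * z1 ^ 2 + 3 / 8 * z1 ^ 3 - 0.140625 * z1 ^ 4)); [|lra].
  unfold z1.
  (* After [z1 = 3.14 * h] and subtraction of [2.5 * h ^ 2], the coefficients of the lower bound are
     rounded down to these. *)
  assert (Fact : 0 <= h ^ 2 * (10.1 - 37.7 * h + 16 * h ^ 2 - 34 * h ^ 3)).
  { apply Rmult_le_pos; [apply pow2_ge_0|].
    assert (h ^ 3 <= 0.2548 * h ^ 2).
    { replace (h ^ 3) with (h * h ^ 2) by ring. apply Rmult_le_compat_r; [apply pow2_ge_0 | lra]. }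
    assert (0 <= h ^ 2) by apply pow2_ge_0. lra. }
  assert (0 <= h ^ 3) by (apply pow_le; lra).
  assert (0 <= h ^ 4) by (apply pow_le; lra). assert (0 <= h ^ 5) by (apply pow_le; lra). lra.
Qed.

(** The mixed term is positive and dropped; the other two are monotone in [v], so the right end [v']
    is the worst case. *)
Lemma Rm_crude a v v' : 0 < a -> 0 < v <= v' -> v' <= v0 ->
  2 - 4 * (PI * v' ^ 2 / 8) ^ 2 - 3 * exp (- (a * (v0 - v'))) <= Rm a v.
Proof.
  intros Ha Hv Hv'. assert (PB := PI_bounds).
  assert (Hc := cos_bv_range v ltac:(lra)). unfold Rm. cbv zeta. set (c := cos (PI * bv v)) in *.
  assert (V2 : v ^ 2 <= v' ^ 2) by (apply pow_incr; lra).
  assert (C2 : c ^ 2 <= (PI * v' ^ 2 / 8) ^ 2).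
  { apply pow_incr. split; [lra|]. assert (PI * v ^ 2 <= PI * v' ^ 2) by (apply Rmult_le_compat_l; lra). lra. }
  assert (exp (- (a * (v0 - v))) <= exp (- (a * (v0 - v')))).
  { apply exp_le. assert (a * v <= a * v') by (apply Rmult_le_compat_l; lra). lra. }
  assert (0 <= 4 * c * exp (- (a * (wv v - v)))).
  { apply Rmult_le_pos; [lra | left; apply exp_pos]. }
  lra.
Qed.

Lemma hat_crude_lt a v Q rho : 0 < a -> 0 < v <= v0 -> 0 < Q -> 0 < rho < 1 ->
  exp (- (a * v)) <= Q -> exp (- (a * v / 3)) <= rho ->
  12 * Q ^ 2 + 12 * Q ^ 3 + 2 * Q ^ 4 * ((1 + rho) / (1 - rho)) ^ 2 < Rm a v ->
  zsum2 (Ht a v) < zsum2 (Ht a v0).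
Proof.
  intros Ha Hv HQ Hrho Eq Er H.
  assert (M := hat_crude a v Ha Hv). cbv zeta in M.
  set (q := exp (- (a * v))) in *. set (r := exp (- (a * v / 3))) in *.
  assert (Pq : 0 < q) by apply exp_pos. assert (Pr : 0 < r) by apply exp_pos.
  assert (HG : ((1 + r) / (1 - r)) ^ 2 <= ((1 + rho) / (1 - rho)) ^ 2).
  { apply pow_incr. split; [apply Rdiv_le_0_compat; lra|].
    apply Rmult_le_compat; try lra; [left; apply Rinv_0_lt_compat; lra | apply Rinv_le_contravar; lra]. }
  assert (HG0 := pow2_ge_0 ((1 + r) / (1 - r))).
  set (GG := ((1 + r) / (1 - r)) ^ 2) in *. set (GR := ((1 + rho) / (1 - rho)) ^ 2) in *.
  assert (Q2 : q ^ 2 <= Q ^ 2) by (apply pow_incr; lra).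
  assert (Q3 : q ^ 3 <= Q ^ 3) by (apply pow_incr; lra).
  assert (Q4 : q ^ 4 <= Q ^ 4) by (apply pow_incr; lra).
  assert (Q40 : 0 <= q ^ 4) by (apply pow_le; lra).
  assert (q ^ 4 * GG <= Q ^ 4 * GR) by (apply Rmult_le_compat; assumption).
  assert (q * (12 * q ^ 2 + 12 * q ^ 3 + 2 * q ^ 4 * GG) < q * Rm a v) by (apply Rmult_lt_compat_l; lra).
  replace (q * (12 * q ^ 2 + 12 * q ^ 3 + 2 * q ^ 4 * GG))
    with (2 * (6 * q ^ 3 + 6 * q ^ 4 + q ^ 5 * GG)) in H1 by ring.
  lra.
Qed.

Lemma dual_sum_le P b : 0 < P -> 0 <= b <= 1 / 2 ->
  zsum (fun k => exp (- (P * (IZR k + b) ^ 2))) <= (exp (- (P * b ^ 2)) + exp (- (P * (1 - b) ^ 2))) / (1 - exp (- P)).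
Proof.
  intros HP Hb. assert (Ppi := PI_RGT_0). apply zsum_geom_le.
  - apply (gb1_ext (fun k => exp (- PI * (P / PI) * (IZR k + b) ^ 2))).
    + intros k. f_equal. field. lra.
    + apply gb1_gauss. now apply Rdiv_lt_0_compat.
  - now apply exp_neg_lt1.
  - intros n. rewrite exp_mult_nat, <- exp_plus, <- INR_IZR_INZ. apply exp_le.
    assert (N0 := pos_INR n). assert (INR n <= INR n ^ 2).
    { destruct n; [simpl; lra|]. assert (1 <= INR (S n)) by (apply (le_INR 1); lia). nra. }
    assert (0 <= INR n * b) by (apply Rmult_le_pos; lra).
    assert (0 <= P * ((INR n + b) ^ 2 - b ^ 2 - INR n)) by (apply Rmult_le_pos; lra). lra.
  - intros n. rewrite exp_mult_nat, <- exp_plus, opp_IZR, <- INR_IZR_INZ, S_INR. apply exp_le.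
    assert (N0 := pos_INR n). assert (INR n <= INR n ^ 2).
    { destruct n; [simpl; lra|]. assert (1 <= INR (S n)) by (apply (le_INR 1); lia). nra. }
    assert (0 <= INR n * (1 - b)) by (apply Rmult_le_pos; lra).
    assert (0 <= P * ((- (INR n + 1) + b) ^ 2 - (1 - b) ^ 2 - INR n)) by (apply Rmult_le_pos; lra). lra.
  - intros k. left. apply exp_pos.
Qed.

(** Every row is at most its weight times [X = chi sg b 0], and the weights sum to at most 1.01. For
    small [a * v] the Gaussian in [X] is wide, so [X] is estimated through its Poisson dual with
    [s = PI / (a * v) >= 2]. *)
Lemma hat_large_y a v : 3.14 <= a -> 0 < v -> a * v <= 1.57 -> zsum2 (Ht a v) <= 0.7.
Proof.
  intros Ha Hv Hav. assert (PB := PI_bounds).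
  assert (Hv2 : v <= 0.5) by nra.
  set (al := a / PI). assert (Hal : 0 < al) by (apply Rdiv_lt_0_compat; lra).
  assert (Hy : 0 < / v) by now apply Rinv_0_lt_compat.
  replace a with (PI * al) by (unfold al; field; lra).
  rewrite <- thetahat_half by assumption. rewrite thetahat_rows by assumption.
  assert (Eb : b2 (1 / 2) (/ v) = bv v) by (unfold b2, bv; field; lra). rewrite Eb.
  set (b := bv v). assert (V2 : 0 <= v ^ 2 <= 0.25).
  { split; [apply pow2_ge_0|]. apply Rle_trans with (0.5 ^ 2); [apply pow_incr; lra | lra]. }
  assert (Hb : 0.46875 <= b <= 1 / 2) by (unfold b, bv; lra). clearbody b.
  set (sg := al / / v). assert (Esg : sg = a * v / PI) by (unfold sg, al; field; lra).
  assert (Hav0 : 0 < a * v) by (apply Rmult_lt_0_compat; lra).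
  assert (Hsg : 0 < sg) by (rewrite Esg; apply Rdiv_lt_0_compat; lra).
  set (X := chi sg b 0). assert (HX0 : 0 <= X) by (eapply Rle_trans; [apply Rabs_pos | apply (chi_le_0 sg b 0); lra]).
  set (s := / sg). assert (Hs : 2 <= s).
  { unfold s. rewrite Esg. unfold Rdiv. rewrite Rinv_mult, Rinv_inv.
    apply Rmult_le_reg_l with (a * v); [assumption|].
    replace (a * v * (/ (a * v) * PI)) with PI by (field; lra). lra. }
  (* A linear factor in place of the root, so that [mult_exp_decreasing] reduces the estimate to
     [s = 2]. *)
  assert (Hroot : sqrt s <= 0.7073 * s).
  { assert (R2 : 1.414 <= sqrt s).
    { apply Rsqr_incr_0_var; [|apply sqrt_pos]. rewrite Rsqr_sqrt by lra. unfold Rsqr. lra. }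
    assert (sqrt s * sqrt s = s) by (apply sqrt_sqrt; lra).
    assert (1.414 * sqrt s <= sqrt s * sqrt s) by (apply Rmult_le_compat_r; lra). lra. }
  assert (HX : X <= 0.66).
  { assert (E := chi_poisson sg b 0 Hsg ltac:(lra)). fold X in E.
    assert (D := dual_sum_le (PI * s) b ltac:(apply Rmult_lt_0_compat; lra) ltac:(lra)).
    rewrite (zsum_ext _ (fun k => exp (- (PI * s * (IZR k + b) ^ 2)))) in E.
    2:{ intros k. rewrite Rmult_0_r, cos_0, Rmult_1_r. unfold s. f_equal. field. lra. }
    rewrite <- E in D.
    assert (EX : X = sqrt s * (sqrt sg * X)).
    { unfold s. rewrite <- Rmult_assoc, sqrt_inv, Rinv_l; [ring | apply Rgt_not_eq, sqrt_lt_R0; assumption]. }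
    assert (A1 : s * exp (- (PI * s * b ^ 2)) <= 2 * 0.2525).
    { apply Rle_trans with (s * exp (- (0.69 * s))).
      - apply Rmult_le_compat_l; [lra|]. apply exp_le.
        assert (0.46875 ^ 2 <= b ^ 2) by (apply pow_incr; lra).
        assert (3.141 * 0.2197 <= PI * b ^ 2) by (apply Rmult_le_compat; lra).
        assert (0 <= s * (PI * b ^ 2 - 0.69)) by (apply Rmult_le_pos; lra). lra.
      - eapply Rle_trans; [apply (mult_exp_decreasing 2 s 0.69); lra|].
        apply Rmult_le_compat_l; [lra|]. apply (exp_neg_bound 1.38); lra. }
    assert (A2 : s * exp (- (PI * s * (1 - b) ^ 2)) <= 2 * 0.2085).
    { apply Rle_trans with (s * exp (- (0.785 * s))).
      - apply Rmult_le_compat_l; [lra|]. apply exp_le.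
        assert ((1 / 2) ^ 2 <= (1 - b) ^ 2) by (apply pow_incr; lra).
        assert (3.141 * 0.25 <= PI * (1 - b) ^ 2) by (apply Rmult_le_compat; lra).
        assert (0 <= s * (PI * (1 - b) ^ 2 - 0.785)) by (apply Rmult_le_pos; lra). lra.
      - eapply Rle_trans; [apply (mult_exp_decreasing 2 s 0.785); lra|].
        apply Rmult_le_compat_l; [lra|]. apply (exp_neg_bound 1.57); lra. }
    assert (A3 : exp (- (PI * s)) <= 0.002).
    { apply (exp_neg_bound 6.28); [|lra|lra]. split; [lra|].
      assert (3.141 * 2 <= PI * s) by (apply Rmult_le_compat; lra). lra. }
    rewrite EX. apply Rle_trans with (0.7073 * s * ((exp (- (PI * s * b ^ 2)) + exp (- (PI * s * (1 - b) ^ 2))) / (1 - exp (- (PI * s))))).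
    - apply Rmult_le_compat; try assumption; [apply sqrt_pos | apply Rmult_le_pos; [apply sqrt_pos | assumption]].
    - unfold Rdiv. rewrite <- Rmult_assoc. apply (Rle_div_l _ 0.66 (1 - exp (- (PI * s)))); lra. }
  set (t := al * / v). assert (Et : PI * t = a / v) by (unfold t, al; field; lra).
  assert (Hc : 0 < a / v) by (apply Rdiv_lt_0_compat; lra).
  assert (GS := zsum_gauss_le (a / v) Hc).
  set (E := exp (- (a / v))) in *.
  assert (HE : 0 < E <= 0.002).
  { split; [apply exp_pos|]. apply (exp_neg_bound 6.28); [|lra|lra]. split; [lra|].
    apply (Rle_div_r 6.28 a v); lra. }
  assert (HS : zsum (fun k => exp (- (a / v * IZR k ^ 2))) <= 1.01).
  { eapply Rle_trans; [apply GS|]. assert (E / (1 - E ^ 3) <= 0.0025); [|lra].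
    assert (E ^ 3 <= 0.002 ^ 3) by (apply pow_incr; lra). apply Rle_div_l; lra. }
  assert (Gg : gb1 (fun k => exp (- (a / v * IZR k ^ 2)))).
  { apply (gb1_ext (fun k => exp (- PI * t * (IZR k + 0) ^ 2))).
    - intros k. f_equal. rewrite <- Et. ring.
    - apply gb1_gauss. apply Rmult_lt_0_compat; assumption. }
  assert (Bd : forall l, Rabs (sgn l * exp (- PI * t * IZR l ^ 2) * chi sg b (1 / 2 * IZR l)) <= X * exp (- (a / v * IZR l ^ 2))).
  { intros l. rewrite !Rabs_mult. rewrite (Rabs_pos_eq (exp _)) by (left; apply exp_pos).
    replace (- PI * t * IZR l ^ 2) with (- (a / v * IZR l ^ 2)) by (rewrite <- Et; ring).
    assert (C := chi_le_0 sg b (1 / 2 * IZR l) Hsg ltac:(lra)). fold X in C.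
    assert (Sg := Rabs_sgn l). assert (Pe := exp_pos (- (a / v * IZR l ^ 2))).
    rewrite (Rmult_comm X). apply Rmult_le_compat; try apply Rabs_pos; try assumption.
    - apply Rmult_le_pos; [apply Rabs_pos | lra].
    - rewrite <- (Rmult_1_l (exp (- (a / v * IZR l ^ 2)))) at 2. apply Rmult_le_compat_r; lra. }
  apply Rle_trans with (zsum (fun l => X * exp (- (a / v * IZR l ^ 2)))).
  - eapply Rle_trans; [apply Rle_abs|]. apply zsum_abs_le; [|now apply gb1_scal | exact Bd].
    apply (gb1_le _ (fun l => X * exp (- (a / v * IZR l ^ 2)))); [now apply gb1_scal | exact Bd].
  - rewrite zsum_scal.
    assert (0 <= zsum (fun k => exp (- (a / v * IZR k ^ 2)))) by (apply zsum_nonneg; [assumption | intros; left; apply exp_pos]).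
    apply Rle_trans with (0.66 * 1.01); [apply Rmult_le_compat; assumption | lra].
Qed.

(** Only for [v >= 1.05] do the outer shells have to be linearized. Down to 0.9 their absolute
    values stay below the bound of [Rm_near], and then below that of [Rm_crude], as long as
    [a * v >= 1.57]; for smaller [a * v] the sum is at most 0.7, against at least 0.9 at [v0]. *)
Lemma hat_step2 a v : 3.14 <= a -> 0 < v < v0 -> zsum2 (Ht a v) < zsum2 (Ht a v0).
Proof.
  intros Ha Hv. assert (B := v0_bounds). assert (PB := PI_bounds).
  destruct (Rle_lt_dec 1.05 v).
  { assert (M := hat_near a v Ha ltac:(lra)). assert (R := Rm_near a v Ha ltac:(lra)).
    assert (P := exp_pos (- (a * v))). assert (0 < (v0 - v) ^ 2) by (apply pow_lt; lra).
    assert (exp (- (a * v)) * (2 * (v0 - v) ^ 2) < exp (- (a * v)) * Rm a v) by (apply Rmult_lt_compat_l; lra). lra. }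
  destruct (Rle_lt_dec 1 v).
  { assert (R := Rm_near a v Ha ltac:(lra)).
    assert (0.1047 ^ 2 <= (v0 - v) ^ 2) by (apply pow_incr; lra).
    assert (3.14 <= a * v) by nra.
    apply (hat_crude_lt a v 0.0434 0.36); try lra.
    - apply (exp_neg_bound 3.14); lra.
    - apply (exp_neg_bound 1.046); lra. }
  destruct (Rle_lt_dec 0.9 v).
  { assert (R := Rm_near a v Ha ltac:(lra)).
    assert (0.1547 ^ 2 <= (v0 - v) ^ 2) by (apply pow_incr; lra).
    assert (2.826 <= a * v) by nra.
    apply (hat_crude_lt a v 0.0594 0.4); try lra.
    - apply (exp_neg_bound 2.826); lra.
    - apply (exp_neg_bound 0.942); lra. }
  destruct (Rle_lt_dec 0.7 v).
  { assert (R := Rm_crude a v 0.9 ltac:(lra) ltac:(lra) ltac:(lra)).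
    assert (exp (- (a * (v0 - 0.9))) <= 0.46).
    { apply (exp_neg_bound 0.79); [|lra|lra]. nra. }
    assert ((PI * 0.9 ^ 2 / 8) ^ 2 <= 0.32 ^ 2) by (apply pow_incr; lra).
    assert (2.198 <= a * v) by nra.
    apply (hat_crude_lt a v 0.112 0.5); try lra.
    - apply (exp_neg_bound 2.198); lra.
    - apply (exp_neg_bound 0.732); lra. }
  destruct (Rle_lt_dec 1.57 (a * v)).
  { assert (R := Rm_crude a v 0.7 ltac:(lra) ltac:(lra) ltac:(lra)).
    assert (exp (- (a * (v0 - 0.7))) <= 0.25).
    { apply (exp_neg_bound 1.42); [|lra|lra]. nra. }
    assert ((PI * 0.7 ^ 2 / 8) ^ 2 <= 0.2 ^ 2) by (apply pow_incr; lra).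
    apply (hat_crude_lt a v 0.21 0.6); try lra.
    - apply (exp_neg_bound 1.57); lra.
    - apply (exp_neg_bound 0.523); lra. }
  assert (L := hat_large_y a v Ha ltac:(lra) ltac:(lra)). assert (L0 := hat_v0_lower a Ha). lra.
Qed.

Lemma thetahat_step2 v al : 0 < v < v0 -> 1 <= al ->
  thetahat (1 / 2) (/ v) (b1 (1 / 2) (/ v)) (b2 (1 / 2) (/ v)) al
  < thetahat (1 / 2) (/ v0) (b1 (1 / 2) (/ v0)) (b2 (1 / 2) (/ v0)) al.
Proof.
  intros Hv Hal. assert (PB := PI_bounds).
  rewrite !thetahat_half by lra. apply hat_step2; [nra | assumption].
Qed.

(** * Combination of the two deformations *)

Lemma hy_v0 : hy = / v0.
Proof.
  unfold hy, v0. assert (0 < sqrt 3) by (apply sqrt_lt_R0; lra). field. lra.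
Qed.

Lemma inDplus_y x y : inDplus x y -> hy <= y.
Proof.
  intros (Hx & Hy & H). unfold hy.
  assert (H3 : sqrt 3 * sqrt 3 = 3) by (apply sqrt_sqrt; lra).
  apply Rsqr_incr_0_var; [unfold Rsqr | lra].
  assert (x ^ 2 <= (1 / 2) ^ 2) by (apply pow_incr; lra). lra.
Qed.

(** The path runs from [(x, y)] to [(1/2, y)] and then to [(1/2, hy)]. Both legs are strict unless
    trivial, and both cannot be trivial away from the hexagonal point. *)
Lemma large_parameter_lt al x y : 1 <= al -> inDplus x y -> (x, y) <> (hx, hy) ->
  theta x y (b1 x y) (b2 x y) al < theta hx hy (b1 hx hy) (b2 hx hy) al /\
  thetahat x y (b1 x y) (b2 x y) al < thetahat hx hy (b1 hx hy) (b2 hx hy) al.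
Proof.
  intros Hal HD Hne. assert (Hy := inDplus_y x y HD). destruct HD as (Hx & Hy0 & _).
  assert (B := v0_bounds). assert (Ehy := hy_v0).
  assert (Hy1 : 1 / 2 <= hy).
  { rewrite Ehy. apply (Rmult_le_reg_l v0); [lra|]. rewrite Rinv_r; lra. }
  assert (S1 : x < 1 / 2 ->
    theta x y (b1 x y) (b2 x y) al < theta hx y (b1 hx y) (b2 hx y) al /\
    thetahat x y (b1 x y) (b2 x y) al < thetahat hx y (b1 hx y) (b2 hx y) al).
  { intros Hx'. split.
    - apply theta_step1; try assumption; try lra. nra.
    - apply thetahat_step1; try assumption; lra. }
  assert (S2 : hy < y ->
    theta hx y (b1 hx y) (b2 hx y) al < theta hx hy (b1 hx hy) (b2 hx hy) al /\
    thetahat hx y (b1 hx y) (b2 hx y) al < thetahat hx hy (b1 hx hy) (b2 hx hy) al).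
  { intros Hy'. rewrite Ehy. replace y with (/ / y) by (apply Rinv_inv).
    assert (Hv : 0 < / y < v0).
    { split; [now apply Rinv_0_lt_compat|]. rewrite <- (Rinv_inv v0).
      apply Rinv_lt_contravar; [|lra]. apply Rmult_lt_0_compat; [apply Rinv_0_lt_compat|]; lra. }
    split; [now apply theta_step2 | now apply thetahat_step2]. }
  destruct (Rle_lt_or_eq_dec _ _ Hy) as [Hy'|Ey]; destruct (Rle_lt_or_eq_dec x (1 / 2) ltac:(lra)) as [Hx'|Ex].
  - destruct (S1 Hx'), (S2 Hy'). split; lra.
  - subst x. apply S2, Hy'.
  - rewrite <- Ey in *. apply S1, Hx'.
  - exfalso. apply Hne. rewrite Ex, Ey. reflexivity.
Qed.

Lemma strict_maximum al x y : 0 < al -> inDplus x y -> (x, y) <> (hx, hy) ->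
  theta x y (b1 x y) (b2 x y) al < theta hx hy (b1 hx hy) (b2 hx hy) al /\
  thetahat x y (b1 x y) (b2 x y) al < thetahat hx hy (b1 hx hy) (b2 hx hy) al.
Proof.
  intros Hal HD Hne. destruct (Rle_lt_dec 1 al) as [H1|H1]; [now apply large_parameter_lt|].
  assert (Hi : 1 <= / al) by (rewrite <- Rinv_1; apply Rinv_le_contravar; lra).
  assert (Hy := inDplus_y x y HD).
  destruct (large_parameter_lt (/ al) x y Hi HD Hne) as [T1 T2].
  split.
  (* [thetahat] at [/ al] is [al] times [theta] at [al], so the positive factor cancels. *)
  - rewrite !(thetahat_theta _ _ (/ al)), Rinv_inv in T2 by (lra || assumption || apply Rle_refl).
    apply Rmult_lt_reg_r in T2; [assumption|]. rewrite Rinv_inv. assumption.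
  - rewrite !(thetahat_theta _ _ al) by (assumption || apply Rle_refl).
    apply Rmult_lt_compat_r; [apply Rinv_0_lt_compat|]; assumption.
Qed.

Theorem theorem3p1 (alpha x y : R) (Halpha : 0 < alpha) (HD : inDplus x y) :
  theta x y (b1 x y) (b2 x y) alpha <= theta hx hy (b1 hx hy) (b2 hx hy) alpha /\
  thetahat x y (b1 x y) (b2 x y) alpha <= thetahat hx hy (b1 hx hy) (b2 hx hy) alpha /\
  (theta x y (b1 x y) (b2 x y) alpha = theta hx hy (b1 hx hy) (b2 hx hy) alpha
     <-> (x, y) = (hx, hy)) /\
  (thetahat x y (b1 x y) (b2 x y) alpha = thetahat hx hy (b1 hx hy) (b2 hx hy) alpha
     <-> (x, y) = (hx, hy)).
Proof.
  assert (D : (x, y) = (hx, hy) \/ (x, y) <> (hx, hy)).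
  { destruct (Req_dec x hx) as [->|Hx]; [destruct (Req_dec y hy) as [->|Hy]|].
    - now left.
    - right. congruence.
    - right. congruence. }
  destruct D as [E|Hne].
  - injection E as -> ->. repeat split; lra.
  - destruct (strict_maximum alpha x y Halpha HD Hne).
    repeat split; try lra; intros E; try contradiction; lra.
Qed.
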